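(* For Bara\'nski carpets, $\dim_{\mathrm H}K=\dim_{\mathrm B}K$ is a sufficient but not necessary condition for $0<\mathcal{H}^{\dim_{\mathrm H}K}(K)<+\infty$. That is: (i) for every Bara\'nski carpet $K$ with $\dim_{\mathrm H}K=\dim_{\mathrm B}K$ one has $0<\mathcal{H}^{\dim_{\mathrm H}K}(K)<+\infty$; (ii) there exists a Bara\'nski carpet $K$ with $\dim_{\mathrm H}K\neq\dim_{\mathrm B}K$ and $0<\mathcal{H}^{\dim_{\mathrm H}K}(K)<+\infty$.
   Context: Let $r,s,d\ge 2$ be integers with $d\le rs$. For $1\le i\le r$, $1\le j\le s$ let $0<a_i,b_j<1$ with $\sum_{i=1}^r a_i=1$, $\sum_{j=1}^s b_j=1$. Let $\mathcal{J}=\{(i_1,j_1),\dots,(i_d,j_d)\}\subseteq\{1,\dots,r\}\times\{1,\dots,s\}$ be a set of $d$ pairs. For $l=1,\dots,d$ let $\psi_l(x,y)=\big(a_{i_l}x+\sum_{i<i_l}a_i,\; b_{j_l}y+\sum_{j<j_l}b_j\big)$. The Bara\'nski carpet $K$ is the attractor of $\{\psi_1,\dots,\psi_d\}$, i.e. the unique non-empty compact set with $K=\bigcup_{l=1}^d\psi_l(K)$. Standing assumption, made for every Bara\'nski carpet: there is $l$ with $a_{i_l}\ne b_{j_l}$, and $K$ is not contained in any vertical or horizontal line. $\dim_{\mathrm H}$, $\dim_{\mathrm B}$ are Hausdorff and box dimension, and $\mathcal{H}^{t}$ is $t$-dimensional Hausdorff measure. *)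

(* Defs.v *)
From HB Require Import structures.
From mathcomp Require Import all_boot all_order all_algebra.
From mathcomp Require Import all_classical all_reals all_analysis.
Set Implicit Arguments.
Unset Strict Implicit.
Unset Printing Implicit Defensive.
Import Order.TTheory GRing.Theory Num.Theory numFieldNormedType.Exports.
Local Open Scope classical_set_scope.
Local Open Scope ring_scope.

(* The canonical norm on R * R is the sup norm, so the Euclidean distance is
   spelled out; both induce the same topology. *)
Definition edist (R : realType) (p q : R * R) : R :=
  Num.sqrt ((p.1 - q.1) ^+ 2 + (p.2 - q.2) ^+ 2).

(* Extended-real valued: an unbounded set has diameter +oo, the empty set -oo. *)
Definition diam (R : realType) (U : set (R * R)) : \bar R :=
  ereal_sup [set (edist x.1 x.2)%:E | x in U `*` U].

(* The empty set contributes 0 also when t = 0, while a nonempty set then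
   contributes 1 (0 `^ 0 = 1), so that t = 0 gives the counting measure. *)
Definition gauge (R : realType) (t : R) (U : set (R * R)) : \bar R :=
  if `[< U = set0 >] then 0%E else (diam U `^ t)%E.

Definition hausdorff_content (R : realType) (t del : R) (A : set (R * R)) :
    \bar R :=
  ereal_inf [set (\sum_(0 <= k <oo) gauge t (F k))%E | F in
    [set F : nat -> set (R * R) |
      (forall k, (diam (F k) <= del%:E)%E) /\ A `<=` \bigcup_k F k]].

Definition hausdorff_measure (R : realType) (t : R) (A : set (R * R)) :
    \bar R :=
  ereal_sup [set hausdorff_content t del A | del in [set del : R | 0 < del]].

(* Real infimum: for subsets of the plane the set of such t contains every
   t > 2, so the default value of inf is never used. *)
Definition hausdorff_dim (R : realType) (A : set (R * R)) : R :=
  inf [set t : R | 0 <= t /\ hausdorff_measure t A = 0%E].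

(* Least number of sets of diameter at most del covering A, as a real number;
   meaningful for bounded A and del > 0 (otherwise possibly inf set0 = 0). *)
Definition covering_number (R : realType) (del : R) (A : set (R * R)) : R :=
  inf [set n%:R | n in [set n : nat | exists F : 'I_n -> set (R * R),
    (forall i, (diam (F i) <= del%:E)%E) /\ A `<=` \bigcup_i F i]].

(* For bounded A: the box dimension of A exists and equals D. *)
Definition has_box_dim (R : realType) (A : set (R * R)) (D : R) : Prop :=
  (fun del : R => ln (covering_number del A) / - ln del) @ 0^'+ --> D.

Definition baranski_map (R : realType) (r s : nat) (a : 'I_r -> R)
    (b : 'I_s -> R) (p : 'I_r * 'I_s) (x : R * R) : R * R :=
  (a p.1 * x.1 + \sum_(i < r | (i < p.1)%N) a i,
   b p.2 * x.2 + \sum_(j < s | (j < p.2)%N) b j).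

(* The maps are indexed by the chosen pairs themselves rather than by an
   enumeration (i_1, j_1), ..., (i_d, j_d) of them. *)
Definition baranski_attractor (R : realType) (r s : nat) (a : 'I_r -> R)
    (b : 'I_s -> R) (J : {set 'I_r * 'I_s}) (K : set (R * R)) : Prop :=
  [/\ K !=set0, compact K &
      K = \bigcup_(p in [set p | p \in J]) (baranski_map a b p @` K)].

Record baranski_system (R : realType) (r s d : nat) (a : 'I_r -> R)
    (b : 'I_s -> R) (J : {set 'I_r * 'I_s}) : Prop := BaranskiSystem {
  baranski_r_ge2 : (2 <= r)%N;
  baranski_s_ge2 : (2 <= s)%N;
  baranski_d_ge2 : (2 <= d)%N;
  baranski_d_le : (d <= r * s)%N;
  baranski_a_itv : forall i, 0 < a i < 1;
  baranski_b_itv : forall j, 0 < b j < 1;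
  baranski_a_sum : \sum_(i < r) a i = 1;
  baranski_b_sum : \sum_(j < s) b j = 1;
  baranski_card : #|J| = d
}.

Definition is_baranski_carpet (R : realType) (K : set (R * R)) : Prop :=
  exists (r s d : nat) (a : 'I_r -> R) (b : 'I_s -> R)
         (J : {set 'I_r * 'I_s}),
  [/\ baranski_system d a b J,
      baranski_attractor a b J K,
      exists2 p, p \in J & a p.1 != b p.2,
      forall c : R, ~ (K `<=` [set x | x.1 = c]) &
      forall c : R, ~ (K `<=` [set x | x.2 = c])].

(* Main.v *)
(** For a Baranski carpet let [tA] be the dimension of the projection to the
    first axis (sum of [a_i ^ tA] over the nonempty columns equal to 1), let [eA]
    solve [sum over J of a_i ^ tA * b_j ^ eA = 1], and let [tB], [eB] be the same
    with the axes exchanged; put [DA = tA + eA], [DB = tB + eB], [D = max DA DB].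
    At every scale the carpet is covered by approximate squares: a word [omega]
    over [J] followed by a word [tau] of columns (if the rectangle of [omega] is
    wider than high) or of rows (otherwise), stopped when the sides agree.  The
    weights [p_omega * q_tau], with [p = a ^ tA * b ^ eA] and [q = a ^ tA], sum to
    at most 1 and are comparable to [delta ^ DA]; hence [H^D(K) < oo], and
    conversely a distribution with law [p] down to height [delta] and column
    law [q] afterwards shows that the box dimension is [D].

    If [DA = D] and all column sums of [b_j ^ eA] equal 1, then [p] itself
    projects to [q], so the product measure charges each approximate square with
    at most [delta ^ D] and [H^D(K) > 0]; similarly for rows.  If neither holds,
    tilting the weights (replacing [p] by geometric means of [p] with other
    weights) makes some scale of every code efficient in dimension [D - eps].
    A code inefficient at all late scales would be typical for [p] up to the end
    of [omega] and typical for [q] on [tau]; but [tau] is an initial part of a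
    later [omega], where the logarithms of the column sums have the opposite
    drift.  So [dim_H K < D], contradicting equality of the dimensions.

    For the second part, take a carpet with uniform columns ([DA = 3/2]) and
    [DB > DA].  The codes which are infinitely often wider than high are covered
    at their first return with total weight at most 1, while the others use thin
    columns so often that they have dimension less than [3/2]. *)
From HB Require Import structures.
From mathcomp Require Import all_boot all_order all_algebra.
From mathcomp Require Import all_classical all_reals all_analysis.
From mathcomp Require Import ring lra.
Require Import Defs.
Set Implicit Arguments.
Unset Strict Implicit.
Unset Printing Implicit Defensive.
Import Order.TTheory GRing.Theory Num.Theory numFieldNormedType.Exports.
Local Open Scope classical_set_scope.
Local Open Scope ring_scope.

(** * Words, stopped words and Kraft inequalities *)

(** No measure on the code space is built. Upper bounds are Kraft sums over finite families of
    words, lower bounds are expectations over words of one finite length, and compactness reduces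
    covers to finite ones. In place of a law of large numbers there are finitely many tilted
    weights, whose failure gives linear inequalities between sums along a code. The drift comes from
    relative entropy: the column law of [p] is [q] times the column sum of the [b_j ^ eA], so the
    logarithm of that sum is a log-likelihood ratio, with positive mean under the first law and
    negative mean under [q] unless the two agree. The obstacle is a code whose rectangles alternate
    between wide and high. A geometric mean with the law of the other axis excludes it: its failure
    puts a linear gap between the logarithms of the sides, while one letter changes their difference
    by a bounded amount. The same gap makes [tau] at least proportional to [omega] in length, so
    that losses on [omega] can be absorbed. A letter with [a_i <> b_j] separates the two laws. *)

Section Words.
Variable R : realType.

Definition wprod (T : Type) (f : T -> R) (u : seq T) : R := \prod_(x <- u) f x.

Lemma wprod_nil T (f : T -> R) : wprod f [::] = 1.
Proof. exact: big_nil. Qed.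

Lemma wprod_cons T (f : T -> R) x u : wprod f (x :: u) = f x * wprod f u.
Proof. exact: big_cons. Qed.

Lemma wprod_cat T (f : T -> R) u v : wprod f (u ++ v) = wprod f u * wprod f v.
Proof. exact: big_cat. Qed.

Lemma wprod_rcons T (f : T -> R) u x : wprod f (rcons u x) = wprod f u * f x.
Proof. by rewrite -cats1 wprod_cat wprod_cons wprod_nil mulr1. Qed.

Lemma wprod_map S T (h : S -> T) (f : T -> R) u :
  wprod f (map h u) = wprod (f \o h) u.
Proof. exact: big_map. Qed.

Lemma wprod_ge0 T (f : T -> R) u : (forall x, 0 <= f x) -> 0 <= wprod f u.
Proof. by move=> f0; apply: prodr_ge0. Qed.

Lemma wprod_gt0 T (f : T -> R) u : (forall x, 0 < f x) -> 0 < wprod f u.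
Proof. by move=> f0; apply: prodr_gt0. Qed.

Lemma wprod_le_expr (T : eqType) (f : T -> R) c u :
  (forall x, 0 <= f x <= c) -> wprod f u <= c ^+ size u.
Proof.
move=> fc; elim: u => [|x u IH]; first by rewrite wprod_nil expr0.
have /andP[f0 fx] := fc x.
rewrite wprod_cons exprS ler_pM//; apply: wprod_ge0 => y.
by have /andP[] := fc y.
Qed.

Lemma ln_wprod T (f : T -> R) u :
  (forall x, 0 < f x) -> ln (wprod f u) = \sum_(x <- u) ln (f x).
Proof.
move=> f0; elim: u => [|x u IH]; first by rewrite wprod_nil ln1 big_nil.
by rewrite wprod_cons big_cons lnM ?posrE ?IH// wprod_gt0.
Qed.

Lemma wprodM T (f g : T -> R) u :
  wprod (fun x => f x * g x) u = wprod f u * wprod g u.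
Proof. exact: big_split. Qed.

Lemma wprod_powR T (f : T -> R) t u : (forall x, 0 < f x) ->
  wprod (fun x => f x `^ t) u = wprod f u `^ t.
Proof.
move=> f0; elim: u => [|x u IH]; first by rewrite !wprod_nil powR1.
by rewrite !wprod_cons IH powRM ?ltW// wprod_gt0.
Qed.

(* [u] is the first prefix of the path at which the running product [th * f ..]
   has dropped to [d] or below. *)
Fixpoint stopped T (f : T -> R) (d th : R) (u : seq T) : bool :=
  if u is x :: v then (d < th) && stopped f d (th * f x) v else th <= d.

Lemma stopped_le T (f : T -> R) d th u :
  stopped f d th u -> th * wprod f u <= d.
Proof.
elim: u th => [|x u IH] th /=; first by rewrite wprod_nil mulr1.
by case/andP=> _ /IH; rewrite wprod_cons mulrA.
Qed.

(** The last letter is read while the product still exceeds [d], so the overshoot is a factor of at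
    least [c]; the hypothesis [c * d <= th] covers the empty word. *)
Lemma stopped_ge T (f : T -> R) d c th u :
  0 < d -> 0 <= c -> (forall x, c <= f x) -> c * d <= th ->
  stopped f d th u -> c * d <= th * wprod f u.
Proof.
move=> d0 c0 fc; elim: u th => [|x u IH] th /=; first by rewrite wprod_nil mulr1.
move=> _ /andP[dth su]; rewrite wprod_cons mulrA; apply: IH su.
by rewrite mulrC ler_pM// ltW.
Qed.

Lemma stopped_prefix (T : eqType) (f : T -> R) d th u v :
  stopped f d th u -> stopped f d th v -> prefix u v -> u = v.
Proof.
elim: u v th => [|x u IH] [|y v] th //=.
  by move=> h1 /andP[/lt_le_trans/(_ h1)]; rewrite ltxx.
by move=> /andP[_ su] /andP[_ sv] /andP[/eqP xy puv]; subst y; rewrite (IH v (th * f x)).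
Qed.

Lemma stopped_exists (T : eqType) (f : T -> R) d th c w :
  0 <= th -> (forall x, 0 <= f x <= c) -> th * c ^+ size w <= d ->
  exists2 u, prefix u w & stopped f d th u.
Proof.
move=> th0 fc; elim: w th th0 => [|x w IH] th th0.
  by rewrite expr0 mulr1 => ?; exists [::].
move=> hd; have [thd|thd] := leP th d; first by exists [::].
have /andP[f0 fx] := fc x.
have [||u pu su] := IH (th * f x); first exact: mulr_ge0.
  apply: le_trans hd; rewrite /= exprS mulrA ler_wpM2r ?exprn_ge0//.
    exact: le_trans fx.
  by rewrite ler_wpM2l.
by exists (x :: u) => /=; rewrite ?eqxx ?thd.
Qed.

Lemma stopped_mkseq (T : eqType) (f : T -> R) d th c (w : nat -> T) :
  0 < d -> 0 <= th -> 0 <= c < 1 -> (forall x, 0 <= f x <= c) ->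
  exists n, stopped f d th (mkseq w n).
Proof.
move=> d0 th0 /andP[c0 c1] fc.
have cvg0 : (fun n => th * c ^+ n) @ \oo --> th * (0 : R).
  by apply: cvgMr; apply: cvg_expr; rewrite ger0_norm.
have [N hN] : exists N, th * c ^+ N <= d.
  rewrite mulr0 in cvg0.
  have /cvgrPdist_le/(_ _ d0) [N _ /(_ N (leqnn N))] := cvg0.
  rewrite sub0r normrN => hN; exists N.
  by apply: le_trans hN; exact: ler_norm.
have [|u pu su] := @stopped_exists _ f d th c (mkseq w N) th0 fc.
  by rewrite size_mkseq.
exists (size u); move: pu; rewrite prefixE => /eqP pu.
suff -> : mkseq w (size u) = u by [].
rewrite -{2}pu /mkseq -map_take take_iota; congr (map w (iota 0 _)).
have : (size u <= N)%N by rewrite -pu size_take size_mkseq; case: ltnP => // /ltnW.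
by move/minn_idPl.
Qed.

Definition prefix_free (T : eqType) (S : seq (seq T)) : Prop :=
  forall u v, u \in S -> v \in S -> prefix u v -> u = v.

Let tails (T : eqType) (S : seq (seq T)) x : seq (seq T) :=
  [seq behead u | u <- S & ohead u == Some x].

Lemma mem_tails (T : eqType) (S : seq (seq T)) x u :
  (u \in tails S x) = (x :: u \in S).
Proof.
apply/mapP/idP => [[[|y v]]|h]; rewrite ?mem_filter//=.
  by move=> /andP[/eqP[<-] ?] ->.
by exists (x :: u) => //; rewrite mem_filter /= eqxx.
Qed.

Lemma tails_uniq (T : eqType) (S : seq (seq T)) x : uniq S -> uniq (tails S x).
Proof.
move=> uS; rewrite map_inj_in_uniq ?filter_uniq//.
move=> [|y u] [|z v]; rewrite !mem_filter//= => /andP[/eqP[<-] _] /andP[/eqP[<-] _].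
by move=> ->.
Qed.

Lemma sum_tails (T : finType) (S : seq (seq T)) (F : seq T -> R) : uniq S ->
  \sum_(u <- S) F u =
  (if [::] \in S then F [::] else 0) +
  \sum_(x : T) \sum_(u <- tails S x) F (x :: u).
Proof.
move=> uS.
rewrite (bigID (fun u => u == [::])) /=; congr (_ + _).
  rewrite -big_filter; case: ifP => hS; last first.
    rewrite big_filter big_seq_cond big1// => u /andP[uS' /eqP u0].
    by rewrite -u0 uS' in hS.
  rewrite (_ : [seq _ <- _ | _] = [:: [::]]) ?big_seq1//.
  apply/perm_small_eq => //; apply: uniq_perm => //; first exact: filter_uniq.
  by move=> u; rewrite mem_filter inE; case: eqP => // ->.
have tail_sum x : \sum_(u <- tails S x) F (x :: u) =
    \sum_(u <- S | ohead u == Some x) F u.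
  rewrite big_map big_filter; apply: eq_bigr => -[|y u]//= /eqP[->]//.
under [RHS]eq_bigr => x _ do rewrite tail_sum.
under [RHS]eq_bigr => x _ do rewrite big_mkcond /=.
rewrite exchange_big /= big_mkcond /=; apply: eq_bigr => -[|y u] _ /=.
  by rewrite big1.
rewrite (bigD1 y)//= eqxx big1 ?addr0// => x xy.
by case: eqP => // -[yx]; rewrite yx eqxx in xy.
Qed.

(** Induction on the maximal length, splitting a family by first letters. [F] need not be
    multiplicative: besides products of weights, [count_stopped] uses lengths of intervals clipped
    to a window. *)
Lemma kraft (T : finType) (F : seq T -> R) (S : seq (seq T)) :
  (forall u, 0 <= F u) -> (forall u, \sum_x F (rcons u x) <= F u) ->
  uniq S -> prefix_free S -> \sum_(u <- S) F u <= F [::].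
Proof.
move=> F0 FS uS pS.
have [n] : exists n, forall u, u \in S -> (size u < n)%N.
  exists (\max_(u <- S) size u).+1 => u uinS; rewrite ltnS.
  exact: (@leq_bigmax_seq _ _ xpredT size).
elim: n F S F0 FS uS pS => [|n IH] F S F0 FS uS pS hS.
  by case: S uS pS hS => [|u S] _ _ hS; [rewrite big_nil|have := hS u (mem_head _ _)].
have [nilS|nilS] := boolP ([::] \in S).
  rewrite (_ : S = [:: [::]]) ?big_seq1//; apply/perm_small_eq => //.
  apply: uniq_perm => // u; rewrite inE; apply/idP/eqP => [uinS|->//].
  by apply/esym/pS => //; rewrite prefix0s.
rewrite sum_tails// (negPf nilS) add0r.
apply: le_trans (FS [::]); apply: ler_sum => x _.
apply: (IH (fun u => F (x :: u))) => [u|u||u v|u].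
- exact: F0.
- exact: (FS (x :: u)).
- exact: tails_uniq.
- rewrite !mem_tails => uS' vS' uv.
  by have [] // : x :: u = x :: v by apply: pS => //=; rewrite eqxx.
- by rewrite mem_tails => /hS.
Qed.

Lemma kraft_wprod (T : finType) (f : T -> R) (S : seq (seq T)) :
  (forall x, 0 <= f x) -> \sum_x f x <= 1 ->
  uniq S -> prefix_free S -> \sum_(u <- S) wprod f u <= 1.
Proof.
move=> f0 f1 uS pS; rewrite -(wprod_nil f); apply: kraft => // u.
  exact: wprod_ge0.
under eq_bigr do rewrite wprod_rcons.
by rewrite -mulr_sumr ler_piMr// wprod_ge0.
Qed.

(** The words of length [n] have total weight at most [rho ^+ n]. A weight of mass less than 1 thus
    pays for words of all lengths at once, where Kraft's inequality would need a prefix-free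
    family. *)
Lemma sum_wprod_geometric (T : finType) (f : T -> R) rho (S : seq (seq T)) :
  (forall x, 0 <= f x) -> \sum_x f x <= rho -> rho < 1 ->
  uniq S -> \sum_(u <- S) wprod f u <= (1 - rho)^-1.
Proof.
move=> f0 f1 rho1 uS.
have rho0 : 0 <= rho by apply: le_trans f1; apply: sumr_ge0.
have h0 : 0 < 1 - rho by rewrite subr_gt0.
have [n] : exists n, forall u, u \in S -> (size u < n)%N.
  exists (\max_(u <- S) size u).+1 => u uinS; rewrite ltnS.
  exact: (@leq_bigmax_seq _ _ xpredT size).
elim: n S uS => [|n IH] S uS hS.
  case: S uS hS => [|u S] _ hS; last by have := hS u (mem_head _ _).
  by rewrite big_nil invr_ge0 ltW.
rewrite sum_tails// wprod_nil.
under eq_bigr => x _ do under eq_bigr do rewrite wprod_cons.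
under eq_bigr => x _ do rewrite -mulr_sumr.
have -> : (1 - rho)^-1 = 1 + rho * (1 - rho)^-1 by field; rewrite gt_eqF.
apply: lerD; first by case: ifP.
apply: (@le_trans _ _ (\sum_x f x * (1 - rho)^-1)).
  apply: ler_sum => x _; rewrite ler_wpM2l// IH ?tails_uniq// => u.
  by rewrite mem_tails => /hS.
by rewrite -mulr_suml ler_wpM2r// invr_ge0 ltW.
Qed.

(** For a fixed first word the second words stop at a common threshold, so they are prefix-free and
    weigh at most 1. The bound [B] for the first words is left open: it is a Kraft sum or a
    geometric series. *)
Lemma sum_wprod_pairs (I C : finType) (p : I -> R) (q : C -> R) B
    (G : pred (seq I)) (f : C -> R) (d th : seq I -> R)
    (S : seq (seq I * seq C)) :
  (forall x, 0 <= p x) -> (forall c, 0 <= q c) -> \sum_c q c <= 1 ->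
  (forall W : seq (seq I), uniq W -> (forall w, w \in W -> G w) ->
     \sum_(w <- W) wprod p w <= B) ->
  uniq S -> (forall z, z \in S -> G z.1 && stopped f (d z.1) (th z.1) z.2) ->
  \sum_(z <- S) wprod p z.1 * wprod q z.2 <= B.
Proof.
move=> p0 q0 q1 pB uS hS.
pose W := undup [seq z.1 | z <- S].
have zW z : z \in S -> z.1 \in W by move=> zS; rewrite mem_undup map_f.
have -> : \sum_(z <- S) wprod p z.1 * wprod q z.2 =
    \sum_(w <- W) wprod p w * \sum_(u <- [seq z.2 | z <- S & z.1 == w]) wprod q u.
  under [RHS]eq_bigr => w _ do rewrite big_map big_filter mulr_sumr big_mkcond /=.
  rewrite exchange_big /= big_seq [RHS]big_seq; apply: eq_bigr => z zS.
  rewrite (bigD1_seq z.1) ?undup_uniq//=; last exact: zW.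
  by rewrite eqxx big1 ?addr0// => w; rewrite eq_sym => /negPf ->.
apply: le_trans (pB W (undup_uniq _) _); last first.
  by move=> w; rewrite mem_undup => /mapP[z /hS /andP[? _] ->].
apply: ler_sum => w _; rewrite ler_piMr ?wprod_ge0//.
apply: kraft_wprod => //.
  rewrite map_inj_in_uniq ?filter_uniq// => -[z1 z2] [y1 y2].
  by rewrite !mem_filter /= => /andP[/eqP -> _] /andP[/eqP -> _] ->.
move=> u v /mapP[y]; rewrite mem_filter => /andP[/eqP yw /hS /andP[_ sy] ->].
move=> /mapP[z]; rewrite mem_filter => /andP[/eqP zw /hS /andP[_ sz] ->].
by apply: stopped_prefix; [exact: sy|rewrite yw -zw].
Qed.

End Words.

(** * Hausdorff measure through explicit covers *)

Section Hausdorff.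
Variable R : realType.
Implicit Types (x y : R * R) (A B U K : set (R * R)) (s t d del : R).

Lemma edistxx x : edist x x = 0.
Proof. by rewrite /edist !subrr expr0n /= addr0 sqrtr0. Qed.

Lemma edist_le x y d : 0 <= d -> `|x.1 - y.1| <= d -> `|x.2 - y.2| <= d ->
  edist x y <= 2 * d.
Proof.
move=> d0 h1 h2; rewrite /edist.
have -> : 2 * d = Num.sqrt ((2 * d) ^+ 2) by rewrite sqrtr_sqr ger0_norm ?mulr_ge0.
apply: ler_wsqrtr; rewrite -[(x.1 - y.1) ^+ 2]real_normK ?num_real//.
rewrite -[(x.2 - y.2) ^+ 2]real_normK ?num_real//.
have := normr_ge0 (x.1 - y.1); have := normr_ge0 (x.2 - y.2); nra.
Qed.

Lemma edist_ge1 x y : `|x.1 - y.1| <= edist x y.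
Proof.
rewrite /edist -[`|_|]ger0_norm// -sqrtr_sqr real_normK ?num_real//.
by apply: ler_wsqrtr; rewrite lerDl sqr_ge0.
Qed.

Lemma edist_ge2 x y : `|x.2 - y.2| <= edist x y.
Proof.
rewrite /edist -[`|_|]ger0_norm// -sqrtr_sqr real_normK ?num_real//.
by apply: ler_wsqrtr; rewrite lerDr sqr_ge0.
Qed.

Lemma diam_le U d : (forall x y, U x -> U y -> edist x y <= d) ->
  (diam U <= d%:E)%E.
Proof.
by move=> h; apply: ge_ereal_sup => _ [[x y] [/= Ux Uy] <-]; rewrite lee_fin h.
Qed.

Lemma edist_le_diam U d x y : (diam U <= d%:E)%E -> U x -> U y -> edist x y <= d.
Proof.
move=> h Ux Uy; rewrite -lee_fin; apply: le_trans h.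
by apply: ereal_sup_ubound; exists (x, y).
Qed.

Lemma diam_ge0 U : U !=set0 -> (0 <= diam U)%E.
Proof.
by case=> x Ux; apply: ereal_sup_ubound; exists (x, x) => //=; rewrite edistxx.
Qed.

Lemma gauge_ge0 t U : (0 <= gauge t U)%E.
Proof. by rewrite /gauge; case: ifP => // _; exact: poweR_ge0. Qed.

Lemma gauge0 t : gauge t (set0 : set (R * R)) = 0%E.
Proof. by rewrite /gauge; case: asboolP. Qed.

Lemma gauge_nonempty t U d : U !=set0 -> (diam U <= d%:E)%E ->
  gauge t U = (fine (diam U) `^ t)%:E /\ 0 <= fine (diam U) <= d.
Proof.
move=> U0 Ud; rewrite /gauge; case: asboolP => [UE|_].
  by case: U0 => x; rewrite UE.
have := diam_ge0 U0; move: Ud; case: (diam U) => [r| |]//=.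
by rewrite !lee_fin => -> ->.
Qed.

Lemma gauge_le t U d : 0 <= t -> 0 <= d -> (diam U <= d%:E)%E ->
  (gauge t U <= (d `^ t)%:E)%E.
Proof.
move=> t0 d0 Ud; have [->|/set0P U0] := eqVneq U set0.
  by rewrite gauge0 lee_fin powR_ge0.
have [-> /andP[r0 rd]] := gauge_nonempty t U0 Ud.
by rewrite lee_fin ge0_ler_powR.
Qed.

Lemma gauge_le_expo s t U d : 0 <= s -> s < t -> (diam U <= d%:E)%E ->
  (gauge t U <= (d `^ (t - s))%:E * gauge s U)%E.
Proof.
move=> s0 st Ud; have [->|/set0P U0] := eqVneq U set0.
  by rewrite !gauge0 mule0.
have [-> /andP[r0 rd]] := gauge_nonempty t U0 Ud.
have [-> _] := gauge_nonempty s U0 Ud.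
rewrite -EFinM lee_fin; set r := fine _ in r0 rd *.
have -> : t = (t - s) + s by rewrite subrK.
rewrite powRD; last by rewrite subrK gt_eqF// (le_lt_trans s0).
rewrite subrK; apply: ler_wpM2r; first exact: powR_ge0.
by rewrite ge0_ler_powR ?nnegrE ?subr_ge0 ?(ltW st)// (le_trans r0).
Qed.

(** Real costs with bounded partial sums replace the extended-real series of [hausdorff_content], so
    that covers are combined by real arithmetic. *)
Definition cov t del (M : R) A : Prop :=
  exists (F : nat -> set (R * R)) (c : nat -> R),
  [/\ forall k, (diam (F k) <= del%:E)%E,
      forall k, (gauge t (F k) <= (c k)%:E)%E,
      forall n, \sum_(k < n) c k <= M & A `<=` \bigcup_k F k].

Lemma cov_content t del M A : cov t del M A ->
  (hausdorff_content t del A <= M%:E)%E.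
Proof.
case=> F [c [Fd Fc cM AF]].
apply: (@le_trans _ _ (\sum_(0 <= k <oo) gauge t (F k))%E).
  by apply: ereal_inf_lbound; exists F.
apply: lime_le; first by apply: is_cvg_nneseries => n _ _; exact: gauge_ge0.
apply: nearW => n; rewrite big_mkord.
apply: (@le_trans _ _ (\sum_(k < n) (c k)%:E)%E); first exact: lee_sum.
by rewrite sumEFin lee_fin.
Qed.

Lemma content_cov t del M A : (hausdorff_content t del A < M%:E)%E ->
  cov t del M A.
Proof.
move=> /ereal_inf_lt[_ [F [/= Fd AF] <-] Fsum].
have sumF n : (\sum_(0 <= k < n) gauge t (F k) < M%:E)%E.
  apply: le_lt_trans Fsum; apply: nneseries_lim_ge => k _ _; exact: gauge_ge0.
have fink k : gauge t (F k) \is a fin_num.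
  rewrite ge0_fin_numE ?gauge_ge0//; apply: (@lt_trans _ _ M%:E); last exact: ltry.
  apply: le_lt_trans (sumF k.+1); rewrite big_nat_recr//= leeDr//.
  by apply: sume_ge0 => i _; exact: gauge_ge0.
exists F, (fun k => fine (gauge t (F k))); split => // [k|n].
  by rewrite fineK.
rewrite -lee_fin -sumEFin; apply: le_trans (ltW (sumF n)).
by rewrite big_mkord; apply: lee_sum => k _; rewrite fineK.
Qed.

Lemma hausdorff_content_ge0 t del A : (0 <= hausdorff_content t del A)%E.
Proof.
apply: le_ereal_inf_tmp => _ [F _ <-]; apply: nneseries_ge0 => k _ _.
exact: gauge_ge0.
Qed.

Lemma hausdorff_measure_ge0 t A : (0 <= hausdorff_measure t A)%E.
Proof.
apply: le_trans (hausdorff_content_ge0 t 1 A) _.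
by apply: ereal_sup_ubound; exists 1 => //=.
Qed.

Lemma content_le_measure t del A : 0 < del ->
  (hausdorff_content t del A <= hausdorff_measure t A)%E.
Proof. by move=> d0; apply: ereal_sup_ubound; exists del. Qed.

Lemma cov_sub t del M A B : A `<=` B -> cov t del M B -> cov t del M A.
Proof.
by move=> AB [F [c [h1 h2 h3 h4]]]; exists F, c; split => //; exact: subset_trans AB _.
Qed.

Lemma cov_mesh t del del' M A : del <= del' -> cov t del M A -> cov t del' M A.
Proof.
move=> dd [F [c [h1 h2 h3 h4]]]; exists F, c; split => // k.
by apply: le_trans (h1 k) _; rewrite lee_fin.
Qed.

Lemma hausdorff_measure_le t M del0 A : 0 < del0 ->
  (forall del, 0 < del -> del <= del0 -> cov t del M A) ->
  (hausdorff_measure t A <= M%:E)%E.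
Proof.
move=> d0 h; apply: ge_ereal_sup => _ [del /= del_gt0 <-].
apply: cov_content; apply: (@cov_mesh _ (Num.min del del0)).
  by rewrite ge_min lexx.
by apply: h; rewrite ?lt_min ?del_gt0// ge_min lexx orbT.
Qed.

Lemma cov_expo s t del M A : 0 <= s -> s < t ->
  cov s del M A -> cov t del (del `^ (t - s) * M) A.
Proof.
move=> s0 st [F [c [h1 h2 h3 h4]]].
exists F, (fun k => del `^ (t - s) * c k); split => // [k|n].
  apply: le_trans (gauge_le_expo s0 st (h1 k)) _.
  by rewrite EFinM lee_wpmul2l// lee_fin powR_ge0.
by rewrite -mulr_sumr ler_wpM2l// powR_ge0.
Qed.

Lemma cov_setU t del M N A B :
  cov t del M A -> cov t del N B -> cov t del (M + N) (A `|` B).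
Proof.
move=> [F [c [h1 h2 h3 h4]]] [G [e [k1 k2 k3 k4]]].
exists (fun k => if odd k then G k./2 else F k./2).
exists (fun k => if odd k then e k./2 else c k./2); split.
- by move=> k; case: ifP.
- by move=> k; case: ifP.
- move=> n.
  have c0 k : 0 <= c k by rewrite -lee_fin; apply: le_trans (h2 k); exact: gauge_ge0.
  have e0 k : 0 <= e k by rewrite -lee_fin; apply: le_trans (k2 k); exact: gauge_ge0.
  pose f k := if odd k then e k./2 else c k./2.
  have f0 k : 0 <= f k by rewrite /f; case: ifP.
  apply: (@le_trans _ _ (\sum_(k < n.*2) f k)).
    have fE m : \sum_(k < m) f k = \sum_(0 <= k < m) f k by rewrite big_mkord.
    rewrite -/(\sum_(k < n) f k) !fE -addnn.
    by rewrite (@big_cat_nat _ _ _ n 0 (n + n)) ?leq_addr//= lerDl sumr_ge0.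
  have -> : \sum_(k < n.*2) f k = \sum_(k < n) c k + \sum_(k < n) e k.
    elim: n => [|n IH]; first by rewrite !big_ord0 addr0.
    rewrite doubleS 2!big_ord_recr /= IH /f /= odd_double /= doubleK uphalf_double.
    by rewrite !big_ord_recr /=; ring.
  exact: lerD.
- move=> x [/h4[k _ Fk]|/k4[k _ Gk]].
    by exists k.*2 => //; rewrite odd_double doubleK.
  by exists k.*2.+1 => //; rewrite /= odd_double /= uphalf_double.
Qed.

Lemma cov_countable (T : countType) (P : pred T) (F : T -> set (R * R))
    (c : T -> R) t del M A : 0 < del ->
  (forall z, 0 <= c z) -> (forall z, P z -> (diam (F z) <= del%:E)%E) ->
  (forall z, P z -> (gauge t (F z) <= (c z)%:E)%E) ->
  (forall S, uniq S -> (forall z, z \in S -> P z) -> \sum_(z <- S) c z <= M) ->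
  (forall x, A x -> exists2 z, P z & F z x) -> cov t del M A.
Proof.
move=> del0 c0 Fd Fc cM AF.
pose u k := if @pickle_inv T k is Some z then if P z then Some z else None else None.
exists (fun k => if u k is Some z then F z else set0).
exists (fun k => if u k is Some z then c z else 0); split.
- move=> k; rewrite /u; case: pickle_inv => [z|]; last first.
    by apply: diam_le => ? ? [].
  by case: ifP => [/Fd //|_]; apply: diam_le => ? ? [].
- move=> k; rewrite /u; case: pickle_inv => [z|]; last by rewrite gauge0.
  by case: ifP => [/Fc //|_]; rewrite gauge0.
- move=> n; rewrite -(big_mkord xpredT (fun k => if u k is Some z then c z else 0)).
  rewrite (_ : \sum_(0 <= _ < n) _ = \sum_(z <- pmap u (index_iota 0 n)) c z).
    apply: cM.
      apply: (@pmap_uniq _ _ _ pickle) (iota_uniq _ _) => k.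
      rewrite /u; have := @pickle_invK T k; case: pickle_inv => //= z <-.
      by case: ifP.
    move=> z; rewrite mem_pmap => /mapP[k _]; rewrite /u.
    by case: pickle_inv => // y; case: ifP => // + [->].
  elim: (index_iota 0 n) => [|k w IH]; first by rewrite !big_nil.
  by rewrite big_cons IH /=; case: (u k) => [z|]//=; rewrite ?big_cons ?add0r.
- move=> x /AF[z Pz Fz]; exists (pickle z) => //.
  by rewrite /u pickleK_inv Pz.
Qed.

Lemma hausdorff_measure0 s t A : 0 <= s -> s < t ->
  (hausdorff_measure s A < +oo)%E -> hausdorff_measure t A = 0%E.
Proof.
move=> s0 st Aoo; have := hausdorff_measure_ge0 s A.
case E : (hausdorff_measure s A) Aoo => [M| |]// _; rewrite lee_fin => M0.
apply/eqP; rewrite eq_le hausdorff_measure_ge0 andbT.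
apply/lee_addgt0Pr => e e0; rewrite add0e.
have M1 : 0 < M + 1 by rewrite ltr_wpDl.
have ts : 0 < t - s by rewrite subr_gt0.
(* The mesh at which the factor gained by raising the exponent from [s] to [t] is at most
   [e / (M + 1)]. *)
pose d0 := (e / (M + 1)) `^ (t - s)^-1.
have d00 : 0 < d0 by rewrite powR_gt0 // divr_gt0.
apply: (@hausdorff_measure_le _ _ d0) => // del del_gt0 deld0.
have : cov s del (M + 1) A.
  apply: content_cov; apply: le_lt_trans (content_le_measure s A del_gt0) _.
  by rewrite E lte_fin ltrDl.
move/(cov_expo s0 st) => [F [c [h1 h2 h3 h4]]]; exists F, c; split => // n.
apply: le_trans (h3 n) _; rewrite -ler_pdivlMr//.
have -> : e / (M + 1) = d0 `^ (t - s).
  by rewrite /d0 -powRrM mulVf ?gt_eqF// powRr1// ltW// divr_gt0.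
by apply: ge0_ler_powR; rewrite ?nnegrE //; apply: ltW.
Qed.

Lemma hausdorff_dim_le s A : 0 <= s -> (hausdorff_measure s A < +oo)%E ->
  hausdorff_dim A <= s.
Proof.
move=> s0 As; apply/ler_addgt0Pr => e e0; apply: ge_inf.
  by exists 0 => t [].
by split; [exact: addr_ge0 s0 (ltW e0)|apply: (hausdorff_measure0 s0) As; rewrite ltrDl].
Qed.

Lemma hausdorff_dim_eq s A : 0 <= s -> (0 < hausdorff_measure s A)%E ->
  (hausdorff_measure s A < +oo)%E -> hausdorff_dim A = s.
Proof.
move=> s0 A0 As; apply/eqP; rewrite eq_le hausdorff_dim_le//=.
apply: lb_le_inf; last first.
  move=> t [t0 At]; rewrite leNgt; apply/negP => ts.
  by move: A0; rewrite (hausdorff_measure0 t0 ts) ?ltxx// At ltry.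
exists (s + 1); split; first by rewrite addr_ge0.
by apply: (hausdorff_measure0 s0) As; rewrite ltrDl.
Qed.

End Hausdorff.

(** * Positive Hausdorff measure from finite covers *)

Section Frostman.
Variable R : realType.

Lemma powRD_le (x y t : R) : 0 <= x -> 0 <= y -> 0 <= t ->
  (x + y) `^ t <= 2 `^ t * (x `^ t + y `^ t).
Proof.
move=> x0 y0 t0.
wlog xy : x y x0 y0 / x <= y.
  move=> h; have [/h|/ltW/h] := leP x y; first exact.
  by rewrite addrC [x `^ t + _]addrC; exact.
apply: (@le_trans _ _ ((2 * y) `^ t)).
  apply: ge0_ler_powR; rewrite ?nnegrE ?addr_ge0 ?mulr_ge0//.
  by rewrite mulr_natl mulr2n lerD2r.
by rewrite powRM// ler_wpM2l ?powR_ge0// lerDr powR_ge0.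
Qed.

Definition box (y : R * R) (rho : R) : set (R * R) :=
  [set x | `|x.1 - y.1| < rho /\ `|x.2 - y.2| < rho].

Lemma open_box y rho : 0 < rho -> open (box y rho).
Proof.
move=> rho0; have -> : box y rho = ball y rho.
  rewrite predeqE => x; split => [[h1 h2]|].
    by split; rewrite -ball_normE /ball_ /= distrC.
  by move=> [] ; rewrite -!ball_normE /ball_ /= => h1 h2; split; rewrite distrC.
exact: ball_open.
Qed.

(** Each set of a countable cover is enlarged to an open box, by amounts whose powers have sum less
    than [eta], and compactness leaves finitely many boxes. Hence the mass of a cover can be
    computed on words of one finite length. The factor [2] to the power [t] in [eta] splits the
    power of a sum; the last [/ 2] shares the rest between diameters and enlargements. *)
Lemma hausdorff_measure_gt0 t c (K : set (R * R)) : compact K -> 0 < t -> 0 < c ->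
  (forall n (y : nat -> R * R) (rho : nat -> R), (forall k, 0 < rho k) ->
     K `<=` \bigcup_(k in `I_n) box (y k) (rho k) ->
     c <= \sum_(k < n) rho k `^ t) ->
  (0 < hausdorff_measure t K)%E.
Proof.
move=> cK t0 c0 hK.
pose eta := c / 2 `^ t / 2.
have p2 : 0 < 2 `^ t :> R by rewrite powR_gt0.
have eta0 : 0 < eta by rewrite !divr_gt0.
apply: (@lt_le_trans _ _ eta%:E); first by rewrite lte_fin.
apply: (@le_trans _ _ (hausdorff_content t 1 K)); last exact: content_le_measure.
rewrite leNgt; apply/negP => /content_cov [F [e [Fd Fe esum KF]]].
pose d k := fine (diam (F k)).
have d0 k : 0 <= d k /\ d k `^ t <= e k.
  (* An empty set has diameter [-oo], which [fine] sends to 0; as [t] is positive, its power is 0 as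
     well. *)
  rewrite /d; have [F0|/set0P F0] := eqVneq (F k) set0.
    have -> : diam (F k) = -oo%E.
      rewrite /diam F0 (_ : [set _ | _ in _] = set0) ?ereal_sup0//.
      by rewrite predeqE => z; split => // -[? [[]]].
    rewrite /= powR0 ?gt_eqF//; split => //.
    by rewrite -lee_fin; apply: le_trans (Fe k); exact: gauge_ge0.
  have [E /andP[h _]] := gauge_nonempty t F0 (Fd k).
  by split => //; rewrite -lee_fin -E.
pose r k : R := (eta * 2^-1 ^+ k.+1) `^ t^-1.
have r0 k : 0 < r k by rewrite powR_gt0// mulr_gt0// exprn_gt0.
have rt k : r k `^ t = eta * 2^-1 ^+ k.+1.
  by rewrite -powRrM mulVf ?gt_eqF// powRr1// ltW// mulr_gt0// exprn_gt0.
have sumr n : \sum_(k < n) r k `^ t < eta.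
  under eq_bigr do rewrite rt.
  rewrite -mulr_sumr gtr_pMr//.
  suff -> : \sum_(i < n) 2^-1 ^+ i.+1 = 1 - 2^-1 ^+ n :> R by rewrite gtrBl exprn_gt0.
  elim: n => [|n IH]; first by rewrite big_ord0 expr0 subrr.
  rewrite big_ord_recr /= IH exprS; set x := _ ^+ n; lra.
pose y k : R * R := xget (0, 0) (F k).
pose rho k := d k + r k.
have rho0 k : 0 < rho k by rewrite /rho ltr_wpDl//; case: (d0 k).
have Fbox k : F k `<=` box (y k) (rho k).
  move=> x Fx; have Fy : F k (y k) by apply: xgetPex; exists x.
  have dE : (diam (F k) <= (d k)%:E)%E.
    rewrite /d fineK// fin_real//; apply/andP; split.
      by apply: lt_le_trans (diam_ge0 (ex_intro _ x Fx)); exact: ltNyr.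
    by apply: le_lt_trans (Fd k) _; exact: ltry.
  have exy := edist_le_diam dE Fx Fy.
  split.
    by apply: le_lt_trans (edist_ge1 _ _) _; apply: le_lt_trans exy _; rewrite ltrDl.
  by apply: le_lt_trans (edist_ge2 _ _) _; apply: le_lt_trans exy _; rewrite ltrDl.
have : near_covering K by apply/compact_near_coveringP.
pose P n (x : R * R) := (\bigcup_(k in `I_n) box (y k) (rho k)) x.
(* With the number of boxes as parameter and the filter [\oo], near-covering says that some finite
   number of boxes covers [K]. *)
move=> /(_ nat \oo P _) [].
  move=> x /KF [k _ /Fbox xk].
  exists (box (y k) (rho k), [set n | (k < n)%N]) => /=.
    split; last by exists k.+1.
    by apply: open_nbhs_nbhs; split => //; exact: open_box.
  by move=> [z n] /= [zk kn]; exists k.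
move=> n _ /(_ n (leqnn n)) Kn; have := hK n y rho rho0 Kn.
apply/negP; rewrite -ltNge.
apply: (@le_lt_trans _ _ (\sum_(k < n) 2 `^ t * (d k `^ t + r k `^ t))).
  apply: ler_sum => k _; apply: powRD_le; [by case: (d0 k)|exact: ltW|exact: ltW].
rewrite -mulr_sumr -ltr_pdivlMl// big_split /= mulrC.
have -> : c / 2 `^ t = eta + eta by rewrite /eta; field; rewrite gt_eqF.
apply: ler_ltD (sumr n); apply: le_trans (esum n).
by apply: ler_sum => k _; case: (d0 k).
Qed.

End Frostman.

(** * Intervals of words and masses of boxes *)

Section Intervals.
Variables (R : realType) (r : nat) (a : 'I_r -> R).
Hypothesis a_gt0 : forall i, 0 < a i.
Hypothesis a_sum : \sum_(i < r) a i = 1.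

Definition offset (k : nat) : R := \sum_(i < r | (i < k)%N) a i.

(** Left end of the image of the unit interval under the composed maps of the letters of [u]; the
    length of this image is [wprod a u]. *)
Fixpoint lo (u : seq 'I_r) : R := if u is i :: v then a i * lo v + offset i else 0.

Lemma offset0 : offset 0 = 0.
Proof. by rewrite /offset big_pred0. Qed.

Lemma offsetr : offset r = 1.
Proof. by rewrite -a_sum; apply: eq_bigl => i; rewrite ltn_ord. Qed.

Lemma offsetS (i : 'I_r) : offset i.+1 = offset i + a i.
Proof.
rewrite /offset (bigD1 i) ?ltnS//= addrC; congr (_ + _).
by apply: eq_bigl => j; rewrite ltnS [(j < i)%N]ltn_neqAle andbC.
Qed.

Lemma offset_ge0 k : 0 <= offset k.
Proof. by apply: sumr_ge0 => i _; exact: ltW. Qed.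

Lemma offset_le1 (i : 'I_r) : a i + offset i <= 1.
Proof.
rewrite addrC -offsetS -a_sum [leRHS](bigID (fun j : 'I_r => (j < i.+1)%N)) /=.
by rewrite lerDl; apply: sumr_ge0 => j _; exact: ltW.
Qed.

Lemma lo_cat u v : lo (u ++ v) = lo u + wprod a u * lo v.
Proof.
elim: u => [|i u IH] /=; first by rewrite wprod_nil add0r mul1r.
by rewrite IH wprod_cons; ring.
Qed.

Lemma affine_itv u (z : R) : 0 <= z <= 1 -> 0 <= lo u + wprod a u * z <= 1.
Proof.
move=> z01; elim: u => [|i u /andP[IH0 IH1]] /=.
  by rewrite wprod_nil add0r mul1r.
have -> : a i * lo u + offset i + wprod a (i :: u) * z =
    a i * (lo u + wprod a u * z) + offset i by rewrite wprod_cons; ring.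
apply/andP; split; first by rewrite addr_ge0 ?offset_ge0// mulr_ge0// ltW.
by apply: le_trans (offset_le1 i); rewrite lerD2r ler_piMr// ltW.
Qed.

Lemma prefix_itv u w (z : R) : 0 <= z <= 1 -> prefix u w ->
  lo u <= lo w + wprod a w * z <= lo u + wprod a u.
Proof.
move=> z01 /prefixP[v ->]; rewrite lo_cat wprod_cat.
have /andP[h0 h1] := affine_itv v z01.
have u0 : 0 < wprod a u by exact: wprod_gt0.
have -> : lo u + wprod a u * lo v + wprod a u * wprod a v * z =
    lo u + wprod a u * (lo v + wprod a v * z) by ring.
by rewrite lerDl mulr_ge0 ?(ltW u0)//= lerD2l ler_piMr// ltW.
Qed.

(** Stopped words have non-overlapping intervals of length at least [c * rho], and those meeting the
    [rho]-neighbourhood of [y] lie in a window of length [4 * rho]. The map [g] clamps to this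
    window: the clipped length telescopes over the children of a word, so [kraft] does the work of
    disjointness. *)
Lemma count_stopped (S : seq (seq 'I_r)) c y rho : uniq S ->
  0 < c -> (forall i, c <= a i) -> 0 < rho -> c * rho <= 1 ->
  (forall u, u \in S -> stopped a rho 1 u /\
     exists2 z, lo u <= z <= lo u + wprod a u & `|z - y| <= rho) ->
  (size S)%:R <= 4 / c.
Proof.
move=> uS c0 ca rho0 crho hS.
pose g (z : R) := Num.max (y - 2 * rho) (Num.min z (y + 2 * rho)).
have g_mono z z' : z <= z' -> g z <= g z'.
  by move=> zz; rewrite /g; apply: le_max2 => //; apply: le_min2.
have gin z : y - 2 * rho <= z <= y + 2 * rho -> g z = z.
  by move=> /andP[h1 h2]; rewrite /g (min_idPl h2) (max_idPr h1).
pose F u := g (lo u + wprod a u) - g (lo u).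
have F0 u : 0 <= F u by rewrite subr_ge0 g_mono// lerDl ltW// wprod_gt0.
have FS u : \sum_x F (rcons u x) <= F u.
  pose G k := g (lo u + wprod a u * offset k).
  have -> : \sum_x F (rcons u x) = \sum_(0 <= i < r) (G i.+1 - G i).
    rewrite big_mkord; apply: eq_bigr => i _; rewrite /F /G offsetS wprod_rcons.
    rewrite -cats1 lo_cat /= mulr0 add0r; congr (g _ - _).
    by rewrite mulrDr addrA.
  by rewrite telescope_sumr// /G offset0 offsetr mulr0 mulr1 addr0.
have pS : prefix_free S.
  move=> u v /hS[su _] /hS[sv _]; exact: stopped_prefix su sv.
have := kraft F0 FS uS pS.
have -> : F [::] = g 1 - g 0 by rewrite /F /= wprod_nil add0r.
move=> h; rewrite ler_pdivlMr// -(ler_pM2r rho0).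
apply: (@le_trans _ _ (\sum_(u <- S) F u)); last first.
  apply: le_trans h _; rewrite /g.
  have : Num.max (y - 2 * rho) (Num.min 1 (y + 2 * rho)) <= y + 2 * rho.
    rewrite ge_max ge_min lexx orbT andbT; lra.
  have : y - 2 * rho <= Num.max (y - 2 * rho) (Num.min 0 (y + 2 * rho)).
    by rewrite le_max lexx.
  move: (Num.max _ _) (Num.max _ _) => p q; lra.
rewrite -mulrA mulr_natl -iter_addr_0 -(count_predT S) -big_const_seq.
rewrite big_seq [leRHS]big_seq; apply: ler_sum => u /hS[su [z /andP[z1 z2]]].
rewrite ler_norml => /andP[h1 h2].
have := stopped_le su; rewrite mul1r => ul.
have u0 : 0 < wprod a u by exact: wprod_gt0.
rewrite /F !gin; first last.
- apply/andP; split; lra.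
- apply/andP; split; lra.
rewrite addrC addKr.
by have := stopped_ge rho0 (ltW c0) ca crho su; rewrite mul1r.
Qed.

End Intervals.

(** * Expectations over random words with a change of law *)

Section Expectation.
Variables (R : realType) (L : finType).

(* Expectation of [f w] when the letters of the random word [w] of length [n] are
   drawn with the law [p1] as long as the running product [th * be ..] exceeds
   [d] and with the law [p2] afterwards. *)
Fixpoint switch_mean (p1 p2 be : L -> R) (d : R) (n : nat) (th : R)
    (f : seq L -> R) : R :=
  if n is m.+1 then
    \sum_x (if d < th then p1 x else p2 x) *
           switch_mean p1 p2 be d m (th * be x) (fun w => f (x :: w))
  else f [::].

Variables (p1 p2 be : L -> R) (d : R).
Hypothesis p1_ge0 : forall x, 0 <= p1 x.
Hypothesis p2_ge0 : forall x, 0 <= p2 x.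
Local Notation expect := (switch_mean p1 p2 be d).

Let p_ge0 (b : bool) x : 0 <= (if b then p1 x else p2 x).
Proof. by case: b. Qed.

Lemma expectS n th f : expect n.+1 th f =
  \sum_x (if d < th then p1 x else p2 x) *
    expect n (th * be x) (fun w => f (x :: w)).
Proof. by []. Qed.

Lemma expect_le n th f g : (forall w, size w = n -> f w <= g w) ->
  expect n th f <= expect n th g.
Proof.
elim: n th f g => [|n IH] th f g fg /=; first exact: fg.
apply: ler_sum => x _; rewrite ler_wpM2l// IH// => w wn.
by apply: fg; rewrite /= wn.
Qed.

Lemma expect0 n th : expect n th (fun=> 0) = 0.
Proof.
elim: n th => [|n IH] th //=; apply: big1 => x _.
by rewrite IH mulr0.
Qed.

Lemma expectD n th f g :
  expect n th (fun w => f w + g w) = expect n th f + expect n th g.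
Proof.
elim: n th f g => [|n IH] th f g //=; rewrite -big_split /=.
by apply: eq_bigr => x _; rewrite IH mulrDr.
Qed.

Lemma expect_sum (S : Type) (s : seq S) n th (f : S -> seq L -> R) :
  expect n th (fun w => \sum_(k <- s) f k w) = \sum_(k <- s) expect n th (f k).
Proof.
elim: s => [|k s IH].
  rewrite big_nil -[RHS](expect0 n th); congr expect.
  by apply: funext => w; rewrite big_nil.
rewrite big_cons -IH -expectD; congr expect.
by apply: funext => w; rewrite big_cons.
Qed.

Lemma expectZ n th c f : expect n th (fun w => c * f w) = c * expect n th f.
Proof.
elim: n th f => [|n IH] th f //=; rewrite mulr_sumr.
by apply: eq_bigr => x _; rewrite IH mulrCA.
Qed.

Lemma expect1 n th : 1 <= \sum_x p1 x -> 1 <= \sum_x p2 x ->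
  1 <= expect n th (fun=> 1).
Proof.
move=> h1 h2; elim: n th => [|n IH] th //=.
apply: (@le_trans _ _ (\sum_x (if d < th then p1 x else p2 x))).
  by case: (d < th).
by apply: ler_sum => x _; apply: ler_peMr; [exact: p_ge0|exact: IH].
Qed.

Variables (C C' : eqType) (col : L -> C) (row : L -> C').
Variables (A : C -> R) (B b : C' -> R).
Hypothesis beE : forall x, be x = b (row x).
Hypothesis b_itv : forall j, 0 <= b j <= 1.
Hypothesis A_ge0 : forall i, 0 <= A i.
Hypothesis B_ge0 : forall i, 0 <= B i.
Hypothesis p1_cell : forall i j,
  \sum_(x | (col x == i) && (row x == j)) p1 x <= A i * B j.
Hypothesis p1_row : forall j, \sum_(x | row x == j) p1 x <= B j.
Hypothesis p2_col : forall i, \sum_(x | col x == i) p2 x <= A i.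
Hypothesis p2_sum : \sum_x p2 x <= 1.

(** Along a word that follows [v], the law changes exactly when [v] is used up, because both happen
    at the threshold [d]. Before that, a step costs [A i * B j], or [B j] once [u] is over;
    afterwards only columns are prescribed and a step costs [A i]. *)
Lemma expect_prefix n th u v : 0 <= th -> stopped b d th v ->
  expect n th (fun w => (prefix u (map col w))%:R * (prefix v (map row w))%:R)
    <= wprod A u * wprod B v.
Proof.
elim: n th u v => [|n IH] th u v th0 sv.
  case: u => [|? ?]; last by rewrite /= mul0r mulr_ge0// wprod_ge0.
  case: v sv => [|? ?] _; last by rewrite /= mulr0 mulr_ge0// wprod_ge0.
  by rewrite !wprod_nil.
pose hd (T : eqType) (w : seq T) c := if w is c' :: _ then c == c' else true.
have hdE (T : eqType) (w w' : seq T) c :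
    prefix w (c :: w') = hd T w c && prefix (behead w) w'.
  by case: w => [|c' w] //=; rewrite ?prefix0s// eq_sym.
have sb x : hd _ v (row x) -> stopped b d (th * be x) (behead v).
  case: v sv => [|j v] /=.
    move=> thd _; apply: le_trans thd; rewrite ler_piMr//.
    by have /andP[] := b_itv (row x); rewrite beE.
  by move=> /andP[_ sv] /eqP xj; rewrite beE xj.
apply: (@le_trans _ _ (\sum_x (if d < th then p1 x else p2 x) *
    ((hd _ u (col x) && hd _ v (row x))%:R *
     (wprod A (behead u) * wprod B (behead v))))).
  rewrite expectS; apply: ler_sum => x _; rewrite ler_wpM2l//.
  set g := fun w => _.
  pose h w : R :=
    (prefix (behead u) (map col w))%:R * (prefix (behead v) (map row w))%:R.
  have -> : g = (fun w => (hd _ u (col x) && hd _ v (row x))%:R * h w).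
    apply: funext => w; rewrite /g /h !map_cons !hdE -!natrM !mulnb; congr (_%:R).
    by rewrite andbACA.
  rewrite (expectZ _ _ _ h); have [hv|hv] := boolP (hd _ v (row x)); last first.
    by rewrite andbF !mul0r.
  by rewrite ler_wpM2l// IH// ?sb// mulr_ge0// beE; have /andP[] := b_itv (row x).
under eq_bigr do rewrite mulrA.
rewrite -mulr_suml.
have [AB AB'] : wprod A u = (if u is i :: _ then A i else 1) * wprod A (behead u)
    /\ wprod B v = (if v is i :: _ then B i else 1) * wprod B (behead v).
  by split; [case: (u) => [|i u'] | case: (v) => [|j v']];
    rewrite /= ?wprod_cons ?wprod_nil ?mul1r.
rewrite AB AB' mulrACA ler_wpM2r ?mulr_ge0 ?wprod_ge0//.
have bE (P : pred L) (p : L -> R) : \sum_x p x * (P x)%:R = \sum_(x | P x) p x.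
  rewrite [RHS]big_mkcond; apply: eq_bigr => x _.
  by case: (P x); rewrite ?mulr1 ?mulr0.
rewrite bE.
case: (v) sv => [|j v'] /= sv.
  rewrite ltNge sv /=.
  case: (u) => [|i u'] /=; first by rewrite mulr1.
  by under eq_bigl do rewrite andbT; rewrite mulr1.
case/andP: sv => -> _.
case: (u) => [|i u'] /=; first by rewrite mul1r.
exact: p1_cell.
Qed.

End Expectation.

(** With one law the mean is the same at every threshold, so boxes of different sizes in one cover
    can be measured by the same expectation. *)
Lemma expect_same (R : realType) (L : finType) (p be be' : L -> R) d d' n th th' f :
  switch_mean p p be d n th f = switch_mean p p be' d' n th' f.
Proof.
elim: n th th' f => [|n IH] th th' f //=; apply: eq_bigr => x _.
by rewrite !if_same; congr (_ * _); apply: IH.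
Qed.

Fixpoint words_upto (T : finType) n : seq (seq T) :=
  if n is m.+1 then
    [::] :: [seq x :: w | x <- enum T, w <- words_upto T m]
  else [:: [::]].

Lemma mem_words_upto (T : finType) n (w : seq T) :
  (size w <= n)%N -> w \in words_upto T n.
Proof.
elim: n w => [|n IH] [|x w] //= wn.
by rewrite inE; apply/allpairsP; exists (x, w); rewrite mem_enum IH.
Qed.

Section Mass.
Variables (R : realType) (r s : nat) (a : 'I_r -> R) (b : 'I_s -> R).
Variables (L : finType) (col : L -> 'I_r) (row : L -> 'I_s).
Hypothesis a_itv : forall i, 0 < a i < 1.
Hypothesis b_itv : forall j, 0 < b j < 1.
Hypothesis a_sum : \sum_(i < r) a i = 1.
Hypothesis b_sum : \sum_(j < s) b j = 1.
Variables (c amax : R).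
Hypothesis c_gt0 : 0 < c.
Hypothesis a_ge : forall i, c <= a i.
Hypothesis b_ge : forall j, c <= b j.
Hypothesis a_le : forall i, a i <= amax.
Hypothesis b_le : forall j, b j <= amax.
Variables (t e : R).
Hypothesis t_ge0 : 0 <= t.
Hypothesis e_ge0 : 0 <= e.
Variables (p1 p2 : L -> R).
Hypothesis p1_ge0 : forall x, 0 <= p1 x.
Hypothesis p2_ge0 : forall x, 0 <= p2 x.
Hypothesis p1_cell : forall i j,
  \sum_(x | (col x == i) && (row x == j)) p1 x <= a i `^ t * b j `^ e.
Hypothesis p1_row : forall j, \sum_(x | row x == j) p1 x <= b j `^ e.
Hypothesis p2_col : forall i, \sum_(x | col x == i) p2 x <= a i `^ t.
Hypothesis p2_sum : \sum_x p2 x <= 1.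
Variable (z : R * R).
Hypothesis z1_itv : 0 <= z.1 <= 1.
Hypothesis z2_itv : 0 <= z.2 <= 1.

Definition word_point (w : seq L) : R * R :=
  (lo a (map col w) + wprod a (map col w) * z.1,
   lo b (map row w) + wprod b (map row w) * z.2).

(** A box of size [rho] meets at most [4 / c] stopped column words and as many stopped row words. A
    word whose point lies in the box begins with one of these pairs, and each pair has mass at most
    [rho] to the power [t + e]. *)
Lemma mass_le (U : pred (seq L)) y rho n :
  0 < rho <= 1 -> amax ^+ n <= rho ->
  (forall w, size w = n -> U w ->
    `|(word_point w).1 - y.1| <= rho /\ `|(word_point w).2 - y.2| <= rho) ->
  switch_mean p1 p2 (b \o row) rho n 1 (fun w => (U w)%:R)
    <= (4 / c) ^+ 2 * rho `^ (t + e).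
Proof.
move=> /andP[rho0 rho1] arho hU.
have crho (r' : nat) (a' : 'I_r' -> R) :
    (forall i, 0 < a' i < 1) -> \sum_(i < r') a' i = 1 ->
    (forall i, c <= a' i) -> c * rho <= 1.
  case: r' a' => [|r'] a' ha; first by rewrite big_ord0 => /esym/eqP; rewrite oner_eq0.
  move=> _ /(_ ord0) ca; rewrite mulr_ile1 ?(ltW c_gt0) ?(ltW rho0)//.
  by apply: le_trans ca _; have /andP[_ /ltW] := ha ord0.
have stop_ex (r' : nat) (a' : 'I_r' -> R) (w : seq 'I_r') :
    (forall i, 0 < a' i < 1) -> (forall i, a' i <= amax) -> size w = n ->
    exists2 u, prefix u w & stopped a' rho 1 u.
  move=> ha ha' wn; apply: (@stopped_exists _ _ _ _ _ amax) => //.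
    by move=> i; have /andP[/ltW -> _] := ha i; rewrite ha'.
  by rewrite mul1r wn.
pose Su := [seq u <- undup (words_upto 'I_r n) | stopped a rho 1 u &&
  `[< exists2 z, lo a u <= z <= lo a u + wprod a u & `|z - y.1| <= rho >] ].
pose Sv := [seq v <- undup (words_upto 'I_s n) | stopped b rho 1 v &&
  `[< exists2 z, lo b v <= z <= lo b v + wprod b v & `|z - y.2| <= rho >] ].
have Su_size : (size Su)%:R <= 4 / c.
  apply: (@count_stopped _ _ a _ _ _ c y.1 rho) => //; first last.
  - by move=> u; rewrite mem_filter => /andP[/andP[? /asboolP]].
  - exact: crho a_itv a_sum a_ge.
  - by rewrite filter_uniq ?undup_uniq.
  - by move=> i; have /andP[] := a_itv i.
have Sv_size : (size Sv)%:R <= 4 / c.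
  apply: (@count_stopped _ _ b _ _ _ c y.2 rho) => //; first last.
  - by move=> u; rewrite mem_filter => /andP[/andP[? /asboolP]].
  - exact: crho b_itv b_sum b_ge.
  - by rewrite filter_uniq ?undup_uniq.
  - by move=> i; have /andP[] := b_itv i.
pose f u v w : R := (prefix u (map col w))%:R * (prefix v (map row w))%:R.
apply: (@le_trans _ _ (switch_mean p1 p2 (b \o row) rho n 1
    (fun w => \sum_(u <- Su) \sum_(v <- Sv) f u v w))).
  apply: expect_le => // w wn; have f0 u v : 0 <= f u v w by rewrite /f mulr_ge0.
  have [Uw|_] := boolP (U w); last by rewrite sumr_ge0// => u _; rewrite sumr_ge0.
  have [hx hy] := hU w wn Uw.
  have [|u pu su] := stop_ex _ a (map col w) a_itv a_le; first by rewrite size_map.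
  have [|v pv sv] := stop_ex _ b (map row w) b_itv b_le; first by rewrite size_map.
  have pw (r' : nat) (T : finType) (cl : T -> 'I_r') (w' : seq T) u' :
      size w' = n -> prefix u' (map cl w') -> u' \in undup (words_upto 'I_r' n).
    move=> w'n pu'; rewrite mem_undup mem_words_upto//.
    by rewrite -w'n -(size_map cl); exact: size_prefix.
  have uSu : u \in Su.
    rewrite mem_filter su (pw _ _ col w)//= andbT; apply/asboolP.
    exists (word_point w).1 => //; apply: prefix_itv => //.
    by move=> i; have /andP[] := a_itv i.
  have vSv : v \in Sv.
    rewrite mem_filter sv (pw _ _ row w)//= andbT; apply/asboolP.
    exists (word_point w).2 => //; apply: prefix_itv => //.
    by move=> i; have /andP[] := b_itv i.
  rewrite (bigD1_seq u)//=; last by rewrite filter_uniq ?undup_uniq.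
  rewrite (bigD1_seq v)//=; last by rewrite filter_uniq ?undup_uniq.
  rewrite {1}/f pu pv mulr1 -addrA lerDl addr_ge0// sumr_ge0// => i _.
  by rewrite sumr_ge0.
rewrite expect_sum; under eq_bigr do rewrite expect_sum.
apply: (@le_trans _ _ (\sum_(u <- Su) \sum_(v <- Sv) rho `^ (t + e))).
  rewrite big_seq [leRHS]big_seq; apply: ler_sum => u.
  rewrite mem_filter => /andP[/andP[su _] _].
  rewrite big_seq [leRHS]big_seq; apply: ler_sum => v.
  rewrite mem_filter => /andP[/andP[sv _] _].
  apply: (@le_trans _ _ (wprod (fun i => a i `^ t) u * wprod (fun j => b j `^ e) v)).
    apply: (@expect_prefix _ _ p1 p2 (b \o row) rho _ _ _ _ col row _ _ b) => //.
    - by move=> j; have /andP[/ltW -> /ltW ->] := b_itv j.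
    - by move=> i; exact: powR_ge0.
    - by move=> i; exact: powR_ge0.
  have a0 i : 0 < a i by have /andP[] := a_itv i.
  have b0 i : 0 < b i by have /andP[] := b_itv i.
  rewrite !wprod_powR// powRD; last by rewrite (gt_eqF rho0) implybT.
  have := stopped_le su; have := stopped_le sv; rewrite !mul1r => hv hu.
  by apply: ler_pM; rewrite ?powR_ge0//; apply: ge0_ler_powR;
    rewrite ?nnegrE ?(ltW rho0)// wprod_ge0// => i; exact: ltW.
rewrite !big_const_seq !count_predT !iter_addr_0; set C := rho `^ _.
rewrite -[_ *+ size Su]mulr_natl -[_ *+ size Sv]mulr_natl mulrA expr2.
by rewrite ler_wpM2r ?powR_ge0// ler_pM.
Qed.

End Mass.

(** * Covers by approximate squares *)

Definition segment (T : Type) (w : nat -> T) n m : seq T :=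
  [seq w k | k <- iota n m].

Lemma mkseq_segment T (w : nat -> T) n m :
  mkseq w (n + m) = mkseq w n ++ segment w n m.
Proof. by rewrite /mkseq iotaD map_cat. Qed.

Lemma segment_shift T (w : nat -> T) n m :
  segment w n m = mkseq (fun k => w (n + k)%N) m.
Proof. by rewrite /segment -[in iota n m](addn0 n) iotaDl -map_comp. Qed.

Section CoveringNumber.
Variable R : realType.

(** At exponent 0 every nonempty set costs at least 1, so bounded partial sums leave only finitely
    many nonempty sets; their number is the maximum [m0] of the counts over initial segments. *)
Lemma covering_number_le (del M : R) (A : set (R * R)) : cov 0 del M A ->
  exists n (F : 'I_n -> set (R * R)), [/\ n%:R <= M,
    forall i, (diam (F i) <= del%:E)%E & A `<=` \bigcup_i F i].
Proof.
case=> F [c [Fd Fc cM AF]].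
pose ne k := `[< F k !=set0 >].
have cE k : (ne k)%:R <= c k.
  rewrite -lee_fin; apply: le_trans (Fc k); rewrite /ne; case: asboolP => [F0|_].
    by have [-> _] := gauge_nonempty 0 F0 (Fd k); rewrite powRr0.
  exact: gauge_ge0.
pose P m := `[< exists n, (\sum_(k < n) (ne k : nat))%N = m >].
have P_ub m : P m -> m%:R <= M.
  move=> /asboolP[n <-]; rewrite natr_sum; apply: le_trans (cM n).
  exact: ler_sum.
have [||m0 /asboolP[n0 n0E] m0max] := @ex_maxnP P (Num.bound M).
- by exists 0%N; apply/asboolP; exists 0%N; rewrite big_ord0.
- move=> m /P_ub mM; rewrite -(ler_nat R); apply: le_trans mM _.
  have M0 : 0 <= M by have := cM 0%N; rewrite big_ord0.
  by apply: ltW; exact: archi_boundP.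
have Fempty k : (n0 <= k)%N -> ~ (F k !=set0).
  move=> nk Fk; have : P (\sum_(i < k.+1) (ne i : nat))%N by apply/asboolP; exists k.+1.
  move=> /m0max; apply/negP; rewrite -ltnNge big_ord_recr /= -n0E.
  have -> : ne k = true by apply/asboolP.
  rewrite addn1 ltnS -(big_mkord xpredT (fun i => ne i : nat)).
  rewrite -(big_mkord xpredT (fun i => ne i : nat)).
  by rewrite [leqRHS](big_cat_nat (n := n0))//= leq_addr.
pose S := [seq k <- iota 0 n0 | ne k].
have SE : size S = m0.
  rewrite size_filter -n0E -sum1_count big_mkcond /=.
  rewrite -(big_mkord xpredT (fun i => ne i : nat)).
  by rewrite /index_iota subn0; apply: eq_bigr => i _; case: (ne i).
exists m0, (fun i : 'I_m0 => F (nth 0%N S i)); split => //.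
  by apply: P_ub; apply/asboolP; exists n0.
move=> x Ax; have [k _ Fk] := AF _ Ax.
have kS : k \in S.
  rewrite mem_filter /ne; apply/andP; split; first by apply/asboolP; exists x.
  rewrite mem_iota /= add0n ltnNge; apply/negP => /Fempty; apply; by exists x.
have iS : (index k S < m0)%N by rewrite -SE index_mem.
by exists (Ordinal iS) => //=; rewrite nth_index.
Qed.

End CoveringNumber.

(* One of the two types of squares: they are extended along the coordinate [X],
   whose digits are the [col] letters with ratios [aC], until the side reaches the
   product of the [be]; the two types are obtained by exchanging the axes. *)
Section Half.
Variables (R : realType) (L C : finType) (col : L -> C) (aC : C -> R) (be : L -> R).
Variables (kmin kmax : R).
Hypothesis kmin_gt0 : 0 < kmin.
Hypothesis kmax_lt1 : kmax < 1.
Hypothesis aC_itv : forall c, kmin <= aC c <= kmax.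
Hypothesis be_itv : forall x, kmin <= be x <= kmax.
Variables (coded : R * R -> (nat -> L) -> Prop) (X Y : R * R -> R).
Hypothesis track_X : forall x x' w w' n, coded x w -> coded x' w' ->
  map col (mkseq w n) = map col (mkseq w' n) ->
  `|X x - X x'| <= wprod aC (map col (mkseq w n)).
Hypothesis track_Y : forall x x' w w' n, coded x w -> coded x' w' ->
  mkseq w n = mkseq w' n -> `|Y x - Y x'| <= wprod be (mkseq w n).
Hypothesis edist_XY : forall x x' d, 0 <= d ->
  `|X x - X x'| <= d -> `|Y x - Y x'| <= d -> edist x x' <= 2 * d.

Lemma aC_gt0 c : 0 < aC c.
Proof. by have /andP[h _] := aC_itv c; apply: lt_le_trans h. Qed.

Lemma be_gt0 x : 0 < be x.
Proof. by have /andP[h _] := be_itv x; apply: lt_le_trans h. Qed.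

Definition cell (z : seq L * seq C) : set (R * R) := [set x | exists2 w, coded x w &
  mkseq w (size z.1) = z.1 /\
  map col (mkseq w (size z.1 + size z.2)) = map col z.1 ++ z.2].

Lemma diam_cell z d : 0 <= d -> wprod be z.1 <= d ->
  wprod aC (map col z.1) * wprod aC z.2 <= d -> (diam (cell z) <= (2 * d)%:E)%E.
Proof.
move=> d0 h1 h2; apply: diam_le => x x' [w xw [w1 w2]] [w' xw' [w1' w2']].
apply: edist_XY => //.
  apply: le_trans (track_X (n := size z.1 + size z.2) xw xw' _) _.
    by rewrite w2 w2'.
  by rewrite w2 wprod_cat.
apply: le_trans (track_Y (n := size z.1) xw xw' _) _; first by rewrite w1 w1'.
by rewrite w1.
Qed.

(** Common core of all upper bounds. [G] selects the first words, [dth] is the side at which the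
    extension stops, and the weights times [M] pay for the [s]-th power of that side. The factor [2]
    to the power [s] comes from the bound [2 * d] on the diameter. *)
Lemma half_cov (s M B del : R) (p : L -> R) (q : C -> R) (G : pred (seq L))
    (dth : seq L -> R) (E : set (R * R)) :
  0 <= s -> 0 < del -> 0 <= M -> (forall x, 0 <= p x) -> (forall c, 0 <= q c) ->
  \sum_c q c <= 1 ->
  (forall W : seq (seq L), uniq W -> (forall w, w \in W -> G w) ->
     \sum_(w <- W) wprod p w <= B) ->
  (forall w, G w -> [/\ 0 <= dth w, wprod be w <= dth w & 2 * dth w <= del]) ->
  (forall x, E x -> exists w n m, [/\ coded x w, G (mkseq w n),
     stopped aC (dth (mkseq w n)) (wprod aC (map col (mkseq w n)))
       (map col (segment w n m)) &
     dth (mkseq w n) `^ s <=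
       M * (wprod p (mkseq w n) * wprod q (map col (segment w n m)))]) ->
  cov s del (2 `^ s * (M * B)) E.
Proof.
move=> s0 del0 M0 p0 q0 q1 pB hG hE.
pose P (z : seq L * seq C) := [&& G z.1,
  stopped aC (dth z.1) (wprod aC (map col z.1)) z.2 &
  dth z.1 `^ s <= M * (wprod p z.1 * wprod q z.2)].
apply: (@cov_countable R _ P cell
  (fun z => 2 `^ s * (M * (wprod p z.1 * wprod q z.2)))) => //.
- by move=> z; rewrite mulr_ge0 ?powR_ge0// !mulr_ge0// wprod_ge0.
- move=> z /and3P[/hG[d0 bd dd] sz _].
  apply: le_trans (@diam_cell z _ d0 bd (stopped_le sz)) _.
  by rewrite lee_fin.
- move=> z /and3P[/hG[d0 bd dd] sz pz].
  apply: le_trans (gauge_le s0 _ (@diam_cell z _ d0 bd (stopped_le sz))) _.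
    by rewrite mulr_ge0.
  by rewrite lee_fin powRM// ler_wpM2l ?powR_ge0.
- move=> S uS hS; rewrite -mulr_sumr -mulr_sumr.
  rewrite ler_wpM2l ?powR_ge0// ler_wpM2l//.
  apply: (sum_wprod_pairs p0 q0 q1 pB uS (d := dth)
    (th := fun z => wprod aC (map col z)) (f := aC)).
  by move=> z /hS /and3P[-> -> _].
- move=> x /hE[w [n [m [xw Gw sw dw]]]].
  exists (mkseq w n, map col (segment w n m)); first by rewrite /P /= Gw sw dw.
  exists w => //=; rewrite !size_map !size_iota; split => //.
  by rewrite mkseq_segment map_cat.
Qed.

End Half.

(** The inequality of arithmetic and geometric means, strict at one letter. The mass lost by the
    geometric mean of two different laws is the source of the positive rates [zeta] and [zeta1] in
    [thin_exact]. *)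
Lemma sum_sqrt_lt1 (R : realType) (T : finType) (f g : T -> R) :
  (forall x, 0 <= f x) -> (forall x, 0 <= g x) ->
  \sum_x f x <= 1 -> \sum_x g x <= 1 -> (exists x, f x != g x) ->
  \sum_x (f x * g x) `^ 2^-1 < 1.
Proof.
move=> f0 g0 f1 g1 [x0 fg].
have amgm x : (f x * g x) `^ 2^-1 <= (f x + g x) / 2.
  rewrite powR12_sqrt ?mulr_ge0// -[leRHS]ger0_norm ?divr_ge0 ?addr_ge0//.
  rewrite -sqrtr_sqr ler_wsqrtr//.
  have := sqr_ge0 (f x - g x); nra.
have amgm0 : (f x0 * g x0) `^ 2^-1 < (f x0 + g x0) / 2.
  rewrite powR12_sqrt ?mulr_ge0// -[ltRHS]ger0_norm ?divr_ge0 ?addr_ge0//.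
  rewrite -sqrtr_sqr ltr_sqrt; last first.
    rewrite exprn_gt0// divr_gt0// lt_neqAle addr_ge0// andbT eq_sym paddr_eq0//.
    by apply: contra fg => /andP[/eqP -> /eqP ->].
  have : 0 < (f x0 - g x0) ^+ 2 by rewrite exprn_even_gt0//= subr_eq0.
  nra.
apply: (@lt_le_trans _ _ (\sum_x (f x + g x) / 2)).
  rewrite (bigD1 x0)//= [ltRHS](bigD1 x0)//=; apply: ltr_leD => //.
  exact: ler_sum.
rewrite -mulr_suml big_split /=; lra.
Qed.

Section PathSums.
Variables (R : realType) (L : Type).
Implicit Types (f g h : L -> R) (w : nat -> L).

Definition psum f w n : R := \sum_(0 <= k < n) f (w k).

(** The weights used below have logarithms that are affine in at most three functions of the letter,
    so their comparison along a code becomes linear arithmetic in path sums. *)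
Lemma psum_lin k1 k2 k3 k4 f g h w n :
  psum (fun x => k1 * f x + k2 * g x + k3 * h x + k4) w n =
  k1 * psum f w n + k2 * psum g w n + k3 * psum h w n + k4 * n%:R.
Proof.
rewrite /psum !big_split /= -!mulr_sumr; congr (_ + _).
by rewrite sumr_const_nat subn0 mulr_natr.
Qed.

Lemma psum_seg f w n m :
  \sum_(n <= k < n + m) f (w k) = psum f w (n + m) - psum f w n.
Proof. by rewrite /psum (@big_cat_nat _ _ _ n 0 (n + m)) ?leq_addr//= addrAC subrr add0r. Qed.

Lemma ln_wprod_mkseq (p : L -> R) w n : (forall x, 0 < p x) ->
  ln (wprod p (mkseq w n)) = psum (fun x => ln (p x)) w n.
Proof. by move=> p0; rewrite ln_wprod// /mkseq big_map /psum /index_iota subn0. Qed.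

Lemma ln_wprod_segment C (col : L -> C) (q : C -> R) w n m : (forall x, 0 < q x) ->
  ln (wprod q (map col (segment w n m))) =
  psum (fun x => ln (q (col x))) w (n + m) - psum (fun x => ln (q (col x))) w n.
Proof.
move=> q0; rewrite ln_wprod// /segment !big_map -psum_seg.
by rewrite /index_iota addKn.
Qed.

Lemma psum_le f c w n : (forall x, f x <= c) -> psum f w n <= c * n%:R.
Proof.
move=> fc; rewrite mulr_natr -{2}(subn0 n) -sumr_const_nat.
exact: ler_sum.
Qed.

Lemma psum_ge f c w n : (forall x, c <= f x) -> c * n%:R <= psum f w n.
Proof.
move=> fc; rewrite mulr_natr -{1}(subn0 n) -sumr_const_nat.
exact: ler_sum.
Qed.

Lemma psum_seg_ge f c w n m : (forall x, c <= f x) ->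
  c * m%:R <= psum f w (n + m) - psum f w n.
Proof.
move=> fc; rewrite -psum_seg mulr_natr -{1}(addKn n m) -sumr_const_nat.
exact: ler_sum.
Qed.

End PathSums.

(** * Tilted weights and the drift contradiction *)

Section HalfThin.
Variables (R : realType) (L C : finType) (col : L -> C) (aC : C -> R) (be : L -> R).
Variables (kmin kmax : R).
Hypothesis kmin_gt0 : 0 < kmin.
Hypothesis kmax_lt1 : kmax < 1.
Hypothesis aC_itv : forall c, kmin <= aC c <= kmax.
Hypothesis be_itv : forall x, kmin <= be x <= kmax.
Variables (coded : R * R -> (nat -> L) -> Prop) (X Y : R * R -> R).
Hypothesis track_X : forall x x' w w' n, coded x w -> coded x' w' ->
  map col (mkseq w n) = map col (mkseq w' n) ->
  `|X x - X x'| <= wprod aC (map col (mkseq w n)).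
Hypothesis track_Y : forall x x' w w' n, coded x w -> coded x' w' ->
  mkseq w n = mkseq w' n -> `|Y x - Y x'| <= wprod be (mkseq w n).
Hypothesis edist_XY : forall x x' d, 0 <= d ->
  `|X x - X x'| <= d -> `|Y x - Y x'| <= d -> edist x x' <= 2 * d.

Let a0 := aC_gt0 kmin_gt0 aC_itv.
Let b0 := be_gt0 kmin_gt0 be_itv.

Local Notation beta w n := (wprod be (mkseq w n)).
Local Notation alpha w n := (wprod aC (map col (mkseq w n))).

(** As [p] has mass less than 1, all lengths [n] from [N] on are used in one cover, and each point
    may choose its own scale. The constant [M0] absorbs the error of the stopping rule. *)
Lemma half_cov_ln s M0 rho (p : L -> R) (q : C -> R) :
  0 <= s -> (forall x, 0 < p x) -> (forall c, 0 < q c) ->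
  \sum_x p x <= rho -> rho < 1 -> \sum_c q c <= 1 ->
  forall del, 0 < del -> exists N0, forall N, (N0 <= N)%N ->
  cov s del (2 `^ s * (expR M0 * (1 - rho)^-1))
    [set x | exists w n m, [/\ coded x w, (N <= n)%N,
      stopped aC (beta w n) (alpha w n) (map col (segment w n m)) &
      s * ln (beta w n) <= M0 + ln (wprod p (mkseq w n)) +
                           ln (wprod q (map col (segment w n m)))]].
Proof.
move=> s0 p0 q0 p1 rho1 q1 del del0.
(* Without letters there are no codes and the empty cover serves; otherwise a letter shows that
   [kmax] is nonnegative. *)
have [L0|[x0 _]] : (L -> False) \/ exists x : L, True.
  by have [|/existsNP [x _]] := pselect (L -> False); [left|right; exists x].
  exists 0%N => N _; exists (fun=> set0), (fun=> 0); split.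
  - by move=> k; apply: diam_le => ? ? [].
  - by move=> k; rewrite gauge0.
  - move=> n; rewrite big1// mulr_ge0 ?powR_ge0// mulr_ge0 ?expR_ge0//.
    by rewrite invr_ge0 subr_ge0 ltW.
  - by move=> x [w _]; case: (L0 (w 0%N)).
have kmax0 : 0 <= kmax.
  have /andP[h1 h2] := be_itv x0.
  by rewrite (le_trans _ h2)// (le_trans _ h1)// ltW.
have [N0 hN0] : exists N0, 2 * kmax ^+ N0 <= del.
  have cvg0 : (fun n => kmax ^+ n) @ \oo --> (0 : R).
    by apply: cvg_expr; rewrite ger0_norm.
  have d2 : 0 < del / 2 by rewrite divr_gt0.
  have /cvgrPdist_le/(_ _ d2) [N _ /(_ N (leqnn N))] := cvg0.
  rewrite sub0r normrN => hN; exists N; rewrite mulrC -ler_pdivlMr//.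
  by apply: le_trans hN; exact: ler_norm.
exists N0 => N NN.
apply: (@half_cov R L C col aC be coded X Y track_X track_Y edist_XY s (expR M0)
  (1 - rho)^-1 del p q (fun w => (N <= size w)%N) (fun w => wprod be w)) => //.
- by move=> x; exact: ltW.
- by move=> c; exact: ltW.
- move=> W uW _; apply: sum_wprod_geometric => // x; exact: ltW.
- move=> w wN; split => //; first by apply: wprod_ge0 => x; exact: ltW.
  apply: le_trans hN0; rewrite ler_pM2l//.
  apply: le_trans (wprod_le_expr (c := kmax) _ _) _.
    by move=> x; have /andP[_ ->] := be_itv x; rewrite ltW.
  by apply: ler_wiXn2l; rewrite ?kmax0 ?(ltW kmax_lt1)// (leq_trans NN).
- move=> x [w [n [m [xw nN sw hw]]]]; exists w, n, m; split => //.
    by rewrite size_mkseq.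
  have P0 : 0 < wprod p (mkseq w n) by exact: wprod_gt0.
  have Q0 : 0 < wprod q (map col (segment w n m)) by exact: wprod_gt0.
  have B0 : 0 < beta w n by exact: wprod_gt0.
  rewrite -ler_ln ?posrE ?powR_gt0// ?mulr_gt0 ?expR_gt0//.
  by rewrite ln_powR !lnM ?posrE ?mulr_gt0 ?expR_gt0// expRK addrA.
Qed.

Let Sa w n := psum (fun x => ln (aC (col x))) w n.
Let Sb w n := psum (fun x => ln (be x)) w n.

Lemma ln_alpha w n : ln (alpha w n) = Sa w n.
Proof. by rewrite wprod_map ln_wprod_mkseq// => x; exact: a0. Qed.

Lemma ln_beta w n : ln (beta w n) = Sb w n.
Proof. by rewrite ln_wprod_mkseq. Qed.

Let A0 := - ln kmin.

Lemma step_a x : - A0 <= ln (aC (col x)) <= ln kmax.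
Proof.
have /andP[h1 h2] := aC_itv (col x).
by rewrite opprK !ler_ln ?posrE// ?h1//; apply: lt_le_trans h2.
Qed.

Lemma step_b x : - A0 <= ln (be x) <= ln kmax.
Proof.
have /andP[h1 h2] := be_itv x.
by rewrite opprK !ler_ln ?posrE// ?h1//; apply: lt_le_trans h2.
Qed.

Lemma A0_gt0 (x : L) : 0 < A0.
Proof.
have /andP[h1 h2] := be_itv x.
by rewrite oppr_gt0 ln_lt0// kmin_gt0 (le_lt_trans _ kmax_lt1)// (le_trans h1).
Qed.

(** The rectangle is at least as wide as high, so reading further columns brings its width down to
    the height, with an overshoot of at most one letter, that is [A0] in logarithms. *)
Lemma stop_segment w n : Sb w n <= Sa w n ->
  exists m, [/\ stopped aC (beta w n) (alpha w n) (map col (segment w n m)),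
    Sa w (n + m) <= Sb w n & Sb w n - A0 <= Sa w (n + m)].
Proof.
rewrite -ln_alpha -ln_beta => tw.
have al0 : 0 < alpha w n by exact: wprod_gt0.
have be0 : 0 < beta w n by exact: wprod_gt0.
have kmax0 : 0 <= kmax < 1.
  have /andP[h1 h2] := be_itv (w 0%N).
  by rewrite kmax_lt1 andbT (le_trans _ h2)// (le_trans _ h1)// ltW.
have [|m sm] := @stopped_mkseq R C aC (beta w n) (alpha w n) kmax
  (fun k => col (w (n + k)%N)) be0 (ltW al0) kmax0.
  by move=> c; have /andP[_ ->] := aC_itv c; rewrite (ltW (a0 c)).
have sE : map col (segment w n m) = mkseq (fun k => col (w (n + k)%N)) m.
  by rewrite segment_shift /mkseq -map_comp.
have aE : Sa w (n + m) = ln (alpha w n * wprod aC (map col (segment w n m))).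
  by rewrite -wprod_cat -map_cat -mkseq_segment ln_alpha.
have al1 : 0 < alpha w n * wprod aC (map col (segment w n m)).
  by rewrite mulr_gt0// wprod_gt0.
exists m; rewrite sE; split => //.
  by rewrite aE ler_ln ?posrE// sE; exact: stopped_le sm.
have kb : ln (beta w n) - A0 = ln (kmin * beta w n).
  by rewrite /A0 opprK lnM ?posrE// addrC.
rewrite aE kb ler_ln ?posrE ?mulr_gt0// sE.
apply: stopped_ge sm => //.
- exact: ltW.
- by move=> c; have /andP[] := aC_itv c.
- rewrite ler_ln ?posrE// in tw; apply: le_trans tw; rewrite ler_piMl ?(ltW be0)//.
  have /andP[h1 h2] := be_itv (w 0%N).
  by rewrite (le_trans h1)// (le_trans h2)// ltW.
exact: wprod_gt0.
Qed.

(* [Good w n] says that one of finitely many weights makes the approximate square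
   of the code [w] at time [n] efficient in dimension [D - eps]; the last clause
   is the drift contradiction, the gap makes the type of a code constant. *)
Definition thin (D eps : R) : Prop :=
  exists (Good : (nat -> L) -> nat -> Prop) (c0 M : R), [/\ 0 < c0,
    forall del, 0 < del -> exists N0, forall N, (N0 <= N)%N ->
      cov (D - eps) del M [set x | exists w n, [/\ coded x w, (N <= n)%N & Good w n]],
    forall w n, (0 < n)%N -> Sb w n <= Sa w n -> ~ Good w n ->
      c0 * n%:R <= Sa w n - Sb w n &
    forall w N, ~ (forall n, (N <= n)%N -> Sb w n <= Sa w n /\ ~ Good w n)].

Variables (t e : R).
Hypothesis t_ge0 : 0 <= t.
Hypothesis sum_aC : \sum_c aC c `^ t = 1.
Hypothesis sum_pA : \sum_x aC (col x) `^ t * be x `^ e = 1.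

Let pA x := aC (col x) `^ t * be x `^ e.

Let pA_gt0 x : 0 < pA x.
Proof. by rewrite mulr_gt0// powR_gt0. Qed.

Let ln_pA x : ln (pA x) = t * ln (aC (col x)) + e * ln (be x).
Proof. by rewrite lnM ?posrE ?powR_gt0// !ln_powR. Qed.

Let exL : exists x : L, True.
Proof.
apply/not_existsP => h; move: sum_pA; rewrite big1 => [/esym/eqP|x]; first by rewrite oner_eq0.
by have := h x.
Qed.

(** The surplus [D - (t + e)] in the exponent pays for damping [pA] by a constant factor per letter,
    so every time with [Sb <= Sa] is good, and the last two clauses of [thin] hold vacuously. *)
Lemma thin_small D : 0 < D -> t + e < D ->
  exists2 eps0, 0 < eps0 & forall eps, 0 < eps <= eps0 -> thin D eps.
Proof.
move=> D0 teD; have [x0 _] := exL.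
(* Half of the surplus is left for [eps]; the other half, times the least decay [- ln kmax] per
   letter, is the damping rate [eta]. *)
pose g := (D - (t + e)) / 2.
have g0 : 0 < g by rewrite divr_gt0// subr_gt0.
have lk : ln kmax < 0.
  rewrite ln_lt0// kmax_lt1 andbT; have /andP[_] := be_itv x0; exact: lt_le_trans.
pose eta := - g * ln kmax.
have eta0 : 0 < eta by rewrite /eta; nra.
exists (Num.min D g); first by rewrite lt_min D0.
move=> eps /andP[eps0]; rewrite le_min => /andP[epsD epsg].
pose p x := expR (- eta) * pA x.
have hM := @half_cov_ln (D - eps) (t * A0) (expR (- eta)) p (fun c => aC c `^ t).
pose Good (w : nat -> L) n := exists m,
  stopped aC (beta w n) (alpha w n) (map col (segment w n m)) /\
  (D - eps) * ln (beta w n) <= t * A0 + ln (wprod p (mkseq w n)) +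
     ln (wprod (fun c => aC c `^ t) (map col (segment w n m))).
have allGood w n : Sb w n <= Sa w n -> Good w n.
  move=> tw; have [m [sm h1 h2]] := stop_segment tw; exists m; split => //.
  rewrite ln_beta ln_wprod_mkseq; last by move=> x; rewrite mulr_gt0 ?expR_gt0.
  rewrite ln_wprod_segment; last by move=> c; exact: powR_gt0.
  have -> : (fun x => ln (p x)) = (fun x => t * ln (aC (col x)) + e * ln (be x) +
      0 * ln (be x) + (- eta)).
    apply: funext => x; rewrite lnM ?posrE ?expR_gt0// expRK ln_pA mul0r addr0.
    by rewrite addrC.
  have -> : (fun x => ln (aC (col x) `^ t)) = (fun x => t * ln (aC (col x)) +
     0 * ln (be x) + 0 * ln (be x) + 0).
    by apply: funext => x; rewrite ln_powR !mul0r !addr0.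
  rewrite !psum_lin -/(Sa w n) -/(Sb w n) -/(Sa w (n + m)) !mul0r !addr0.
  have : Sb w n <= ln kmax * n%:R.
    by apply: psum_le => x; have /andP[] := step_b x.
  move=> hb; have hb0 : Sb w n <= 0.
    by apply: le_trans hb _; rewrite nmulr_rle0.
  have k1 : t * (Sb w n - A0) <= t * Sa w (n + m) by rewrite ler_wpM2l.
  have k2 : (D - eps - (t + e)) * Sb w n <= g * Sb w n.
    apply: ler_wnM2r => //; have : 2 * g = D - (t + e) by rewrite /g; field.
    lra.
  have k3 : g * Sb w n <= g * (ln kmax * n%:R) by rewrite ler_wpM2l// ltW.
  rewrite /eta; lra.
exists Good, 1, (2 `^ (D - eps) * (expR (t * A0) * (1 - expR (- eta))^-1)); split => //.
- move=> del del0; have [||||||N0 hN0] := hM _ _ _ _ _ _ _ del0.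
  + by rewrite subr_ge0.
  + by move=> x; rewrite mulr_gt0 ?expR_gt0.
  + by move=> c; exact: powR_gt0.
  + by rewrite -mulr_sumr sum_pA mulr1.
  + by rewrite expR_lt1 oppr_lt0.
  + by rewrite sum_aC.
  exists N0 => N NN; apply: cov_sub (hN0 N NN) => x [w [n [xw Nn [m [sm hm]]]]].
  by exists w, n, m; split.
- by move=> w n _ /allGood.
- by move=> w N /(_ N (leqnn N)) [/allGood].
Qed.


Variable tB : R.
Hypothesis surj : forall c, exists x, col x = c.
Let D := t + e.
Hypothesis D_gt0 : 0 < D.
(** Comparison law from the other axis, with exponents that also add up to [D]. The quotient of [pA]
    and [pt] is therefore the power [t + tB - D] of [aC / be], and comparing the two along a code
    measures the gap [Sa - Sb]. *)
Let pt x := be x `^ tB * aC (col x) `^ (D - tB).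
Hypothesis sum_pt : \sum_x pt x <= 1.
Hypothesis pA_pt : exists x, pA x != pt x.
(** Density of the column law of [pA] with respect to the law given by the [t]-th powers of [aC]. *)
Let sigma c := \sum_(x | col x == c) be x `^ e.
Hypothesis sigma_neq1 : exists c, sigma c != 1.

Let sigma_gt0 c : 0 < sigma c.
Proof.
have [x xc] := surj c; rewrite /sigma (bigD1 x) ?xc//= ltr_pwDl ?powR_gt0//.
by apply: sumr_ge0 => y _; exact: powR_ge0.
Qed.

Let sum_sigma : \sum_c aC c `^ t * sigma c = 1.
Proof.
rewrite -sum_pA (partition_big col xpredT)//=; apply: eq_bigr => c _.
by rewrite mulr_sumr; apply: eq_bigr => x /eqP <-.
Qed.

(** Mass of the geometric mean of these two column laws. It is reached from both sides: by dividing
    [pA] by the square root of [sigma], and by multiplying the powers of [aC] by that root. *)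
Let Z1 := \sum_c (aC c `^ t * (aC c `^ t * sigma c)) `^ 2^-1.

Let Z1E : Z1 = \sum_c aC c `^ t * sigma c `^ 2^-1.
Proof.
apply: eq_bigr => c _; rewrite mulrA powRM ?mulr_ge0 ?powR_ge0 ?ltW//.
by rewrite powR12_sqrt ?mulr_ge0 ?powR_ge0// -expr2 sqrtr_sqr ger0_norm ?powR_ge0.
Qed.

Let Z1_itv : 0 < Z1 < 1.
Proof.
apply/andP; split.
  have [c _] := sigma_neq1; rewrite /Z1 (bigD1 c)//= ltr_pwDl//.
    by rewrite powR_gt0// !mulr_gt0 ?powR_gt0.
  by apply: sumr_ge0 => ? _; exact: powR_ge0.
apply: sum_sqrt_lt1; rewrite ?sum_aC ?sum_sigma//.
- by move=> c; exact: powR_ge0.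
- by move=> c; rewrite mulr_ge0 ?powR_ge0 ?ltW.
have [c sc] := sigma_neq1; exists c; rewrite eq_sym -subr_eq0.
rewrite (_ : _ - _ = aC c `^ t * (sigma c - 1)); last by ring.
by rewrite mulf_neq0 ?subr_eq0// gt_eqF ?powR_gt0.
Qed.

Let sum_pA_sigma : \sum_x pA x * sigma (col x) `^ (- 2^-1) = Z1.
Proof.
rewrite Z1E (partition_big col xpredT)//=; apply: eq_bigr => c _.
under eq_bigr => x /eqP xc do rewrite xc.
rewrite -mulr_suml.
have -> : \sum_(x | col x == c) pA x = aC c `^ t * sigma c.
  by rewrite mulr_sumr; apply: eq_bigr => x /eqP <-.
rewrite -mulrA; congr (_ * _).
rewrite -{1}[sigma c]powRr1 ?ltW// -powRD ?(gt_eqF (sigma_gt0 c)) ?implybT//.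
by congr (_ `^ _); field.
Qed.

(** Each tilted weight yields one inequality where it fails: [p1] the linear gap, [p2] a linear
    lower bound for the sum [Ss] of [ln sigma] over the first word, and [p3] with [q3] the decrease
    of [Ss] along the extension. Passing from [n] to the end of its extension for ever, [Ss] would
    stay bounded and grow linearly. *)
Lemma thin_exact :
  exists2 eps0, 0 < eps0 & forall eps, 0 < eps <= eps0 -> thin D eps.
Proof.
have [x0 _] := exL; have A00 := A0_gt0 x0.
pose Z := \sum_x (pA x * pt x) `^ 2^-1.
have pt0 x : 0 < pt x by rewrite mulr_gt0// powR_gt0.
have Z0 : 0 < Z.
  rewrite /Z (bigD1 x0)//= ltr_pwDl//; first by rewrite powR_gt0// mulr_gt0.
  by apply: sumr_ge0 => ? _; exact: powR_ge0.
have Zlt1 : Z < 1.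
  apply: sum_sqrt_lt1 => //; [by move=> x; exact: ltW| by move=> x; exact: ltW|].
  by rewrite sum_pA.
have [Z10 Z1lt1] := andP Z1_itv.
pose zeta := - ln Z; pose zeta1 := - ln Z1.
have zeta0 : 0 < zeta by rewrite oppr_gt0 ln_lt0// Z0.
have zeta10 : 0 < zeta1 by rewrite oppr_gt0 ln_lt0// Z10.
pose kap := t + tB - D.
pose c0 := zeta / (2 * (`|kap| + 1)).
have kap1 : 0 < `|kap| + 1 by rewrite ltr_wpDl.
have c00 : 0 < c0 by rewrite divr_gt0// mulr_gt0.
(* Chosen so that the loss [eta * n] on the first word is at most [zeta1 / 4 * m] on an extension
   whose length [m] is at least [c0 * n / A0]. *)
pose eta := zeta1 * c0 / (4 * A0).
have eta0 : 0 < eta by rewrite divr_gt0 ?mulr_gt0.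
(* Lowering the exponent by [eps] costs at most [eps * A0] per letter; these bounds keep the cost
   below the gain of each of the three weights. *)
pose eps0 := Num.min D (Num.min (zeta / (4 * A0)) (Num.min (zeta1 / (4 * A0)) (eta / A0))).
exists eps0; first by rewrite !lt_min D_gt0 !divr_gt0 ?mulr_gt0.
move=> eps /andP[epsp]; rewrite !le_min => /and4P[epsD eps1 eps2 eps3].
(* In [p1] and [p2] half of the rate is the gain and half keeps the mass below 1. The gain of the
   third pair sits in [q3], which is normalized to mass 1, so [p3] is merely damped. *)
pose p1 x := expR (zeta / 2) * (pA x * pt x) `^ 2^-1.
pose p2 x := expR (zeta1 / 2) * (pA x * sigma (col x) `^ (- 2^-1)).
pose p3 x := expR (- eta) * pA x.
pose q1 c := aC c `^ t.
pose q3 c := expR zeta1 * (aC c `^ t * sigma c `^ 2^-1).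
have p10 x : 0 < p1 x by rewrite mulr_gt0 ?expR_gt0// powR_gt0// mulr_gt0.
have p20 x : 0 < p2 x by rewrite !mulr_gt0 ?expR_gt0// powR_gt0.
have p30 x : 0 < p3 x by rewrite mulr_gt0 ?expR_gt0.
have q10 c : 0 < q1 c by rewrite powR_gt0.
have q30 c : 0 < q3 c by rewrite !mulr_gt0 ?expR_gt0 ?powR_gt0.
have q1s : \sum_c q1 c <= 1 by rewrite sum_aC.
have expZ (z : R) : 0 < z -> expR (- ln z / 2) * z = expR (- (- ln z / 2)).
  move=> z0; rewrite -{2}[z]lnK ?posrE// -expRD; congr expR; by field.
have p1s : \sum_x p1 x <= expR (- (zeta / 2)).
  by rewrite -mulr_sumr -/Z /zeta expZ.
have p2s : \sum_x p2 x <= expR (- (zeta1 / 2)).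
  by rewrite -mulr_sumr sum_pA_sigma /zeta1 expZ.
have p3s : \sum_x p3 x <= expR (- eta).
  by rewrite -mulr_sumr sum_pA mulr1.
have q3s : \sum_c q3 c <= 1.
  by rewrite -mulr_sumr -Z1E /zeta1 expRN lnK ?posrE// mulVf ?gt_eqF.
have Deps : 0 <= D - eps by rewrite subr_ge0.
have lt1 (z : R) : 0 < z -> expR (- z) < 1 by move=> z0; rewrite expR_lt1 oppr_lt0.
have hM p q rho := @half_cov_ln (D - eps) (t * A0) rho p q Deps.
have {}hM1 := hM p1 q1 _ p10 q10 p1s (lt1 _ (divr_gt0 zeta0 (ltr0n _ 2))) q1s.
have {}hM2 := hM p2 q1 _ p20 q10 p2s (lt1 _ (divr_gt0 zeta10 (ltr0n _ 2))) q1s.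
have {hM}hM3 := hM p3 q3 _ p30 q30 p3s (lt1 _ eta0) q3s.
pose Good1 p q (w : nat -> L) n := exists m,
  stopped aC (beta w n) (alpha w n) (map col (segment w n m)) /\
  (D - eps) * ln (beta w n) <= t * A0 + ln (wprod p (mkseq w n)) +
     ln (wprod q (map col (segment w n m))).
pose Good w n := Good1 p1 q1 w n \/ (Good1 p2 q1 w n \/ Good1 p3 q3 w n).
pose Ss w n := psum (fun x => ln (sigma (col x))) w n.
have lnp1 w n : ln (wprod p1 (mkseq w n)) = (t + (D - tB)) / 2 * Sa w n +
    (e + tB) / 2 * Sb w n + 0 * Ss w n + zeta / 2 * n%:R.
  rewrite ln_wprod_mkseq// -psum_lin; congr psum; apply: funext => x.
  have PP : 0 < pA x * pt x by rewrite mulr_gt0.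
  rewrite /p1 lnM ?posrE ?expR_gt0 ?(powR_gt0 _ PP)// expRK ln_powR.
  by rewrite lnM ?posrE// ln_pA lnM ?posrE ?powR_gt0// !ln_powR; field.
have lnp2 w n : ln (wprod p2 (mkseq w n)) = t * Sa w n + e * Sb w n +
    (- 2^-1) * Ss w n + zeta1 / 2 * n%:R.
  rewrite ln_wprod_mkseq// -psum_lin; congr psum; apply: funext => x.
  have SG := powR_gt0 (- 2^-1) (sigma_gt0 (col x)).
  have PS := mulr_gt0 (pA_gt0 x) SG.
  rewrite /p2 lnM ?posrE ?expR_gt0// expRK.
  by rewrite lnM ?posrE// ln_pA ln_powR; ring.
have lnp3 w n : ln (wprod p3 (mkseq w n)) = t * Sa w n + e * Sb w n +
    0 * Ss w n + (- eta) * n%:R.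
  rewrite ln_wprod_mkseq// -psum_lin; congr psum; apply: funext => x.
  by rewrite lnM ?posrE ?expR_gt0// expRK ln_pA; ring.
have lnq1 w n m : ln (wprod q1 (map col (segment w n m))) =
    t * Sa w (n + m) - t * Sa w n.
  rewrite ln_wprod_segment//.
  have E k : psum (fun x => ln (q1 (col x))) w k = t * Sa w k + 0 * Sb w k +
    0 * Ss w k + 0 * k%:R.
    rewrite -psum_lin; congr psum; apply: funext => x; rewrite ln_powR; ring.
  by rewrite !E; ring.
have lnq3 w n m : ln (wprod q3 (map col (segment w n m))) =
    t * (Sa w (n + m) - Sa w n) + 2^-1 * (Ss w (n + m) - Ss w n) + zeta1 * m%:R.
  rewrite ln_wprod_segment//.
  have E k : psum (fun x => ln (q3 (col x))) w k = t * Sa w k + 2^-1 * Ss w k +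
    0 * Sb w k + zeta1 * k%:R.
    rewrite -psum_lin; congr psum; apply: funext => x.
    have SG := powR_gt0 2^-1 (sigma_gt0 (col x)).
    have AG := powR_gt0 t (a0 (col x)).
    have PS := mulr_gt0 AG SG.
    rewrite /q3 lnM ?posrE ?expR_gt0// expRK.
    by rewrite lnM ?posrE// !ln_powR; ring.
  by rewrite !E natrD; ring.
have Sb_ge w n : - A0 * n%:R <= Sb w n.
  by apply: psum_ge => x; have /andP[] := step_b x.
have epsA c : eps <= c / A0 -> eps * A0 <= c by rewrite ler_pdivlMr.
have {}eps1 : eps * A0 <= zeta / 4.
  apply: epsA; apply: le_trans eps1 _; rewrite le_eqVlt; apply/orP; left; apply/eqP.
  by field; rewrite gt_eqF.
have {}eps2 : eps * A0 <= zeta1 / 4.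
  apply: epsA; apply: le_trans eps2 _; rewrite le_eqVlt; apply/orP; left; apply/eqP.
  by field; rewrite gt_eqF.
have {}eps3 : eps * A0 <= eta by exact: epsA.
have epsSb w n c : eps * A0 <= c -> - (c * n%:R) <= eps * Sb w n.
  move=> hc; apply: (@le_trans _ _ (eps * (- A0 * n%:R))); last first.
    by rewrite ler_wpM2l// ltW.
  rewrite mulNr mulrN mulrA lerN2; apply: ler_wpM2r => //.
have bad_gap w n : (0 < n)%N -> Sb w n <= Sa w n -> ~ Good w n ->
    c0 * n%:R <= Sa w n - Sb w n.
  move=> n0 tw bad; have [m [sm h1 h2]] := stop_segment tw.
  have /negP : ~ ((D - eps) * ln (beta w n) <= t * A0 + ln (wprod p1 (mkseq w n)) +
     ln (wprod q1 (map col (segment w n m)))).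
    by move=> h; apply: bad; left; exists m.
  rewrite -ltNge ln_beta lnp1 lnq1 mul0r addr0.
  have k1 : t * (Sb w n - A0) <= t * Sa w (n + m) by rewrite ler_wpM2l.
  have := epsSb w n _ eps1.
  have k2 : kap / 2 * (Sa w n - Sb w n) <= (`|kap| + 1) / 2 * (Sa w n - Sb w n).
    apply: ler_wpM2r; first by rewrite subr_ge0.
    by apply: ler_wpM2r => //; apply: le_trans (ler_norm _) _; rewrite lerDl.
  have cE : c0 * n%:R * ((`|kap| + 1) / 2) = zeta / 4 * n%:R.
    by rewrite /c0; field; rewrite gt_eqF.
  move=> k3 k4.
  rewrite -(ler_pM2r (_ : 0 < (`|kap| + 1) / 2)) ?divr_gt0// cE.
  rewrite /kap in k2; rewrite /D in k2 k3 k4 *; lra.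
have bad_Ss w n : (0 < n)%N -> Sb w n <= Sa w n -> ~ Good w n ->
    zeta1 / 2 * n%:R <= Ss w n.
  move=> n0 tw bad; have [m [sm h1 h2]] := stop_segment tw.
  have /negP : ~ ((D - eps) * ln (beta w n) <= t * A0 + ln (wprod p2 (mkseq w n)) +
     ln (wprod q1 (map col (segment w n m)))).
    by move=> h; apply: bad; right; left; exists m.
  rewrite -ltNge ln_beta lnp2 lnq1.
  have k1 : t * (Sb w n - A0) <= t * Sa w (n + m) by rewrite ler_wpM2l.
  have := epsSb w n _ eps2; rewrite /D; lra.
have bad_next w n : (0 < n)%N -> Sb w n <= Sa w n -> ~ Good w n ->
    exists2 m, (n < m)%N & Ss w m <= Ss w n.
  move=> n0 tw bad; have [m [sm h1 h2]] := stop_segment tw.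
  have /negP : ~ ((D - eps) * ln (beta w n) <= t * A0 + ln (wprod p3 (mkseq w n)) +
     ln (wprod q3 (map col (segment w n m)))).
    by move=> h; apply: bad; right; right; exists m.
  rewrite -ltNge ln_beta lnp3 lnq3 mul0r addr0 => k4.
  have k1 : t * (Sb w n - A0) <= t * Sa w (n + m) by rewrite ler_wpM2l.
  have k2 := epsSb w n _ eps3.
  have k3 : - A0 * m%:R <= Sa w (n + m) - Sa w n.
    by apply: psum_seg_ge => x; have /andP[] := step_a x.
  have k5 := bad_gap w n n0 tw bad.
  (* The extension has to close the gap at a speed of at most [A0] per letter, which bounds [m] from
     below. *)
  have k6 : c0 * n%:R <= A0 * m%:R by lra.
  have k7 : eta * n%:R <= zeta1 / 4 * m%:R.
    have -> : eta * n%:R = zeta1 / (4 * A0) * (c0 * n%:R).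
      by rewrite /eta; field; rewrite gt_eqF.
    apply: (@le_trans _ _ (zeta1 / (4 * A0) * (A0 * m%:R))).
      by rewrite ler_wpM2l// ltW// divr_gt0// mulr_gt0.
    by rewrite le_eqVlt; apply/orP; left; apply/eqP; field; rewrite gt_eqF.
  exists (n + m)%N.
    rewrite -[ltnLHS]addn0 ltn_add2l -(ltr_nat R) -(pmulr_rgt0 _ A00).
    by apply: lt_le_trans k6; rewrite mulr_gt0// ltr0n.
  have : 0 <= zeta1 * m%:R by rewrite mulr_ge0// ltW.
  rewrite /D in k4 k2; lra.
pose M rho := 2 `^ (D - eps) * (expR (t * A0) * (1 - rho)^-1).
exists Good, c0, (M (expR (- (zeta / 2))) +
  (M (expR (- (zeta1 / 2))) + M (expR (- eta)))); split => //.
- move=> del del0.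
  have [N1 hN1] := hM1 del del0; have [N2 hN2] := hM2 del del0.
  have [N3 hN3] := hM3 del del0; exists (maxn N1 (maxn N2 N3)) => N.
  rewrite !geq_max => /and3P[NN1 NN2 NN3].
  apply: cov_sub (cov_setU (hN1 _ NN1) (cov_setU (hN2 _ NN2) (hN3 _ NN3))).
  move=> x [w [n [xw Nn [[m [sm hm]]|[[m [sm hm]]|[m [sm hm]]]]]]].
  + by left; exists w, n, m.
  + by right; left; exists w, n, m.
  + by right; right; exists w, n, m.
- move=> w N bad.
  (* Starting one later keeps all times positive. Chaining [bad_next] gives arbitrarily late times
     with [Ss] at most its value at [N1], against [bad_Ss]. *)
  pose N1 := N.+1.
  have step k : exists n, [/\ (N1 + k <= n)%N & Ss w n <= Ss w N1].
    elim: k => [|k [n [Nn hn]]]; first by exists N1; rewrite addn0.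
    have n0 : (0 < n)%N by apply: leq_trans Nn.
    have [|tw nG] := bad n.
      by apply: leq_trans Nn; rewrite /N1 addSn leqW ?leq_addr.
    have [m nm hm] := bad_next w n n0 tw nG; exists m; split.
      by rewrite addnS; apply: leq_ltn_trans nm.
    exact: le_trans hm hn.
  pose k := Num.bound (`|Ss w N1| / (zeta1 / 2)).
  have [n [Nn hn]] := step k.
  have n0 : (0 < n)%N by apply: leq_trans Nn.
  have [|tw nG] := bad n.
    by apply: leq_trans Nn; rewrite /N1 addSn leqW ?leq_addr.
  have := bad_Ss w n n0 tw nG.
  apply/negP; rewrite -ltNge; apply: le_lt_trans hn _.
  apply: le_lt_trans (ler_norm _) _; rewrite mulrC -ltr_pdivrMr ?divr_gt0//.
  apply: lt_le_trans (archi_boundP _) _.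
    by rewrite divr_ge0// ltW// divr_gt0.
  by rewrite ler_nat; apply: leq_trans Nn; rewrite leq_addl.
Qed.

End HalfThin.

(** * Lower bounds on the mass of a cover *)

Lemma sum_inj_le (R : realType) (L C : finType) (P : pred L) (h : L -> C) (f : C -> R) :
  (forall c, 0 <= f c) -> {in P &, injective h} ->
  \sum_(x | P x) f (h x) <= \sum_c f c.
Proof.
move=> f0 hP; rewrite (partition_big h xpredT)//=; apply: ler_sum => c _.
have [[x /andP[Px /eqP xc]]|none] := pselect (exists x, P x && (h x == c)).
  rewrite (bigD1 x) /=; last by rewrite Px xc eqxx.
  rewrite xc big1 ?addr0// => y /andP[/andP[Py /eqP yc] yx].
  by case/eqP: yx; apply: hP => //; rewrite yc xc.
by rewrite big_pred0// => x; apply/negP => h'; apply: none; exists x.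
Qed.

Section Masses.
Variables (R : realType) (r s : nat) (a : 'I_r -> R) (b : 'I_s -> R).
Variables (L C : finType) (col : L -> 'I_r) (row : L -> 'I_s).
Variables (colC : L -> C) (v : C -> 'I_r).
Hypothesis v_col : forall x, v (colC x) = col x.
Hypothesis v_inj : injective v.
Hypothesis colC_surj : forall c, exists x, colC x = c.
Hypothesis cell_inj : forall x y, col x = col y -> row x = row y -> x = y.
Hypothesis a_itv : forall i, 0 < a i < 1.
Hypothesis b_itv : forall j, 0 < b j < 1.
Hypothesis a_sum : \sum_(i < r) a i = 1.
Hypothesis b_sum : \sum_(j < s) b j = 1.
Variables (c amax : R).
Hypothesis c_gt0 : 0 < c.
Hypothesis amax_itv : 0 <= amax < 1.
Hypothesis a_ge : forall i, c <= a i.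
Hypothesis b_ge : forall j, c <= b j.
Hypothesis a_le : forall i, a i <= amax.
Hypothesis b_le : forall j, b j <= amax.
Variables (t e : R).
Hypothesis t_ge0 : 0 <= t.
Hypothesis e_ge0 : 0 <= e.
Let pA x := a (col x) `^ t * b (row x) `^ e.
Hypothesis sum_pA : \sum_x pA x = 1.
Variable (z : R * R).
Hypothesis z1_itv : 0 <= z.1 <= 1.
Hypothesis z2_itv : 0 <= z.2 <= 1.

Let a0 i : 0 < a i. Proof. by have /andP[] := a_itv i. Qed.
Let b0 j : 0 < b j. Proof. by have /andP[] := b_itv j. Qed.
Let pA_gt0 x : 0 < pA x. Proof. by rewrite mulr_gt0 ?powR_gt0. Qed.

Let pA_cell i j :
  \sum_(x | (col x == i) && (row x == j)) pA x <= a i `^ t * b j `^ e.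
Proof.
rewrite (eq_bigr (fun=> a i `^ t * b j `^ e)); last first.
  by move=> x /andP[/eqP xi /eqP xj]; rewrite /pA xi xj.
apply: le_trans (@sum_inj_le R L unit _ (fun=> tt) (fun=> a i `^ t * b j `^ e) _ _) _.
- by move=> _; rewrite mulr_ge0 ?powR_ge0.
- move=> x y /andP[/eqP xi /eqP xj] /andP[/eqP yi /eqP yj] _.
  by apply: cell_inj; rewrite ?xi ?yi ?xj ?yj.
- by rewrite big_const card_unit /= addr0.
Qed.

Let pow_lt1 rho : 0 < rho -> exists n, amax ^+ n <= rho.
Proof.
move=> rho0; have cvg0 : (fun n => amax ^+ n) @ \oo --> (0 : R).
  by apply: cvg_expr; have /andP[h1 h2] := amax_itv; rewrite ger0_norm.
have /cvgrPdist_le/(_ _ rho0) [N _ /(_ N (leqnn N))] := cvg0.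
by rewrite sub0r normrN => hN; exists N; apply: le_trans hN; exact: ler_norm.
Qed.

(** After the switch the letters follow [p2], which rescales [pA] inside each column so that the
    columns get law [a] to the power [t]. The switch depends on [rho], so this controls covers of a
    single scale, as box dimension requires. *)
Lemma mass_lower_count N rho (U : 'I_N -> pred (seq L)) (y : 'I_N -> R * R) :
  \sum_k a (v k) `^ t = 1 -> 0 < rho <= 1 ->
  (forall i w, U i w -> `|(word_point a b col row z w).1 - (y i).1| <= rho /\
                        `|(word_point a b col row z w).2 - (y i).2| <= rho) ->
  (forall w, exists i, U i w) ->
  1 <= N%:R * ((4 / c) ^+ 2 * rho `^ (t + e)).
Proof.
move=> sum_a rho01 hU Uex; have /andP[rho0 _] := rho01.
have [n hn] := pow_lt1 rho0.
pose sigma i := \sum_(x | col x == i) b (row x) `^ e.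
have sigma0 x : 0 < sigma (col x).
  rewrite /sigma (bigD1 x)//= ltr_pwDl ?powR_gt0//.
  by apply: sumr_ge0 => y' _; exact: powR_ge0.
pose p2 x := pA x / sigma (col x).
have colv x k : (col x == v k) = (colC x == k).
  by rewrite -v_col; apply/eqP/eqP => [/v_inj|->].
have p2_colE x0 : \sum_(x | col x == col x0) p2 x = a (col x0) `^ t.
  rewrite (eq_bigr (fun x => a (col x0) `^ t / sigma (col x0) * b (row x) `^ e)).
    by rewrite -mulr_sumr -/(sigma _) divfK// gt_eqF.
  by move=> x /eqP xx; rewrite /p2 /pA xx mulrAC.
have p2_sum : \sum_x p2 x = 1.
  rewrite -sum_a (partition_big colC xpredT)//=; apply: eq_bigr => k _.
  have [x0 x0k] := colC_surj k; rewrite -x0k v_col -p2_colE.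
  by apply: eq_bigl => x; rewrite x0k -colv -x0k v_col.
have p2_col i : \sum_(x | col x == i) p2 x <= a i `^ t.
  have [[x0 <-]|none] := pselect (exists x, col x = i); first by rewrite p2_colE.
  rewrite big_pred0 ?powR_ge0// => x; apply/negP => /eqP xi.
  by apply: none; exists x.
have pA_row j : \sum_(x | row x == j) pA x <= b j `^ e.
  rewrite (eq_bigr (fun x => b j `^ e * a (v (colC x)) `^ t)); last first.
    by move=> x /eqP xj; rewrite /pA xj v_col mulrC.
  rewrite -mulr_sumr ler_piMr ?powR_ge0// -sum_a.
  apply: (@sum_inj_le R L C _ colC (fun k => a (v k) `^ t)) => [k|].
    exact: powR_ge0.
  move=> x y' /eqP xj /eqP yj xy; apply: cell_inj; last by rewrite xj yj.
  by rewrite -!v_col xy.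
have p20 x : 0 <= p2 x by rewrite divr_ge0 ?ltW.
have pA0 x : 0 <= pA x by exact: ltW.
have h1 : 1 <= switch_mean pA p2 (b \o row) rho n 1 (fun=> 1).
  by apply: expect1; rewrite ?sum_pA ?p2_sum.
apply: le_trans h1 _.
apply: (@le_trans _ _ (switch_mean pA p2 (b \o row) rho n 1
    (fun w => \sum_(i < N) (U i w)%:R))).
  apply: expect_le => // w _; have [i Ui] := Uex w.
  by rewrite (bigD1 i)//= Ui lerDl sumr_ge0.
rewrite expect_sum.
apply: (@le_trans _ _ (\sum_(i < N) (4 / c) ^+ 2 * rho `^ (t + e))); last first.
  by rewrite sumr_const card_ord -[leLHS]mulr_natl.
apply: ler_sum => i _.
apply: (@mass_le _ _ _ a b L col row a_itv b_itv a_sum b_sum c amax c_gt0 a_ge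
  b_ge a_le b_le t e t_ge0 e_ge0 pA p2 pA0 p20 pA_cell pA_row p2_col _ z z1_itv
  z2_itv _ (y i)) => //.
  by rewrite p2_sum.
by move=> w _; exact: hU.
Qed.

(** If the column sums are at most 1, [pA] itself has small enough column marginals. No switch is
    made, and one expectation handles boxes of all sizes. *)
Lemma mass_lower_sum N (rho : nat -> R) (y : nat -> R * R) (U : nat -> pred (seq L)) :
  (forall i, \sum_(x | col x == i) b (row x) `^ e <= 1) ->
  (forall j, \sum_(x | row x == j) a (col x) `^ t <= 1) ->
  (forall k, 0 < rho k) ->
  (forall k w, U k w -> `|(word_point a b col row z w).1 - (y k).1| <= rho k /\
                        `|(word_point a b col row z w).2 - (y k).2| <= rho k) ->
  (forall w, exists2 k, (k < N)%N & U k w) ->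
  1 <= \sum_(k < N) Num.max 1 ((4 / c) ^+ 2) * rho k `^ (t + e).
Proof.
move=> pcol prow rho0 hU Uex.
have pA0 x : 0 <= pA x by exact: ltW.
have pA_row j : \sum_(x | row x == j) pA x <= b j `^ e.
  rewrite (eq_bigr (fun x => b j `^ e * a (col x) `^ t)); last first.
    by move=> x /eqP xj; rewrite /pA xj mulrC.
  by rewrite -mulr_sumr ler_piMr ?powR_ge0.
have pA_col i : \sum_(x | col x == i) pA x <= a i `^ t.
  rewrite (eq_bigr (fun x => a i `^ t * b (row x) `^ e)); last first.
    by move=> x /eqP xi; rewrite /pA xi.
  by rewrite -mulr_sumr ler_piMr ?powR_ge0.
have [n hn] : exists n, forall k, (k < N)%N -> amax ^+ n <= rho k.
  elim: (N) => [|N' [n hn]]; first by exists 0%N.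
  have [n' hn'] := pow_lt1 (rho0 N'); exists (maxn n n') => k.
  have /andP[m0 m1] := amax_itv.
  have mono i j : (i <= j)%N -> amax ^+ j <= amax ^+ i.
    by move=> ij; apply: ler_wiXn2l => //; exact: ltW.
  rewrite ltnS leq_eqVlt => /orP[/eqP ->|/hn].
    by apply: le_trans hn'; rewrite mono// leq_maxr.
  by apply: le_trans; rewrite mono// leq_maxl.
pose Ew d f := switch_mean pA pA (b \o row) d n 1 f.
have EwE d d' f : Ew d f = Ew d' f by exact: expect_same.
have h1 : 1 <= Ew 1 (fun=> 1) by apply: expect1; rewrite ?sum_pA.
apply: le_trans h1 _.
apply: (@le_trans _ _ (Ew 1 (fun w => \sum_(k < N) (U k w)%:R))).
  apply: expect_le => // w _; have [k kN Uk] := Uex w.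
  by rewrite (bigD1 (Ordinal kN))//= Uk lerDl sumr_ge0.
rewrite /Ew expect_sum; apply: ler_sum => k _.
have [rho1|rho1] := leP (rho k) 1.
  rewrite -/(Ew 1 _) (EwE _ (rho k)).
  apply: (@le_trans _ _ ((4 / c) ^+ 2 * rho k `^ (t + e))); last first.
    by rewrite ler_wpM2r ?powR_ge0// le_max lexx orbT.
  apply: (@mass_le _ _ _ a b L col row a_itv b_itv a_sum b_sum c amax c_gt0 a_ge
    b_ge a_le b_le t e t_ge0 e_ge0 pA pA pA0 pA0 pA_cell pA_row pA_col _ z z1_itv
    z2_itv _ (y k)) => //.
  - by rewrite sum_pA.
  - by rewrite rho0.
  - exact: hn.
  - by move=> w _; exact: hU.
(* For radii above 1 the total mass is enough; this accounts for the [1] in the maximum. *)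
apply: (@le_trans _ _ 1).
  have hle m th f : (forall w, f w <= 1) ->
      switch_mean pA pA (b \o row) 1 m th f <= 1.
    elim: m th f => [|m IH] th f f1 //=.
    rewrite -[leRHS]sum_pA; apply: ler_sum => x _; rewrite if_same.
    by rewrite ler_piMr// IH.
  by apply: hle => w; rewrite lern1 leq_b1.
rewrite mulr_ege1// ?le_max ?lexx//.
by rewrite -(powRr0 (rho k)); apply: ler_powR; [exact: ltW|exact: addr_ge0].
Qed.

End Masses.

(** * Counting approximate squares of one size *)

Section HalfBox.
Variables (R : realType) (L C : finType) (col : L -> C) (aC : C -> R) (be : L -> R).
Variables (kmin kmax : R).
Hypothesis kmin_gt0 : 0 < kmin.
Hypothesis kmax_lt1 : kmax < 1.
Hypothesis aC_itv : forall c, kmin <= aC c <= kmax.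
Hypothesis be_itv : forall x, kmin <= be x <= kmax.
Variables (coded : R * R -> (nat -> L) -> Prop) (X Y : R * R -> R).
Hypothesis track_X : forall x x' w w' n, coded x w -> coded x' w' ->
  map col (mkseq w n) = map col (mkseq w' n) ->
  `|X x - X x'| <= wprod aC (map col (mkseq w n)).
Hypothesis track_Y : forall x x' w w' n, coded x w -> coded x' w' ->
  mkseq w n = mkseq w' n -> `|Y x - Y x'| <= wprod be (mkseq w n).
Hypothesis edist_XY : forall x x' d, 0 <= d ->
  `|X x - X x'| <= d -> `|Y x - Y x'| <= d -> edist x x' <= 2 * d.

Let a0 := aC_gt0 kmin_gt0 aC_itv.
Let b0 := be_gt0 kmin_gt0 be_itv.

(** Both words stop at side [del / 2], so Kraft bounds the total weight by 1, while each pair weighs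
    at least [kmin * (del / 2)] to the power [t + e]. Exponent 0 turns the cost of the cover into a
    count. *)
Lemma half_box t e del : 0 <= t -> 0 <= e ->
  \sum_c aC c `^ t = 1 -> \sum_x aC (col x) `^ t * be x `^ e = 1 ->
  0 < del <= 1 ->
  cov 0 del ((kmin * (del / 2)) `^ (- (t + e))) [set x | exists w n,
    [/\ coded x w, stopped be (del / 2) 1 (mkseq w n) &
        kmin * (del / 2) <= wprod aC (map col (mkseq w n))]].
Proof.
move=> t0 e0 sa sp /andP[del0 del1].
pose pA x := aC (col x) `^ t * be x `^ e.
have pA0 x : 0 <= pA x by rewrite mulr_ge0 ?powR_ge0.
have d2 : 0 < del / 2 by rewrite divr_gt0.
set k2 := kmin * (del / 2).
have k20 : 0 < k2 by rewrite mulr_gt0.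
have -> : k2 `^ (- (t + e)) = 2 `^ 0 * (k2 `^ (- (t + e)) * 1).
  by rewrite powRr0 mul1r mulr1.
apply: (@half_cov R L C col aC be coded X Y track_X track_Y edist_XY 0 _ 1 del
  pA (fun c => aC c `^ t) (fun w => stopped be (del / 2) 1 w) (fun=> del / 2)) => //.
- exact: powR_ge0.
- by move=> c; exact: powR_ge0.
- by rewrite sa.
- move=> W uW hW; apply: kraft_wprod => //; first by rewrite sp.
  by move=> u v /hW su /hW sv; exact: stopped_prefix su sv.
- move=> w /stopped_le; rewrite mul1r => wd; split => //; first exact: ltW.
  by rewrite mulrC divfK.
move=> x [w [n [xw sw kw]]].
have al0 : 0 < wprod aC (map col (mkseq w n)) by exact: wprod_gt0.
have be0 : 0 < wprod be (mkseq w n) by exact: wprod_gt0.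
have kmax0 : 0 <= kmax < 1.
  have /andP[h1 h2] := be_itv (w 0%N).
  by rewrite kmax_lt1 andbT (le_trans _ h2)// (le_trans _ h1)// ltW.
have kmin1 : kmin <= 1.
  have /andP[h1 h2] := be_itv (w 0%N).
  by rewrite (le_trans h1)// (le_trans h2)// ltW.
have [|m sm] := @stopped_mkseq R C aC (del / 2) (wprod aC (map col (mkseq w n))) kmax
  (fun k => col (w (n + k)%N)) d2 (ltW al0) kmax0.
  by move=> c; have /andP[_ ->] := aC_itv c; rewrite (ltW (a0 c)).
have sE : map col (segment w n m) = mkseq (fun k => col (w (n + k)%N)) m.
  by rewrite segment_shift /mkseq -map_comp.
exists w, n, m; split => //; first by rewrite sE.
rewrite powRr0.
have h1 : k2 <= wprod be (mkseq w n).
  have := @stopped_ge R L be (del / 2) kmin 1 (mkseq w n) d2 (ltW kmin_gt0).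
  rewrite mul1r; apply => //; first by move=> y; have /andP[] := be_itv y.
  by apply: mulr_ile1; rewrite ?(ltW kmin_gt0)// ?(ltW d2)//; lra.
have h2 : k2 <= wprod aC (map col (mkseq w n)) * wprod aC (map col (segment w n m)).
  rewrite sE; apply: stopped_ge sm => //; first exact: ltW.
  by move=> c; have /andP[] := aC_itv c.
have -> : wprod pA (mkseq w n) =
    wprod aC (map col (mkseq w n)) `^ t * wprod be (mkseq w n) `^ e.
  rewrite /pA wprodM; congr (_ * _); last exact: wprod_powR.
  by rewrite (wprod_map col); apply: (@wprod_powR _ _ (aC \o col)) => y; exact: a0.
rewrite (@wprod_powR _ _ aC)// powRN [_^-1 * _]mulrC ler_pdivlMr ?powR_gt0// mul1r.
rewrite powRD; last by rewrite (gt_eqF k20) implybT.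
rewrite mulrAC -powRM ?(ltW al0)//; last by apply: wprod_ge0 => c; exact: ltW.
by apply: ler_pM; rewrite ?powR_ge0//; apply: ge0_ler_powR;
  rewrite ?nnegrE ?(ltW k20)// ?(ltW be0)// mulr_ge0 ?(ltW al0)//;
  apply: wprod_ge0 => c; exact: ltW.
Qed.

End HalfBox.

(** Intermediate value theorem on the unit interval: the two bounds are the values of the sum at
    exponents 0 and 1. *)
Lemma exists_exponent (R : realType) (T : finType) (f g : T -> R) :
  (forall x, 0 < f x < 1) -> (forall x, 0 < g x) ->
  1 <= \sum_x g x -> \sum_x g x * f x <= 1 ->
  exists2 u, 0 <= u & \sum_x g x * f x `^ u = 1.
Proof.
move=> f01 g0 g1 gf1.
pose F u := \sum_x g x * f x `^ u.
have cF : {within `[0, 1], continuous F}.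
  have cx x : continuous (fun u : R => g x * f x `^ u).
    have /andP[fx0 _] := f01 x.
    have -> : (fun u : R => g x * f x `^ u) = (fun u => g x * expR (u * ln (f x))).
      by apply: funext => y; rewrite /powR gt_eqF.
    move=> u; apply: cvgMr; apply: continuous_comp; last exact: continuous_expR.
    by apply: cvgMl; exact: cvg_id.
  apply: continuous_subspaceT; rewrite /F.
  elim: (index_enum T) => [|x s IH].
    under eq_fun do rewrite big_nil.
    by move=> u; exact: cvg_cst.
  under eq_fun do rewrite big_cons.
  by move=> u; apply: cvgD; [exact: cx|exact: IH].
have F0 : F 0 = \sum_x g x.
  by apply: eq_bigr => x _; rewrite powRr0 mulr1.
have F1 : F 1 = \sum_x g x * f x.
  by apply: eq_bigr => x _; have /andP[/ltW fx _] := f01 x; rewrite powRr1.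
have [|u] := @IVT R F 0 1 1 ler01 cF.
  by rewrite F0 F1 ge_min gf1 orbT le_max g1.
by rewrite in_itv /= => /andP[u0 _] Fu; exists u.
Qed.

(** * Coding of the attractor *)

Lemma finite_itv01 (R : realType) (T : finType) (f : T -> R) :
  (forall x, 0 < f x < 1) ->
  exists c k, [/\ 0 < c, 0 <= k < 1 & forall x, c <= f x <= k].
Proof.
move=> f01.
suff [c [k [c0 k1 h]]] : exists c k, [/\ 0 < c, 0 <= k < 1 &
    forall x, x \in enum T -> c <= f x <= k].
  by exists c, k; split => // x; apply: h; rewrite mem_enum.
elim: (enum T) => [|x s [c [k [c0 /andP[k0 k1] h]]]].
  by exists 1, 0; split => //; rewrite lexx ltr01.
have /andP[fx0 fx1] := f01 x.
exists (Num.min c (f x)), (Num.max k (f x)); split.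
- by rewrite lt_min c0.
- by rewrite le_max k0 gt_max k1.
- move=> y; rewrite inE => /orP[/eqP ->|/h /andP[h1 h2]].
    by rewrite ge_min le_max !lexx !orbT.
  by rewrite ge_min le_max h1 h2.
Qed.

Section Carpet.
Variables (R : realType) (r s d : nat) (a : 'I_r -> R) (b : 'I_s -> R).
Variables (J : {set 'I_r * 'I_s}) (K : set (R * R)).
Hypothesis sys : baranski_system d a b J.
Hypothesis att : baranski_attractor a b J K.

Let a_itv := baranski_a_itv sys.
Let b_itv := baranski_b_itv sys.
Let a_sum := baranski_a_sum sys.
Let b_sum := baranski_b_sum sys.
Let a0 i : 0 < a i. Proof. by have /andP[] := a_itv i. Qed.
Let b0 j : 0 < b j. Proof. by have /andP[] := b_itv j. Qed.

Definition letter : finType := {x : 'I_r * 'I_s | x \in J}.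
Definition lcol (x : letter) : 'I_r := (val x).1.
Definition lrow (x : letter) : 'I_s := (val x).2.

Definition word_map (w : seq letter) (z : R * R) : R * R :=
  word_point a b lcol lrow z w.

Lemma word_map_cons x w z :
  word_map (x :: w) z = baranski_map a b (val x) (word_map w z).
Proof.
rewrite /word_map /word_point /baranski_map /= !wprod_cons -/(offset _ _) -/(offset _ _).
by congr (_, _); rewrite /lcol /lrow /=; ring.
Qed.

Lemma attractorP x : K x <-> exists l : letter, exists2 y, K y & baranski_map a b (val l) y = x.
Proof.
have [_ _ KE] := att; split.
  by rewrite {1}KE => -[p /= pJ [y Ky yx]]; exists (Sub p pJ), y => //; rewrite SubK.
by move=> [l [y Ky yx]]; rewrite KE; exists (val l) => /=; [exact: (valP l)|exists y].
Qed.

Lemma word_map_K w z : K z -> K (word_map w z).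
Proof.
move=> Kz; elim: w => [|x w IH].
  rewrite /word_map /word_point /= !wprod_nil !add0r !mul1r.
  by case: z Kz.
rewrite word_map_cons; apply/attractorP; exists x, (word_map w z) => //.
Qed.

(** Each use of the self-similarity shrinks the possible excess of [S] over the unit interval by the
    factor [k], so there is none. *)
Let coord_itv (S : set R) (T : finType) (al oo : T -> R) :
  (forall i, 0 < al i < 1) -> (forall i, 0 <= oo i) -> (forall i, al i + oo i <= 1) ->
  (exists M, forall x, S x -> `|x| <= M) ->
  (forall x, S x -> exists i, exists2 y, S y & x = al i * y + oo i) ->
  forall x, S x -> 0 <= x <= 1.
Proof.
move=> al01 oo0 oo1 [M SM] Sex.
have [c [k [c0 /andP[k0 k1] alk]]] := finite_itv01 al01.
have h n x : S x -> - (M * k ^+ n) <= x <= 1 + M * k ^+ n.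
  elim: n x => [|n IH] x Sx.
    rewrite expr0 mulr1; have := SM x Sx; rewrite ler_norml => /andP[-> /=].
    by move/le_trans; apply; rewrite lerDr.
  have [i [y Sy xE]] := Sex x Sx.
  have M0 : 0 <= M by apply: le_trans (SM x Sx).
  have kn0 : 0 <= M * k ^+ n by rewrite mulr_ge0 ?exprn_ge0.
  have /andP[a1 a2] := alk i; have /andP[al0 _] := al01 i.
  have /andP[y1 y2] := IH y Sy.
  have e : al i * (M * k ^+ n) <= M * k ^+ n.+1.
    by rewrite exprS [leRHS]mulrCA ler_wpM2r.
  have e1 : al i * - (M * k ^+ n) <= al i * y by rewrite ler_pM2l.
  have e2 : al i * y <= al i * (1 + M * k ^+ n) by rewrite ler_pM2l.
  have := oo0 i; have := oo1 i; rewrite xE.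
  by move=> o1 o0; apply/andP; split; lra.
move=> x Sx.
have cvg0 : (fun n => M * k ^+ n) @ \oo --> (0 : R).
  by rewrite -[X in _ --> X](mulr0 M); apply: cvgMr; apply: cvg_expr; rewrite ger0_norm.
apply/andP; split.
  apply/ler_addgt0Pr => e e0.
  have /cvgrPdist_le/(_ _ e0) [N _ /(_ N (leqnn N))] := cvg0.
  rewrite sub0r normrN ler_norml => /andP[_ hN]; have /andP[h1 _] := h N x Sx; lra.
apply/ler_addgt0Pr => e e0.
have /cvgrPdist_le/(_ _ e0) [N _ /(_ N (leqnn N))] := cvg0.
rewrite sub0r normrN ler_norml => /andP[_ hN]; have /andP[_ h1] := h N x Sx; lra.
Qed.

Lemma attractor_unit_square x : K x -> (0 <= x.1 <= 1) /\ (0 <= x.2 <= 1).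
Proof.
have [_ cK _] := att.
have [M SM] : exists M, forall x, K x -> `|x.1| <= M /\ `|x.2| <= M.
  have [M [_ hM]] := compact_bounded cK.
  exists (M + 1) => y Ky; have := hM (M + 1) _ y Ky.
  rewrite /= prod_normE /= ge_max ltrDl ltr01 => /(_ isT) /andP[]; by [].
move=> Kx; split.
  apply: (@coord_itv [set z | exists2 y, K y & z = y.1] _ a (fun i => offset a i)) => //.
  - by move=> i; exact: offset_ge0.
  - by move=> i; exact: offset_le1.
  - by exists M => _ [y /SM[? _] ->].
  - move=> _ [y /attractorP[l [z Kz <-]] ->]; exists (lcol l), z.1 => //.
    by exists z.
  - by exists x.
apply: (@coord_itv [set z | exists2 y, K y & z = y.2] _ b (fun i => offset b i)) => //.
- by move=> i; exact: offset_ge0.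
- by move=> i; exact: offset_le1.
- by exists M => _ [y /SM[_ ?] ->].
- move=> _ [y /attractorP[l [z Kz <-]] ->]; exists (lrow l), z.2 => //.
  by exists z.
- by exists x.
Qed.

(** The remaining point [z] ranges over the unit square, which contains the attractor; this suffices
    for all diameter estimates. *)
Definition coded (x : R * R) (w : nat -> letter) : Prop :=
  forall n, exists z, [/\ 0 <= z.1 <= 1, 0 <= z.2 <= 1 & x = word_map (mkseq w n) z].

Lemma coded_exists x : K x -> exists w, coded x w.
Proof.
move=> Kx.
have [l0 _] : exists l : letter, True by have /attractorP[l _] := Kx; exists l.
have /choice[f fP] : forall y, exists lz : letter * (R * R),
    K y -> K lz.2 /\ y = baranski_map a b (val lz.1) lz.2.
  move=> y; have [/attractorP[l [z Kz yE]]|nK] := pselect (K y).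
    by exists (l, z).
  by exists (l0, y) => /nK.
pose y := fix y k := if k is k'.+1 then (f (y k')).2 else x.
have Ky k : K (y k).
  by elim: k => [|k IH] //=; have [] := fP _ IH.
exists (fun k => (f (y k)).1) => n; exists (y n).
have [h1 h2] := attractor_unit_square (Ky n); split => //.
elim: n {h1 h2} => [|n IH].
  by rewrite /mkseq /word_map /word_point /= !wprod_nil !add0r !mul1r; case: (x).
rewrite IH; have [_ yE] := fP _ (Ky n).
rewrite {1}yE mkseqS.
have rc w l z : word_map (rcons w l) z = word_map w (baranski_map a b (val l) z).
  elim: w => [|l' w IHw]; last by rewrite rcons_cons !word_map_cons IHw.
  rewrite /= word_map_cons /word_map /word_point /= !wprod_nil !add0r !mul1r.
  by case: z.
by rewrite rc.
Qed.

Let track (r' : nat) (al : 'I_r' -> R) (u u' : seq 'I_r') (z z' : R) :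
  (forall i, 0 < al i) -> 0 <= z <= 1 -> 0 <= z' <= 1 -> u = u' ->
  `|lo al u + wprod al u * z - (lo al u' + wprod al u' * z')| <= wprod al u.
Proof.
move=> al0 /andP[z0 z1] /andP[z0' z1'] <-.
rewrite (_ : _ - _ = wprod al u * (z - z')); last by ring.
have u0 : 0 < wprod al u by exact: wprod_gt0.
rewrite normrM gtr0_norm// ler_piMr ?(ltW u0)// ler_norml; apply/andP; split; lra.
Qed.

Lemma track1 x x' w w' n : coded x w -> coded x' w' ->
  map lcol (mkseq w n) = map lcol (mkseq w' n) ->
  `|x.1 - x'.1| <= wprod a (map lcol (mkseq w n)).
Proof.
by move=> /(_ n)[z [z1 _ ->]] /(_ n)[z' [z1' _ ->]] /= E; exact: track.
Qed.

Lemma track2 x x' w w' n : coded x w -> coded x' w' ->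
  map lrow (mkseq w n) = map lrow (mkseq w' n) ->
  `|x.2 - x'.2| <= wprod b (map lrow (mkseq w n)).
Proof.
by move=> /(_ n)[z [_ z1 ->]] /(_ n)[z' [_ z1' ->]] /= E; exact: track.
Qed.

Definition column : finType := {i : 'I_r | [exists j, (i, j) \in J]}.
Definition line : finType := {j : 'I_s | [exists i, (i, j) \in J]}.

Lemma lcolP x : [exists j, (lcol x, j) \in J].
Proof. by apply/existsP; exists (lrow x); have := valP x; rewrite /lcol /lrow; case: (val x). Qed.

Lemma lrowP x : [exists i, (i, lrow x) \in J].
Proof. by apply/existsP; exists (lcol x); have := valP x; rewrite /lcol /lrow; case: (val x). Qed.

Definition ccol (x : letter) : column := exist _ (lcol x) (lcolP x).
Definition crow (x : letter) : line := exist _ (lrow x) (lrowP x).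

Lemma ccol_surj c : exists x, ccol x = c.
Proof.
case: c => i hi; have /existsP[j ij] := hi.
by exists (exist _ (i, j) ij); apply: val_inj.
Qed.

Lemma crow_surj c : exists x, crow x = c.
Proof.
case: c => j hj; have /existsP[i ij] := hj.
by exists (exist _ (i, j) ij); apply: val_inj.
Qed.

Lemma letter_inj x y : lcol x = lcol y -> lrow x = lrow y -> x = y.
Proof.
move=> h1 h2; apply: val_inj; move: h1 h2; rewrite /lcol /lrow.
by case: (val x) => ? ?; case: (val y) => ? ? /= -> ->.
Qed.

Definition col_width (c : column) : R := a (val c).
Definition line_height (c : line) : R := b (val c).

Lemma card_letter : (1 < #|letter|)%N.
Proof. by rewrite card_sig (baranski_card sys) (baranski_d_ge2 sys). Qed.

Lemma sides_itv : exists c k, [/\ 0 < c, 0 <= k < 1,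
  forall i, c <= a i <= k & forall j, c <= b j <= k].
Proof.
have [c [k [c0 k1 h]]] := @finite_itv01 R ('I_r + 'I_s)%type
  (fun x => match x with inl i => a i | inr j => b j end)
  (fun x => match x with inl i => a_itv i | inr j => b_itv j end).
exists c, k; split => // i; [exact: (h (inl i))|exact: (h (inr i))].
Qed.

End Carpet.

(** * Box dimension *)

(** Letters of one column lie in distinct rows, so the second sum is at most 1 when [e = 1]. If both
    exponents vanished, that sum would count the letters, of which there are at least two. *)
Lemma half_exponents (R : realType) (L C C' : finType) (col : L -> C) (row : L -> C')
    (aC : C -> R) (bC : C' -> R) :
  (forall c, exists x, col x = c) ->
  (forall x y, col x = col y -> row x = row y -> x = y) ->
  (forall c, 0 < aC c < 1) -> (forall c, 0 < bC c < 1) ->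
  \sum_c aC c <= 1 -> \sum_c bC c <= 1 -> (1 < #|L|)%N ->
  exists t e, [/\ 0 <= t, 0 <= e, 0 < t + e, \sum_c aC c `^ t = 1 &
    \sum_x aC (col x) `^ t * bC (row x) `^ e = 1].
Proof.
move=> surj cell_inj a01 b01 a1 b1 L2.
have a0 c : 0 < aC c by have /andP[] := a01 c.
have b0 c : 0 < bC c by have /andP[] := b01 c.
have [x0 _] : exists x : L, true.
  by move: L2; rewrite -cardsT => /ltnW /card_gt0P [x _]; exists x.
have h1 : 1 <= \sum_(c : C) (1 : R).
  by rewrite (bigD1 (col x0))//= lerDl sumr_ge0.
have h2 : \sum_c 1 * aC c <= 1.
  by rewrite (eq_bigr aC)// => c _; rewrite mul1r.
have [t t0 sa'] := exists_exponent a01 (fun=> ltr01) h1 h2.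
have sa : \sum_c aC c `^ t = 1.
  by rewrite -sa'; apply: eq_bigr => c _; rewrite mul1r.
have g0 x : 0 < aC (col x) `^ t by exact: powR_gt0.
have h3 : 1 <= \sum_x aC (col x) `^ t.
  rewrite -sa (partition_big col xpredT)//=; apply: ler_sum => c _.
  have [x xc] := surj c; rewrite (bigD1 x) ?xc//= lerDl.
  by apply: sumr_ge0 => y _; exact: powR_ge0.
have h4 : \sum_x aC (col x) `^ t * bC (row x) <= 1.
  rewrite -sa (partition_big col xpredT)//=; apply: ler_sum => c _.
  rewrite (eq_bigr (fun x => aC c `^ t * bC (row x))); last by move=> x /eqP <-.
  rewrite -mulr_sumr ler_piMr ?powR_ge0//; apply: le_trans b1.
  apply: sum_inj_le => [c'|x y]; first exact: ltW.
  by move=> /eqP xc /eqP yc; apply: cell_inj; rewrite xc yc.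
have [e e0 sp] := exists_exponent (fun x => b01 (row x)) g0 h3 h4.
exists t, e; split => //; rewrite lt_neqAle addr_ge0// andbT eq_sym.
rewrite paddr_eq0//; apply/negP => /andP[/eqP tE /eqP eE].
move: sp; rewrite tE eE.
under eq_bigr do rewrite !powRr0 mul1r.
rewrite sumr_const -[1 in RHS]/(1%:R) => /eqP; rewrite eqr_nat => /eqP cE.
by move: L2; rewrite cE.
Qed.

Lemma has_box_dimI (R : realType) (K : set (R * R)) D CL CU : 0 < CL ->
  (forall del, 0 < del <= 1 -> cov 0 del (CU * del `^ (- D)) K) ->
  (forall del N (F : 'I_N -> set (R * R)), 0 < del <= 1 ->
    (forall i, (diam (F i) <= del%:E)%E) -> K `<=` \bigcup_i F i ->
    CL * del `^ (- D) <= N%:R) ->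
  has_box_dim K D.
Proof.
move=> CL0 hU hL.
have cn del : 0 < del <= 1 ->
    CL * del `^ (- D) <= covering_number del K <= CU * del `^ (- D).
  move=> del01; have [n [F [nM Fd KF]]] := covering_number_le (hU _ del01).
  apply/andP; split.
    apply: lb_le_inf; first by exists n%:R, n => //; exists F.
    by move=> _ [m [G [Gd KG]] <-]; exact: (hL _ _ G).
  apply: le_trans nM; apply: ge_inf; last by exists n => //; exists F.
  by exists 0 => _ [m _ <-].
pose M := `|ln CL| + `|ln CU|.
have M0 : 0 <= M by rewrite addr_ge0.
apply/cvgrPdist_le => e e0.
(* Below this scale the bounded error [M] is at most [e] times [- ln del]. *)
pose del0 := expR (- ((M + 1) / e)).
have del0_lt1 : del0 < 1.
  by rewrite expR_lt1 oppr_lt0 divr_gt0// ltr_wpDl.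
near=> del.
have del_gt0 : 0 < del by near: del; exact: nbhs_right_gt.
have deld : del < del0 by near: del; apply: nbhs_right_lt; exact: expR_gt0.
have del1 : 0 < del <= 1 by rewrite del_gt0 ltW// (lt_trans deld).
have /andP[h1 h2] := cn del del1.
have P0 : 0 < del `^ (- D) by rewrite powR_gt0.
have N0 : 0 < covering_number del K by apply: lt_le_trans h1; rewrite mulr_gt0.
have CU0 : 0 < CU by rewrite -(pmulr_lgt0 _ P0); apply: lt_le_trans h2.
have l0 : (M + 1) / e <= - ln del.
  rewrite lerNr; have := ltW deld; rewrite -ler_ln ?posrE ?expR_gt0//.
  by rewrite expRK.
have ld : 0 < - ln del by apply: lt_le_trans l0; rewrite divr_gt0// ltr_wpDl.
have Pl : 0 < CL * del `^ (- D) by exact: mulr_gt0.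
have Pu : 0 < CU * del `^ (- D) by exact: mulr_gt0.
move: h1; rewrite -ler_ln ?posrE// lnM ?posrE// ln_powR => h1.
move: h2; rewrite -ler_ln ?posrE// lnM ?posrE// ln_powR => h2.
set l := - ln del in l0 ld *; have lE : ln del = - l by rewrite /l opprK.
rewrite lE in h1 h2.
have -> : D - ln (covering_number del K) / l =
    (D * l - ln (covering_number del K)) / l by field; rewrite gt_eqF.
rewrite normrM normfV (gtr0_norm ld) ler_pdivrMr//.
have : M <= e * l.
  by rewrite mulrC -ler_pdivrMr//; apply: le_trans l0; rewrite ler_pM2r ?invr_gt0// lerDl.
apply: le_trans; rewrite ler_norml /M.
have := ler_norm (- ln CL); have := ler_norm (ln CU); rewrite normrN.
have := normr_ge0 (ln CU); have := normr_ge0 (ln CL).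
move=> k1 k2 k3 k4; apply/andP; split; lra.
Unshelve. all: by end_near.
Qed.

Section CarpetDimension.
Variables (R : realType) (r s d : nat) (a : 'I_r -> R) (b : 'I_s -> R).
Variables (J : {set 'I_r * 'I_s}) (K : set (R * R)).
Hypothesis sys : baranski_system d a b J.
Hypothesis att : baranski_attractor a b J K.

Let a_itv := baranski_a_itv sys.
Let b_itv := baranski_b_itv sys.
Let a_sum := baranski_a_sum sys.
Let b_sum := baranski_b_sum sys.

Local Notation L := (letter J).

Lemma column_exponents : exists t e, [/\ 0 <= t, 0 <= e, 0 < t + e,
  \sum_(c : column J) col_width a c `^ t = 1 &
  \sum_(x : L) a (lcol x) `^ t * b (lrow x) `^ e = 1].
Proof.
have cw_itv (c : column J) : 0 < col_width a c < 1 by exact: a_itv.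
have inj (x y : L) : ccol x = ccol y -> lrow x = lrow y -> x = y.
  by move=> /(congr1 val) /= h1; exact: letter_inj.
have cw1 : \sum_(c : column J) col_width a c <= 1.
  rewrite -a_sum; apply: (@sum_inj_le R (column J) 'I_r xpredT val a).
    by move=> c; apply: ltW; have /andP[] := a_itv c.
  by move=> x y _ _; exact: val_inj.
have b1 : \sum_j b j <= 1 by rewrite b_sum.
have [t [e [h1 h2 h3 h4 h5]]] :=
  half_exponents (@ccol_surj _ _ J) inj cw_itv b_itv cw1 b1 (card_letter sys).
by exists t, e.
Qed.

Lemma line_exponents : exists t e, [/\ 0 <= t, 0 <= e, 0 < t + e,
  \sum_(c : line J) line_height b c `^ t = 1 &
  \sum_(x : L) b (lrow x) `^ t * a (lcol x) `^ e = 1].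
Proof.
have cw_itv (c : line J) : 0 < line_height b c < 1 by exact: b_itv.
have inj (x y : L) : crow x = crow y -> lcol x = lcol y -> x = y.
  by move=> /(congr1 val) /= h1 h2; exact: letter_inj.
have cw1 : \sum_(c : line J) line_height b c <= 1.
  rewrite -b_sum; apply: (@sum_inj_le R (line J) 'I_s xpredT val b).
    by move=> c; apply: ltW; have /andP[] := b_itv c.
  by move=> x y _ _; exact: val_inj.
have a1 : \sum_j a j <= 1 by rewrite a_sum.
have [t [e [h1 h2 h3 h4 h5]]] :=
  half_exponents (@crow_surj _ _ J) inj cw_itv a_itv cw1 a1 (card_letter sys).
by exists t, e.
Qed.

Let a0 i : 0 < a i. Proof. by have /andP[] := a_itv i. Qed.
Let b0 j : 0 < b j. Proof. by have /andP[] := b_itv j. Qed.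

Variables (tA eA tB eB : R).
Hypothesis tA_ge0 : 0 <= tA.
Hypothesis eA_ge0 : 0 <= eA.
Hypothesis tB_ge0 : 0 <= tB.
Hypothesis eB_ge0 : 0 <= eB.
Hypothesis sum_col : \sum_(c : column J) col_width a c `^ tA = 1.
Hypothesis sum_line : \sum_(c : line J) line_height b c `^ tB = 1.
Hypothesis sum_A : \sum_(x : L) a (lcol x) `^ tA * b (lrow x) `^ eA = 1.
Hypothesis sum_B : \sum_(x : L) b (lrow x) `^ tB * a (lcol x) `^ eB = 1.

Let D := Num.max (tA + eA) (tB + eB).

Lemma column_track x x' w w' n : coded a b x w -> coded a b x' w' ->
  map (@ccol r s J) (mkseq w n) = map (@ccol r s J) (mkseq w' n) ->
  `|x.1 - x'.1| <= wprod (@col_width R r s a J) (map (@ccol r s J) (mkseq w n)).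
Proof.
move=> xw xw' E; rewrite wprod_map -[_ \o _]/(a \o @lcol r s J) -wprod_map.
apply: (track1 sys xw xw'); move/(congr1 (map val)): E.
by rewrite -!map_comp.
Qed.

Lemma row_track x x' w w' n : coded a b x w -> coded a b x' w' ->
  mkseq w n = mkseq w' n ->
  `|x.2 - x'.2| <= wprod (fun l : L => b (lrow l)) (mkseq w n).
Proof.
move=> xw xw' E; rewrite -[fun l => _]/(b \o @lrow r s J) -wprod_map.
by apply: (track2 sys xw xw'); rewrite E.
Qed.

Lemma line_track x x' w w' n : coded a b x w -> coded a b x' w' ->
  map (@crow r s J) (mkseq w n) = map (@crow r s J) (mkseq w' n) ->
  `|x.2 - x'.2| <= wprod (@line_height R r s b J) (map (@crow r s J) (mkseq w n)).
Proof.
move=> xw xw' E; rewrite wprod_map -[_ \o _]/(b \o @lrow r s J) -wprod_map.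
apply: (track2 sys xw xw'); move/(congr1 (map val)): E.
by rewrite -!map_comp.
Qed.

Lemma lcol_track x x' w w' n : coded a b x w -> coded a b x' w' ->
  mkseq w n = mkseq w' n ->
  `|x.1 - x'.1| <= wprod (fun l : L => a (lcol l)) (mkseq w n).
Proof.
move=> xw xw' E; rewrite -[fun l => _]/(a \o @lcol r s J) -wprod_map.
by apply: (track1 sys xw xw'); rewrite E.
Qed.

Lemma edist_le_swap (x x' : R * R) d' : 0 <= d' ->
  `|x.2 - x'.2| <= d' -> `|x.1 - x'.1| <= d' -> edist x x' <= 2 * d'.
Proof. by move=> ? ? ?; exact: edist_le. Qed.

Lemma attractor_nonempty : K !=set0.
Proof. by case: att. Qed.

Let CLpos : exists c k, [/\ 0 < c, 0 <= k < 1,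
  forall i, c <= a i <= k & forall j, c <= b j <= k].
Proof. exact: sides_itv sys. Qed.

Lemma box_lower : exists2 CL, 0 < CL &
  forall del N (F : 'I_N -> set (R * R)), 0 < del <= 1 ->
    (forall i, (diam (F i) <= del%:E)%E) -> K `<=` \bigcup_i F i ->
    CL * del `^ (- D) <= N%:R.
Proof.
have [c [k [c0 k1 ak bk]]] := CLpos.
have [z Kz] := attractor_nonempty.
have [z1 z2] := attractor_unit_square sys att Kz.
have a_ge i : c <= a i by have /andP[] := ak i.
have a_le i : a i <= k by have /andP[] := ak i.
have b_ge i : c <= b i by have /andP[] := bk i.
have b_le i : b i <= k by have /andP[] := bk i.
have Cpos : 0 < ((4 / c) ^+ 2)^-1 by rewrite invr_gt0 exprn_gt0// divr_gt0.
exists ((4 / c) ^+ 2)^-1 => // del N F del01 Fd KF.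
have /andP[del0 _] := del01.
pose U (i : 'I_N) (w : seq L) := `[< F i (word_map a b w z) >].
have Uex w : exists i, U i w.
  have [i _ Fi] := KF _ (word_map_K att w Kz).
  by exists i; apply/asboolP.
pose y (i : 'I_N) : R * R := xget (0, 0) (F i).
have hU i w : U i w -> `|(word_map a b w z).1 - (y i).1| <= del /\
                       `|(word_map a b w z).2 - (y i).2| <= del.
  move=> /asboolP Fw; have Fy : F i (y i) by apply: xgetPex; exists (word_map a b w z).
  have := edist_le_diam (Fd i) Fw Fy.
  by split; [apply: le_trans (edist_ge1 _ _) _|apply: le_trans (edist_ge2 _ _) _].
have fin t e : 1 <= N%:R * ((4 / c) ^+ 2 * del `^ (t + e)) ->
    ((4 / c) ^+ 2)^-1 * del `^ (- (t + e)) <= N%:R.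
  have P1 : 0 < (4 / c) ^+ 2 by rewrite exprn_gt0// divr_gt0.
  have P2 : 0 < del `^ (t + e) by rewrite powR_gt0.
  rewrite powRN; move: ((4 / c) ^+ 2) (del `^ (t + e)) P1 P2 => x y' x0 y0 h.
  have -> : x^-1 / y' = 1 / (x * y') by field; rewrite !gt_eqF.
  by rewrite ler_pdivrMr ?mulr_gt0.
have vA (x : L) : val (ccol x) = lcol x by [].
have vB (x : L) : val (crow x) = lrow x by [].
have injB (x x' : L) : lrow x = lrow x' -> lcol x = lcol x' -> x = x'.
  by move=> h1 h2; exact: letter_inj.
(* The bound for the second pair of exponents is the same count with the axes of the base point and
   of the centres exchanged. *)
rewrite /D /Num.max; case: ifP => _; apply: fin.
  apply: (mass_lower_count vB val_inj (@crow_surj _ _ J) injB b_itv a_itv b_sum a_sum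
    c0 k1 b_ge a_ge b_le a_le tB_ge0 eB_ge0 sum_B (z := (z.2, z.1)) z2 z1
    (y := fun i => ((y i).2, (y i).1)) sum_line del01 (U := U) _ Uex).
  by move=> i w /hU [h1 h2]; split.
exact: (mass_lower_count vA val_inj (@ccol_surj _ _ J) (@letter_inj _ _ J) a_itv b_itv
  a_sum b_sum c0 k1 a_ge b_ge a_le b_le tA_ge0 eA_ge0 sum_A z1 z2 sum_col del01 hU Uex).
Qed.

Lemma box_upper : exists CU, forall del, 0 < del <= 1 -> cov 0 del (CU * del `^ (- D)) K.
Proof.
have [c [k [c0 /andP[k0 k1] ak bk]]] := CLpos.
exists ((c / 2) `^ (- (tA + eA)) + (c / 2) `^ (- (tB + eB))) => del del01.
have /andP[del0 del1] := del01.
have covA := @half_box R L (column J) (@ccol r s J) (@col_width R r s a J)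
  (fun x => b (lrow x)) c k c0 k1 (fun c => ak _) (fun x => bk _)
  (@coded R r s a b J) fst snd column_track row_track (@edist_le R)
  tA eA del tA_ge0 eA_ge0 sum_col sum_A del01.
have covB := @half_box R L (line J) (@crow r s J) (@line_height R r s b J)
  (fun x => a (lcol x)) c k c0 k1 (fun c => bk _) (fun x => ak _)
  (@coded R r s a b J) snd fst line_track lcol_track edist_le_swap
  tB eB del tB_ge0 eB_ge0 sum_line sum_B del01.
have weaken t e E : t + e <= D -> cov 0 del ((c * (del / 2)) `^ (- (t + e))) E ->
    cov 0 del ((c / 2) `^ (- (t + e)) * del `^ (- D)) E.
  move=> teD [F [f [h1 h2 h3 h4]]]; exists F, f; split => // n.
  apply: le_trans (h3 n) _.
  rewrite (_ : c * (del / 2) = c / 2 * del); last by field.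
  rewrite powRM ?divr_ge0 ?(ltW c0) ?(ltW del0)//.
  rewrite ler_wpM2l ?powR_ge0//; apply: ger_powR => //.
  by rewrite lerN2.
have hA : tA + eA <= D by rewrite le_max lexx.
have hB : tB + eB <= D by rewrite le_max lexx orbT.
rewrite mulrDl; apply: cov_sub (cov_setU (weaken _ _ _ hA covA) (weaken _ _ _ hB covB)).
move=> x /(coded_exists sys att) [w xw].
have d2 : 0 < del / 2 by rewrite divr_gt0.
have k1' : 0 <= k < 1 by rewrite k0.
have a_itv' (x' : L) : 0 <= a (lcol x') <= k.
  by have /andP[_ ->] := ak (lcol x'); rewrite ltW.
have b_itv' (x' : L) : 0 <= b (lrow x') <= k.
  by have /andP[_ ->] := bk (lrow x'); rewrite ltW.
have [n sn] := stopped_mkseq w d2 ler01 k1' b_itv'.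
have [m sm] := stopped_mkseq w d2 ler01 k1' a_itv'.
have kd : c * (del / 2) <= 1.
  have /andP[h1 _] := ak (lcol (w 0%N)).
  have /andP[_ h2] := a_itv (lcol (w 0%N)).
  by apply: mulr_ile1; [exact: ltW|exact: ltW|apply: le_trans h1 _; exact: ltW|lra].
have anti (f : L -> R) i j : (forall l, 0 < f l < 1) -> (i <= j)%N ->
    wprod f (mkseq w j) <= wprod f (mkseq w i).
  move=> f01 ij; rewrite -(subnKC ij) mkseq_segment wprod_cat.
  have f0 l : 0 < f l by have /andP[] := f01 l.
  rewrite ler_piMr//; first by rewrite ltW// wprod_gt0.
  apply: le_trans (wprod_le_expr (c := 1) _ _) _; last by rewrite expr1n.
  by move=> l; have /andP[h1 h2] := f01 l; rewrite !ltW.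
(* The code is cut when the first of the two sides reaches [del / 2]; the other side is then still
   at least [c * (del / 2)], since it reaches its own threshold no earlier. *)
have [nm|mn] := leqP n m.
- left; exists w, n; split => //.
  rewrite wprod_map -[_ \o _]/(fun l : L => a (lcol l)).
  apply: le_trans (anti (fun l => a (lcol l)) _ _ _ nm); last by move=> l; exact: a_itv.
  have := stopped_ge d2 (ltW c0) _ kd sm; rewrite mul1r; apply.
  by move=> l; have /andP[] := ak (lcol l).
- right; exists w, m; split => //.
  rewrite wprod_map -[_ \o _]/(fun l : L => b (lrow l)).
  apply: le_trans (anti (fun l => b (lrow l)) _ _ _ (ltnW mn)); last by move=> l; exact: b_itv.
  have := stopped_ge d2 (ltW c0) _ kd sn; rewrite mul1r; apply.
  by move=> l; have /andP[] := bk (lrow l).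
Qed.

Lemma carpet_box_dim : has_box_dim K D.
Proof.
have [CL CL0 hL] := box_lower; have [CU hU] := box_upper.
exact: has_box_dimI CL0 hU hL.
Qed.

Hypothesis D_gt0 : 0 < D.

Lemma hausdorff_measure_max_lty : (hausdorff_measure D K < +oo)%E.
Proof.
have [CU hU] := box_upper.
apply: (@le_lt_trans _ _ CU%:E); last exact: ltry.
apply: (@hausdorff_measure_le _ _ _ 1) => // del del0 del1.
have del01 : 0 < del <= 1 by rewrite del0.
have := cov_expo (lexx 0) D_gt0 (hU del del01).
rewrite subr0 powRN mulrCA mulfV ?mulr1//.
by rewrite gt_eqF// powR_gt0.
Qed.

End CarpetDimension.

(** * Carpets with equal dimensions *)

Section ThinOrUniform.
Variables (R : realType) (L C C' : finType) (col : L -> C) (row : L -> C').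
Variables (aC : C -> R) (bC : C' -> R) (kmin kmax : R).
Hypothesis kmin_gt0 : 0 < kmin.
Hypothesis kmax_lt1 : kmax < 1.
Hypothesis aC_itv : forall c, kmin <= aC c <= kmax.
Hypothesis bC_itv : forall c, kmin <= bC c <= kmax.
Variables (coded : R * R -> (nat -> L) -> Prop) (X Y : R * R -> R).
Hypothesis track_X : forall x x' w w' n, coded x w -> coded x' w' ->
  map col (mkseq w n) = map col (mkseq w' n) ->
  `|X x - X x'| <= wprod aC (map col (mkseq w n)).
Hypothesis track_Y : forall x x' w w' n, coded x w -> coded x' w' ->
  mkseq w n = mkseq w' n -> `|Y x - Y x'| <= wprod (fun x => bC (row x)) (mkseq w n).
Hypothesis edist_XY : forall x x' d, 0 <= d ->
  `|X x - X x'| <= d -> `|Y x - Y x'| <= d -> edist x x' <= 2 * d.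
Hypothesis surj : forall c, exists x, col x = c.
Hypothesis cell_inj : forall x y, col x = col y -> row x = row y -> x = y.
Variables (t e t' e' D : R).
Hypothesis t_ge0 : 0 <= t.
Hypothesis sum_a : \sum_c aC c `^ t = 1.
Hypothesis sum_b : \sum_c bC c `^ t' = 1.
Hypothesis sum_ab : \sum_x aC (col x) `^ t * bC (row x) `^ e = 1.
Hypothesis sum_ba : \sum_x bC (row x) `^ t' * aC (col x) `^ e' = 1.
Hypothesis D_gt0 : 0 < D.
Hypothesis teD : t + e <= D.
Hypothesis teD' : t' + e' <= D.
Hypothesis neq_sides : exists x, aC (col x) != bC (row x).

Let sigma c := \sum_(x | col x == c) bC (row x) `^ e.

(** The place where unequal sides matter. If [pA] and [pt] agreed, a letter with unequal sides would
    force [e = t']; the column sums would then be at most 1, and having weighted mean 1 they would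
    all be 1. So nonuniform columns give two different laws, as [thin_exact] requires. *)
Lemma thin_or_uniform : (t + e = D /\ forall c, sigma c = 1) \/
  (exists2 eps0, 0 < eps0 & forall eps, 0 < eps <= eps0 ->
     thin col aC (fun x => bC (row x)) coded D eps).
Proof.
have a0 c : 0 < aC c by have /andP[h _] := aC_itv c; apply: lt_le_trans h.
have b0 c : 0 < bC c by have /andP[h _] := bC_itv c; apply: lt_le_trans h.
have be_itv x : kmin <= bC (row x) <= kmax by exact: bC_itv.
move: teD; rewrite le_eqVlt => /orP[/eqP tE|tlt]; last first.
  right; exact: (thin_small kmin_gt0 kmax_lt1 aC_itv be_itv track_X track_Y edist_XY
    t_ge0 sum_a sum_ab D_gt0 tlt).
have [uni|/existsNP[c0 sc0]] := pselect (forall c, sigma c = 1); first by left.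
right.
pose pt x := bC (row x) `^ t' * aC (col x) `^ (t + e - t').
have a1 c : 0 < aC c <= 1.
  by rewrite a0 /=; have /andP[_ h] := aC_itv c; apply: le_trans h _; exact: ltW.
have sum_pt : \sum_x pt x <= 1.
  rewrite -sum_ba; apply: ler_sum => x _; rewrite ler_wpM2l ?powR_ge0//.
  apply: ger_powR; first exact: a1.
  by rewrite lerBrDl tE.
have pA_pt : exists x, aC (col x) `^ t * bC (row x) `^ e != pt x.
  apply: contrapT => /forallNP allE.
  have [x0 x0ne] := neq_sides.
  have et' : e = t'.
    have /negP := allE x0; rewrite negbK => /eqP /(congr1 (@ln R)).
    rewrite !lnM ?posrE ?powR_gt0// !ln_powR => h.
    have : (t' - e) * (ln (aC (col x0)) - ln (bC (row x0))) = 0 by lra.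
    move/eqP; rewrite mulf_eq0 !subr_eq0 => /orP[/eqP ->//|/eqP].
    by move/ln_inj => hab; move: x0ne; rewrite hab ?posrE// eqxx.
  have sle c : sigma c <= 1.
    rewrite -sum_b /sigma et'.
    apply: (@sum_inj_le R L C' _ row (fun c => bC c `^ t')) => [c'|x y].
      exact: powR_ge0.
    by move=> /eqP xc /eqP yc; apply: cell_inj; rewrite xc yc.
  have : \sum_c aC c `^ t * (1 - sigma c) = 0.
    under eq_bigr do rewrite mulrBr mulr1.
    rewrite sumrB sum_a -[1 in LHS]sum_ab (partition_big col xpredT)//=.
    apply/eqP; rewrite subr_eq0; apply/eqP; apply: eq_bigr => c _.
    by rewrite mulr_sumr; apply: eq_bigr => x /eqP <-.
  move/eqP; rewrite psumr_eq0; last first.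
    by move=> c _; rewrite mulr_ge0 ?powR_ge0// subr_ge0.
  move=> /allP /(_ c0 (mem_index_enum _)); rewrite /= mulf_eq0.
  rewrite gt_eqF ?powR_gt0//= subr_eq0 => /eqP h; exact: sc0.
have D0 : 0 < t + e by rewrite tE.
have sne : exists c, sigma c != 1 by exists c0; apply/eqP.
rewrite -tE; exact: (thin_exact kmin_gt0 kmax_lt1 aC_itv be_itv track_X track_Y
  edist_XY t_ge0 sum_a sum_ab surj D0 sum_pt pA_pt sne).
Qed.

End ThinOrUniform.

Section CarpetMeasure.
Variables (R : realType) (r s d : nat) (a : 'I_r -> R) (b : 'I_s -> R).
Variables (J : {set 'I_r * 'I_s}) (K : set (R * R)).
Hypothesis sys : baranski_system d a b J.
Hypothesis att : baranski_attractor a b J K.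

Let a_itv := baranski_a_itv sys.
Let b_itv := baranski_b_itv sys.
Let a_sum := baranski_a_sum sys.
Let b_sum := baranski_b_sum sys.
Let a0 i : 0 < a i. Proof. by have /andP[] := a_itv i. Qed.
Let b0 j : 0 < b j. Proof. by have /andP[] := b_itv j. Qed.

Local Notation L := (letter J).
Local Notation ccol := (@ccol r s J).
Local Notation crow := (@crow r s J).
Local Notation width := (@col_width R r s a J).
Local Notation height := (@line_height R r s b J).

Lemma hausdorff_measure_uniform_gt0 t e : 0 <= t -> 0 <= e -> 0 < t + e ->
  \sum_(x : L) a (lcol x) `^ t * b (lrow x) `^ e = 1 ->
  (forall i, \sum_(x : L | lcol x == i) b (lrow x) `^ e <= 1) ->
  (forall j, \sum_(x : L | lrow x == j) a (lcol x) `^ t <= 1) ->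
  (0 < hausdorff_measure (t + e) K)%E.
Proof.
move=> t0 e0 te0 sp scol srow; have [Kne cK _] := att; have [z Kz] := Kne.
have [z1 z2] := attractor_unit_square sys att Kz.
have [c [k [c0 k1 ak bk]]] := sides_itv sys.
have a_ge i : c <= a i by have /andP[] := ak i.
have a_le i : a i <= k by have /andP[] := ak i.
have b_ge i : c <= b i by have /andP[] := bk i.
have b_le i : b i <= k by have /andP[] := bk i.
pose C := Num.max 1 ((4 / c) ^+ 2).
have C0 : 0 < C by rewrite lt_max ltr01.
apply: (@hausdorff_measure_gt0 _ _ C^-1) => //; first by rewrite invr_gt0.
move=> n y rho rho0 Kbox.
pose U k (w : seq L) := `[< box (y k) (rho k) (word_map a b w z) >].
have Uex w : exists2 k, (k < n)%N & U k w.
  have [i kn h] := Kbox _ (word_map_K att w Kz).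
  by exists i => //; apply/asboolP.
have hU k' w : U k' w -> `|(word_map a b w z).1 - (y k').1| <= rho k' /\
                       `|(word_map a b w z).2 - (y k').2| <= rho k'.
  by move=> /asboolP[h1 h2]; split; exact: ltW.
have := mass_lower_sum (@letter_inj _ _ J) a_itv b_itv a_sum b_sum c0 k1 a_ge b_ge a_le b_le
  t0 e0 sp z1 z2 scol srow rho0 hU Uex.
by rewrite -mulr_sumr -/C => h; rewrite -div1r ler_pdivrMr// mulrC.
Qed.

(** A code that is bad at all late times has a linear gap between the logarithms of its sides, of
    either sign. The sign cannot change, so the code keeps one type for ever, which the last clause
    of [thin] forbids. *)
Lemma thin_measure_lty D : 0 < D ->
  (exists2 eps0, 0 < eps0 & forall eps, 0 < eps <= eps0 ->
     thin ccol width (fun x => b (lrow x)) (@coded R r s a b J) D eps) ->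
  (exists2 eps0, 0 < eps0 & forall eps, 0 < eps <= eps0 ->
     thin crow height (fun x => a (lcol x)) (@coded R r s a b J) D eps) ->
  exists eps, [/\ 0 < eps, eps <= D & (hausdorff_measure (D - eps) K < +oo)%E].
Proof.
move=> D0 [epsA epsA0 thA] [epsB epsB0 thB].
pose eps := Num.min D (Num.min epsA epsB).
have eps0 : 0 < eps by rewrite !lt_min D0 epsA0.
have epsD : eps <= D by rewrite ge_min lexx.
have epA : 0 < eps <= epsA by rewrite eps0 !ge_min lexx orbT.
have epB : 0 < eps <= epsB by rewrite eps0 !ge_min lexx !orbT.
have {thA}[GA [cA [MA [cA0 covA gapA endA]]]] := thA _ epA.
have {thB}[GB [cB [MB [cB0 covB gapB endB]]]] := thB _ epB.
exists eps; split => //; apply: (@le_lt_trans _ _ (MA + MB)%:E); last exact: ltry.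
apply: (@hausdorff_measure_le _ _ _ 1) => // del del0 _.
have [NA hA] := covA del del0; have [NB hB] := covB del del0.
pose N0 := maxn NA NB.
apply: cov_sub (cov_setU (hA N0 (leq_maxl _ _)) (hB N0 (leq_maxr _ _))).
move=> x /(coded_exists sys att)[w xw].
suff [n Nn [Gn|Gn]] : exists2 n, (N0 <= n)%N & GA w n \/ GB w n.
- by left; exists w, n.
- by right; exists w, n.
apply: contrapT => none.
have bad n : (N0 <= n)%N -> ~ GA w n /\ ~ GB w n.
  by move=> Nn; split => G; apply: none; exists n => //; [left|right].
pose da n := psum (fun x : L => ln (a (lcol x))) w n.
pose db n := psum (fun x : L => ln (b (lrow x))) w n.
have gA n : (0 < n)%N -> db n <= da n -> ~ GA w n -> cA * n%:R <= da n - db n.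
  exact: gapA.
have gB n : (0 < n)%N -> da n <= db n -> ~ GB w n -> cB * n%:R <= db n - da n.
  exact: gapB.
have [c [k [c0 /andP[_ k1] ak bk]]] := sides_itv sys.
have lb (f : R) : c <= f <= k -> - - ln c <= ln f <= 0.
  move=> /andP[h1 h2]; have f0 : 0 < f by apply: lt_le_trans h1.
  rewrite opprK ler_ln ?posrE// h1 /= ln_le0// (le_trans h2)// ltW//.
pose A0 := - ln c.
have A00 : 0 <= A0.
  by have := lb _ (ak (lcol (w 0%N))); rewrite /A0 => /andP[h1 h2]; lra.
have step n : `|(da n.+1 - db n.+1) - (da n - db n)| <= A0.
  rewrite /da /db /psum !big_nat_recr//=.
  have /andP[h1 h2] := lb _ (ak (lcol (w n))).
  have /andP[h3 h4] := lb _ (bk (lrow (w n))).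
  rewrite ler_norml /A0; apply/andP; split; lra.
pose cm := Num.min cA cB.
have cm0 : 0 < cm by rewrite lt_min cA0.
(* From [N1] on the gap exceeds [A0], the largest change of the difference by one letter. *)
pose N1 := (maxn N0.+1 (Num.bound (A0 / cm))).
have N1N0 n : (N1 <= n)%N -> (N0 <= n)%N /\ (0 < n)%N.
  move=> h; have : (N0.+1 <= n)%N by apply: leq_trans h; rewrite leq_maxl.
  by move=> h'; split; [exact: ltnW|apply: leq_trans h'].
have big n : (N1 <= n)%N -> A0 < cm * n%:R.
  move=> h; rewrite mulrC -ltr_pdivrMr//.
  apply: lt_le_trans (archi_boundP _) _; first by rewrite divr_ge0// ltW.
  by rewrite ler_nat; apply: leq_trans h; rewrite leq_maxr.
have cmA n : cm * n%:R <= cA * n%:R by rewrite ler_wpM2r// ge_min lexx.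
have cmB n : cm * n%:R <= cB * n%:R by rewrite ler_wpM2r// ge_min lexx orbT.
have [h0|h0] := leP (db N1) (da N1).
  apply: (endA w N1) => n Nn; suff : db n <= da n by have [/bad[? _] _] := N1N0 n Nn.
  rewrite -(subnKC Nn); elim: (n - N1)%N => [|m IH]; first by rewrite addn0.
  have Nm : (N1 <= N1 + m)%N by rewrite leq_addr.
  have [/bad[nA _] m0] := N1N0 _ Nm.
  have := gA _ m0 IH nA; have := big _ Nm; have := cmA (N1 + m)%N.
  have := step (N1 + m)%N; rewrite addnS ler_norml => /andP[h1 _]; lra.
apply: (endB w N1) => n Nn; suff : da n <= db n by have [/bad[_ ?] _] := N1N0 n Nn.
rewrite -(subnKC Nn); elim: (n - N1)%N => [|m IH]; first by rewrite addn0 ltW.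
have Nm : (N1 <= N1 + m)%N by rewrite leq_addr.
have [/bad[_ nB] m0] := N1N0 _ Nm.
have := gB _ m0 IH nB; have := big _ Nm; have := cmB (N1 + m)%N.
have := step (N1 + m)%N; rewrite addnS ler_norml => /andP[_ h1]; lra.
Qed.

End CarpetMeasure.

Lemma equal_dimensions_measure (R : realType) (K : set (R * R)) (D : R) :
  is_baranski_carpet K -> has_box_dim K D -> hausdorff_dim K = D ->
  (0 < hausdorff_measure (hausdorff_dim K) K)%E /\
  (hausdorff_measure (hausdorff_dim K) K < +oo)%E.
Proof.
move=> [r [s [d [a [b [J [sys att [p pJ abp] _ _]]]]]]] boxD dimD.
have [tA [eA [tA0 eA0 DA0 sumtA sumA]]] := column_exponents sys.
have [tB [eB [tB0 eB0 DB0 sumtB sumB]]] := line_exponents sys.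
set DA := tA + eA in DA0; set DB := tB + eB in DB0.
pose D' := Num.max DA DB.
have D'0 : 0 < D' by rewrite lt_max DA0.
have box' := carpet_box_dim sys att tA0 eA0 tB0 eB0 sumtA sumtB sumA sumB.
have DD : D = D' by apply: cvg_unique boxD box'.
rewrite dimD DD; split; last first.
  exact: (hausdorff_measure_max_lty sys att tA0 eA0 tB0 eB0 sumtA sumtB sumA sumB).
have DAD : DA <= D' by rewrite le_max lexx.
have DBD : DB <= D' by rewrite le_max lexx orbT.
have [c [k [c0 /andP[_ k1] ak bk]]] := sides_itv sys.
have neA : exists x : letter J, col_width a (ccol x) != line_height b (crow x).
  by exists (exist _ p pJ).
have neB : exists x : letter J, line_height b (crow x) != col_width a (ccol x).
  by exists (exist _ p pJ); rewrite eq_sym.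
have injA (x y : letter J) : ccol x = ccol y -> crow x = crow y -> x = y.
  by move=> /(congr1 val) /= h1 /(congr1 val) /= h2; exact: letter_inj.
have injB (x y : letter J) : crow x = crow y -> ccol x = ccol y -> x = y.
  by move=> h1 h2; exact: injA.
have wi (c' : column J) : c <= col_width a c' <= k by exact: ak.
have hi (c' : line J) : c <= line_height b c' <= k by exact: bk.
have [[DAE uniA]|thA] := thin_or_uniform (row := @crow r s J)
  (X := fst) (Y := snd) c0 k1 wi hi (column_track sys)
  (row_track sys) (@edist_le R) (@ccol_surj _ _ J) injA tA0 sumtA sumtB sumA sumB
  D'0 DAD DBD neA.
  rewrite -DAE; apply: (hausdorff_measure_uniform_gt0 sys att) => //.
  - move=> i; have [hi'|hi'] := boolP [exists j, (i, j) \in J].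
      by rewrite -(uniA (exist _ i hi')).
    by rewrite big_pred0// => x; apply/negP => /eqP xi; move: (lcolP x); rewrite xi (negPf hi').
  (* The row sums need no uniformity: letters of one row lie in distinct columns, so their powers of
     [a] sum to at most [sumtA]. *)
  - move=> j; rewrite -sumtA.
    apply: (@sum_inj_le R (letter J) (column J) _ (@ccol r s J) (fun c => col_width a c `^ tA)).
      by move=> c'; exact: powR_ge0.
    by move=> x y /eqP xj /eqP yj /(congr1 val) /= h; apply: letter_inj => //; rewrite xj yj.
have [[DBE uniB]|thB] := thin_or_uniform (row := @ccol r s J)
  (X := snd) (Y := fst) c0 k1 hi wi (line_track sys)
  (lcol_track sys) (@edist_le_swap R) (@crow_surj _ _ J) injB tB0 sumtB sumtA sumB sumA
  D'0 DBD DAD neB.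
  rewrite -DBE addrC; apply: (hausdorff_measure_uniform_gt0 sys att) => //.
  - by rewrite addrC.
  - by rewrite -[RHS]sumB; apply: eq_bigr => x _; rewrite mulrC.
  - move=> i; rewrite -sumtB.
    apply: (@sum_inj_le R (letter J) (line J) _ (@crow r s J) (fun c => line_height b c `^ tB)).
      by move=> c'; exact: powR_ge0.
    by move=> x y /eqP xj /eqP yj /(congr1 val) /= h; apply: letter_inj => //; rewrite xj yj.
  - move=> j; have [hj|hj] := boolP [exists i, (i, j) \in J].
      by rewrite -(uniB (exist _ j hj)).
    by rewrite big_pred0// => x; apply/negP => /eqP xi; move: (lrowP x); rewrite xi (negPf hj).
have [eps [eps0 epsD' fin]] := thin_measure_lty sys att D'0 thA thB.
have : hausdorff_dim K <= D' - eps by apply: hausdorff_dim_le fin; rewrite subr_ge0.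
by rewrite dimD DD; rewrite lerDl oppr_ge0 leNgt eps0.
Qed.

(** * Existence of the attractor *)

Section AttractorExists.
Variables (R : realType) (r s d : nat) (a : 'I_r -> R) (b : 'I_s -> R).
Variables (J : {set 'I_r * 'I_s}).
Hypothesis sys : baranski_system d a b J.

Let a_itv := baranski_a_itv sys.
Let b_itv := baranski_b_itv sys.
Let a_sum := baranski_a_sum sys.
Let b_sum := baranski_b_sum sys.
Let a0 i : 0 < a i. Proof. by have /andP[] := a_itv i. Qed.
Let b0 j : 0 < b j. Proof. by have /andP[] := b_itv j. Qed.

Local Notation L := (letter J).
Let f (l : L) := baranski_map a b (val l).
Let S : set (R * R) := `[0, 1] `*` `[0, 1].

Let f_S l x : S x -> S (f l x).
Proof.
have itv (r' : nat) (al : 'I_r' -> R) (i : 'I_r') z : (forall i, 0 < al i) ->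
    \sum_i al i = 1 -> 0 <= z <= 1 ->
    0 <= al i * z + \sum_(j < r' | (j < i)%N) al j <= 1.
  move=> al0 al1 z01; have := affine_itv al0 al1 [:: i] z01.
  by rewrite /= wprod_cons wprod_nil mulr0 mulr1 add0r addrC.
rewrite /S /= !in_itv /= => -[x1 x2].
by split; apply: itv.
Qed.

Let f_inj l : injective (f l).
Proof.
move=> [x1 x2] [y1 y2] [/addIr h1 /addIr h2]; congr (_, _).
- by apply: mulfI h1; rewrite gt_eqF.
- by apply: mulfI h2; rewrite gt_eqF.
Qed.

Let f_continuous l : continuous (f l).
Proof.
move=> x.
have h1 : (fun y => (f l y).1) @ x --> (f l x).1.
  by apply: cvgD; [apply: cvgMr; exact: cvg_fst|exact: cvg_cst].
have h2 : (fun y => (f l y).2) @ x --> (f l x).2.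
  by apply: cvgD; [apply: cvgMr; exact: cvg_snd|exact: cvg_cst].
exact: (cvg_pair h1 h2).
Qed.

Let Kn := fix Kn n : set (R * R) :=
  if n is m.+1 then \big[setU/set0]_(l : L) (f l @` Kn m) else S.

Let KnS n x : Kn n.+1 x <-> exists l, exists2 y, Kn n y & f l y = x.
Proof.
rewrite /= -bigcup_seq /bigcup /=; split; first by move=> [l _ [y Ky yx]]; exists l, y.
by move=> [l [y Ky yx]]; exists l; [rewrite /= mem_index_enum|exists y].
Qed.

Let Kn_compact n : compact (Kn n).
Proof.
elim: n => [|n IH] /=.
  by apply: compact_setX; exact: segment_compact.
apply: bigsetU_compact => l _; apply: continuous_compact => //.
exact/continuous_subspaceT/f_continuous.
Qed.

Let Kn_decr n x : Kn n.+1 x -> Kn n x.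
Proof.
elim: n x => [|n IH] x /KnS[l [y Ky <-]]; first exact: f_S.
by apply/KnS; exists l, y => //; exact: IH.
Qed.

Let Kn_le n m x : (n <= m)%N -> Kn m x -> Kn n x.
Proof.
move=> /subnKC <-; elim: (m - n)%N => [|k IH]; first by rewrite addn0.
by rewrite addnS => /Kn_decr.
Qed.

(** For the inclusion of [K] in the union of its images, injectivity makes the preimage of [x] under
    a map the same at every stage; a map that fails at some stage fails later too, and finitely many
    maps fail at a common stage. The fixed points show that [K] is nonempty, and later that it lies
    on no axis-parallel line. *)
Lemma attractor_exists : exists2 K, baranski_attractor a b J K &
  forall l : L, exists2 x, K x & f l x = x.
Proof.
pose K : set (R * R) := \bigcap_n Kn n.
have fixK l : exists2 x, K x & f l x = x.
  pose x : R * R := ((\sum_(i < r | (i < (val l).1)%N) a i) / (1 - a (val l).1),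
                     (\sum_(j < s | (j < (val l).2)%N) b j) / (1 - b (val l).2)).
  have fx : f l x = x.
    have /andP[_ h1] := a_itv (val l).1; have /andP[_ h2] := b_itv (val l).2.
    by congr (_, _) => /=; field; rewrite subr_eq0 gt_eqF.
  exists x => // n _; elim: n => [|n IH]; last by apply/KnS; exists l, x.
  have h (r' : nat) (al : 'I_r' -> R) (i : 'I_r') : (forall i, 0 < al i < 1) ->
      \sum_i al i = 1 ->
      0 <= (\sum_(j < r' | (j < i)%N) al j) / (1 - al i) <= 1.
    move=> al01 al1; have al0 j : 0 < al j by have /andP[] := al01 j.
    have /andP[_ h] := al01 i; rewrite -/(offset al i).
    rewrite divr_ge0 ?offset_ge0 ?subr_ge0 ?(ltW h)//= ler_pdivrMr ?subr_gt0//.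
    by rewrite mul1r lerBrDl; exact: offset_le1.
  by change (S x); rewrite /S /x; split; rewrite /= in_itv /=; apply: h.
have [l0 _] : exists l : L, true.
  by have := card_letter sys; rewrite -cardsT => /ltnW /card_gt0P [x _]; exists x.
exists K => //; split.
- by have [x Kx _] := fixK l0; exists x.
- apply: (@subclosed_compact _ _ S) => //; last by move=> x /(_ 0%N I).
    apply: closed_bigI => n _; apply: compact_closed; last exact: Kn_compact.
    exact: norm_hausdorff.
  by apply: compact_setX; exact: segment_compact.
- rewrite predeqE => x; split; last first.
    move=> [p /= pJ [y Ky <-]] n _; apply: Kn_decr.
    by apply/KnS; exists (exist _ p pJ), y => //; exact: Ky.
  move=> Kx; apply: contrapT => none.
  have nK l : exists n, ~ exists2 y, Kn n y & f l y = x.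
    apply: contrapT => /forallNP h.
    have [y0 _ y0x] : exists2 y, Kn 0 y & f l y = x by have /contrapT := h 0%N.
    apply: none; exists (val l); first exact: (valP l).
    exists y0 => // n _; have [y Ky yx] : exists2 y, Kn n y & f l y = x.
      by have /contrapT := h n.
    by rewrite (_ : y0 = y)//; apply: (@f_inj l); rewrite y0x yx.
  have /choice[nl hnl] := nK.
  have /KnS[l [y Ky yx]] := Kx (\max_l nl l).+1 I.
  apply: (hnl l); exists y => //; apply: Kn_le Ky; exact: leq_bigmax.
Qed.

End AttractorExists.

(** * First returns to wide rectangles *)

Section FirstReturn.
Variables (R : realType) (L C : finType) (col : L -> C) (aC : C -> R) (be : L -> R).
Variables (kmin kmax : R).
Hypothesis kmin_gt0 : 0 < kmin.
Hypothesis kmax_itv : 0 <= kmax < 1.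
Hypothesis aC_itv : forall c, kmin <= aC c <= kmax.
Hypothesis be_itv : forall x, kmin <= be x <= kmax.
Variables (coded : R * R -> (nat -> L) -> Prop) (X Y : R * R -> R).
Hypothesis track_X : forall x x' w w' n, coded x w -> coded x' w' ->
  map col (mkseq w n) = map col (mkseq w' n) ->
  `|X x - X x'| <= wprod aC (map col (mkseq w n)).
Hypothesis track_Y : forall x x' w w' n, coded x w -> coded x' w' ->
  mkseq w n = mkseq w' n -> `|Y x - Y x'| <= wprod be (mkseq w n).
Hypothesis edist_XY : forall x x' d, 0 <= d ->
  `|X x - X x'| <= d -> `|Y x - Y x'| <= d -> edist x x' <= 2 * d.

Let a0 := aC_gt0 kmin_gt0 aC_itv.
Let b0 := be_gt0 kmin_gt0 be_itv.

(* The words at which a code first has [beta <= alpha] after time [N] form a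
   prefix-free family, so their total weight is at most 1. *)
Lemma first_return_cov t e del N : 0 <= t -> 0 <= e ->
  \sum_c aC c `^ t = 1 -> \sum_x aC (col x) `^ t * be x `^ e = 1 ->
  0 < del -> 2 * kmax ^+ N <= del ->
  cov (t + e) del (2 `^ (t + e) * (kmin `^ (- t) * 1)) [set x | exists w n,
    [/\ coded x w, (N <= n)%N &
        wprod be (mkseq w n) <= wprod aC (map col (mkseq w n))]].
Proof.
move=> t0 e0 sa sp del0 delN.
pose pA x := aC (col x) `^ t * be x `^ e.
have pA0 x : 0 <= pA x by rewrite mulr_ge0 ?powR_ge0.
pose wide w := wprod be w <= wprod aC (map col w).
pose G (w : seq L) := [&& (N <= size w)%N, wide w &
  [forall k : 'I_(size w), (N <= k)%N ==> ~~ wide (take k w)]].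
apply: (@half_cov R L C col aC be coded X Y track_X track_Y edist_XY _ _ 1 del
  pA (fun c => aC c `^ t) G (fun w => wprod be w)) => //.
- exact: addr_ge0.
- exact: powR_ge0.
- by move=> c; exact: powR_ge0.
- by rewrite sa.
- move=> W uW hW; apply: kraft_wprod => //; first by rewrite sp.
  move=> u v /hW /and3P[Nu wu _] /hW /and3P[_ _ /forallP hv] uv.
  move: (uv); rewrite prefixE => /eqP uE.
  have := size_prefix uv; rewrite leq_eqVlt => /orP[/eqP su|su].
    by rewrite -uE su take_size.
  by have := hv (Ordinal su); rewrite /= Nu /= uE wu.
- move=> w /and3P[Nw _ _]; split => //; first by rewrite ltW// wprod_gt0.
  apply: le_trans delN; rewrite ler_pM2l//.
  apply: le_trans (wprod_le_expr (c := kmax) _ _) _.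
    by move=> x; have /andP[_ ->] := be_itv x; rewrite ltW.
  by have /andP[k0 /ltW k1] := kmax_itv; apply: ler_wiXn2l.
move=> x [w [n0 [xw Nn0 wn0]]].
have ex : exists n, (N <= n)%N && wide (mkseq w n) by exists n0; rewrite Nn0.
case: (ex_minnP ex) => n /andP[Nn wn] nmin.
have al0 : 0 < wprod aC (map col (mkseq w n)) by exact: wprod_gt0.
have be0 : 0 < wprod be (mkseq w n) by exact: wprod_gt0.
have kmin1 : kmin <= 1.
  have /andP[h1 h2] := be_itv (w 0%N).
  by have /andP[_ /ltW] := kmax_itv; apply: le_trans; exact: le_trans h2.
have [|m sm] := @stopped_mkseq R C aC (wprod be (mkseq w n))
  (wprod aC (map col (mkseq w n))) kmax (fun k => col (w (n + k)%N)) be0 (ltW al0) kmax_itv.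
  by move=> c; have /andP[_ ->] := aC_itv c; rewrite (ltW (a0 c)).
have sE : map col (segment w n m) = mkseq (fun k => col (w (n + k)%N)) m.
  by rewrite segment_shift /mkseq -map_comp.
exists w, n, m; split => //; last 1 first.
- have h2 : kmin * wprod be (mkseq w n) <=
      wprod aC (map col (mkseq w n)) * wprod aC (map col (segment w n m)).
    rewrite sE; apply: stopped_ge sm => //; first exact: ltW.
      by move=> c; have /andP[] := aC_itv c.
    by apply: le_trans wn; rewrite ler_piMl// ltW.
  have -> : wprod pA (mkseq w n) =
      wprod aC (map col (mkseq w n)) `^ t * wprod be (mkseq w n) `^ e.
    rewrite /pA wprodM; congr (_ * _); last exact: wprod_powR.
    by rewrite (wprod_map col); apply: (@wprod_powR _ _ (aC \o col)) => y; exact: a0.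
  have Q0 : 0 <= wprod aC (map col (segment w n m)) by apply: wprod_ge0 => c; exact: ltW.
  rewrite (@wprod_powR _ _ aC)// powRN [_^-1 * _]mulrC ler_pdivlMr ?powR_gt0//.
  rewrite powRD; last by rewrite (gt_eqF be0) implybT.
  have kb0 : 0 <= kmin * wprod be (mkseq w n) by rewrite mulr_ge0// ltW.
  have h3 : (kmin * wprod be (mkseq w n)) `^ t <=
      (wprod aC (map col (mkseq w n)) * wprod aC (map col (segment w n m))) `^ t.
    by apply: ge0_ler_powR; rewrite ?nnegrE// (le_trans kb0).
  rewrite !powRM ?(ltW al0) ?(ltW be0) ?(ltW kmin_gt0)// in h3.
  have := ler_wpM2r (powR_ge0 (wprod be (mkseq w n)) e) h3; lra.
- rewrite /G size_mkseq Nn wn /=; apply/forallP => -[k kn] /=; apply/implyP => Nk.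
  apply/negP => wk.
  have tE : take k (mkseq w n) = mkseq w k.
    by rewrite /mkseq -map_take take_iota (minn_idPl (ltnW kn)).
  by have := nmin k; rewrite Nk -tE wk => /(_ isT); rewrite leqNgt kn.
- by rewrite sE.
Qed.

End FirstReturn.

(** * A carpet with unequal dimensions *)

Lemma card_block n q m : (m < n)%N ->
  #|[pred j : 'I_(n * q) | (j %/ q == m)%N]| = q.
Proof.
move=> mn; rewrite -sum1_card big_mkcond /=.
have q0 : (0 < q)%N \/ q = 0%N by case: (q); [right|left].
case: q0 => [q0|->]; last first.
  by rewrite big1// => j; have := ltn_ord j; rewrite [X in (_ < X)%N]muln0.
pose F j := if (j %/ q == m)%N then 1%N else 0%N.
have H k : (\sum_(0 <= j < k * q) F j)%N = if (m < k)%N then q else 0%N.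
  elim: k => [|k IH]; first by rewrite mul0n big_nil.
  rewrite mulSn addnC (@big_cat_nat _ _ _ (k * q))//= ?leq_addr// IH.
  rewrite (eq_big_nat _ _ (F2 := fun=> (k == m) : nat)); last first.
    move=> j /andP[h1 h2]; rewrite /F; suff -> : (j %/ q)%N = k by case: eqP.
    rewrite -(subnKC h1) divnMDl// divn_small ?addn0// ltn_subLR//.
  rewrite sum_nat_const_nat addKn ltnS.
  by case: (ltngtP m k) => H; rewrite ?muln1 ?muln0 ?addn0 ?add0n.
rewrite (eq_bigr (fun j : 'I_(n * q) => F j))//.
by rewrite -(big_mkord xpredT F) H mn.
Qed.

(* With [x = p / n], the claim reduces to [16 x^2 - 14 x + 16 / 5 >= 0], which
   holds because [16 x^2 - 14 x + 49 / 16] is a square. *)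
Lemma frequency_inequality (R : realFieldType) (n m p p' : R) :
  0 < n -> 0 < m -> 0 <= p -> p <= n -> 0 <= p' ->
  n + 4 * p <= 2 * m -> 2 * m <= n + 4 * p + 5 -> p / n - 100^-1 <= p' / m ->
  17 * m + n / 10 <= 12 * n + 16 * p + 8 * p' + 43.
Proof.
move=> n0 m0 p0 pn p'0 k1 k2; rewrite ler_pdivlMr//.
have [x pE] : exists x, p = x * n by exists (p / n); rewrite divfK// gt_eqF.
have x0 : 0 <= x by rewrite -(pmulr_lge0 _ n0) -pE.
rewrite pE mulfK ?gt_eqF// => k3.
(* Multiplying the bound on [2 * m] by [x - 100^-1] needs its sign; for smaller [x] the bound
   [0 <= p'] is enough. *)
have [r1|r1] := leP (100^-1) x.
  have k4 : (x - 100^-1) * (n + 4 * p) <= (x - 100^-1) * (2 * m).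
    by rewrite ler_wpM2l// subr_ge0.
  have k5 : 0 <= n * (4 * x - 7 / 4) ^+ 2 by rewrite mulr_ge0 ?sqr_ge0 ?(ltW n0).
  rewrite pE in pn.
  rewrite pE in k1 k2 k4; lra.
have : 0 <= n * (100^-1 - x) by rewrite mulr_ge0 ?(ltW n0)// subr_ge0 ltW.
rewrite pE in k1 k2; lra.
Qed.

Section Example.
Variables (R : realType) (Q : nat).
Hypothesis Q_gt1 : (1 < Q)%N.
Hypothesis ln_Q : ln (Q%:R : R) = 8 * ln 2.

Local Notation q := (Q%:R : R).

Let q0 : 0 < q. Proof. by rewrite ltr0n ltnW. Qed.
Let q1 : 1 < q. Proof. by rewrite ltr1n. Qed.
Let qN0 : q != 0. Proof. by rewrite gt_eqF. Qed.

(* The rows form [Q] blocks of [Q] rows.  The first [Q ^ 4] columns are thin and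
   meet the rows of block 0; then come [Q - 1] thick columns, the [i]-th of which
   meets the rows of block [i].  The argument needs [Q] large; [Q = 2 ^ 8] makes
   all logarithms integer multiples of [ln 2]. *)
Let ncol := (Q ^ 4 + Q.-1)%N.
Let nrow := (Q * Q)%N.

Let wd (i : 'I_ncol) : R := if (i < Q ^ 4)%N then q ^- 5 else q^-1.
Let ht (j : 'I_nrow) : R := q ^- 2.
Let block (i : nat) : nat := if (i < Q ^ 4)%N then 0%N else (i - Q ^ 4).+1%N.

Let JJ : {set 'I_ncol * 'I_nrow} := [set p : 'I_ncol * 'I_nrow | (p.2 %/ Q == block p.1)%N].

Let block_lt (i : 'I_ncol) : (block i < Q)%N.
Proof.
rewrite /block; case: (ltnP i (Q ^ 4)%N) => h; first exact: ltnW.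
have := ltn_ord i; rewrite /ncol -ltn_subLR// => h'.
by apply: leq_ltn_trans h' _; rewrite prednK// ltnW.
Qed.

Let card_column i : #|[pred x : letter JJ | lcol x == i]| = Q.
Proof.
rewrite -(card_block Q (block_lt i)).
have inj : injective (fun x : letter JJ => (lcol x, lrow x)).
  by move=> x y [] h1 h2; exact: letter_inj.
rewrite -(card_imset _ inj) -(card_imset _ (f := fun j : 'I_nrow => (i, j))); last first.
  by move=> j j' [].
apply: eq_card => -[i' j']; apply/imsetP/imsetP.
  move=> [x /eqP xi [-> ->]]; exists (lrow x); last by rewrite xi.
  have := valP x; rewrite !inE /= => /eqP h; rewrite -xi; apply/eqP; exact: h.
move=> [j jb [-> ->]].
have hJ : (i, j) \in JJ by rewrite !inE.
by exists (exist _ (i, j) hJ) => //; rewrite !inE.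
Qed.

Let sum_wd : \sum_i wd i = 1.
Proof.
rewrite /wd big_split_ord /=.
under eq_bigr do rewrite ltn_ord.
under [X in _ + X]eq_bigr do rewrite ltnNge leq_addr /=.
rewrite !sumr_const !card_ord -[_ *+ (Q ^ 4)]mulr_natl -[_ *+ Q.-1]mulr_natl natrX.
have -> : Q.-1%:R = q - 1 by rewrite -[X in _ = X%:R - 1](prednK (ltnW Q_gt1)) -natr1 addrK.
by field.
Qed.

Let sum_ht : \sum_j ht j = 1.
Proof. by rewrite /ht sumr_const card_ord -[_ *+ nrow]mulr_natl natrM; field. Qed.

Let q5_itv : 0 < q ^- 5 < 1.
Proof. by rewrite invr_gt0 exprn_gt0//= invf_lt1 ?exprn_gt0// exprn_egt1. Qed.
Let q1_itv : 0 < q^-1 < 1.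
Proof. by rewrite invr_gt0 q0 invf_lt1. Qed.
Let q2_itv : 0 < q ^- 2 < 1.
Proof. by rewrite invr_gt0 exprn_gt0//= invf_lt1 ?exprn_gt0// exprn_egt1. Qed.

Let c0col_lt : (0 < ncol)%N.
Proof. by rewrite /ncol addn_gt0 expn_gt0 ltnW. Qed.
Let c0col := Ordinal c0col_lt.

Let bigcol_lt : (Q ^ 4 < ncol)%N.
Proof. by rewrite /ncol -{1}[(Q ^ 4)%N]addn0 ltn_add2l -subn1 subn_gt0. Qed.
Let bigcol := Ordinal bigcol_lt.

Let row0_lt : (0 < nrow)%N.
Proof. by rewrite /nrow muln_gt0 ltnW. Qed.
Let row0 := Ordinal row0_lt.

Let rowQ_lt : (Q < nrow)%N.
Proof. by rewrite /nrow -{1}[Q]muln1 ltn_pmul2l// ltnW. Qed.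
Let rowQ := Ordinal rowQ_lt.

Lemma example_system : baranski_system #|JJ| wd ht JJ.
Proof.
split => //.
- by rewrite /ncol; case: (Q) Q_gt1 => [|[|n]]// _; rewrite (@leq_add 1 1)// expn_gt0.
- by rewrite /nrow (leq_trans Q_gt1)// leq_pmulr// ltnW.
- apply: leq_trans Q_gt1 _; rewrite -(card_column c0col) -(card_sig (mem JJ)).
  exact: max_card.
- by have := max_card (mem JJ); rewrite card_prod !card_ord.
- by move=> i; rewrite /wd; case: ifP.
Qed.


Local Notation LL := (letter JJ).

Let sum_col_const i (g : R) : \sum_(x : LL | lcol x == i) g = g * q.
Proof.
rewrite (eq_bigl (mem [pred x : LL | lcol x == i])); last by move=> x; rewrite !inE.
by rewrite sumr_const card_column mulr_natr.
Qed.

Let sum_letter (g : 'I_ncol -> R) : \sum_(x : LL) g (lcol x) = \sum_i g i * q.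
Proof.
rewrite (partition_big (@lcol _ _ JJ) xpredT)//=; apply: eq_bigr => i _.
by rewrite -(sum_col_const i (g i)); apply: eq_bigr => x /eqP ->.
Qed.

Let column_nonempty (i : 'I_ncol) : [exists j, (i, j) \in JJ].
Proof.
have : (0 < #|[pred x : LL | lcol x == i]|)%N by rewrite card_column ltnW.
by move=> /card_gt0P[x /eqP <-]; exact: lcolP.
Qed.

Let line_nonempty (j : 'I_nrow) : [exists i, (i, j) \in JJ].
Proof.
have jQ : (j %/ Q < Q)%N by rewrite ltn_divLR ?(ltnW Q_gt1).
have [j0|j0] := posnP (j %/ Q)%N.
  apply/existsP; exists c0col; rewrite inE /= j0 /block /=.
  by rewrite expn_gt0 (ltnW Q_gt1).
have hi : (Q ^ 4 + (j %/ Q).-1 < ncol)%N.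
  by rewrite /ncol ltn_add2l -ltnS !prednK// ltnW.
apply/existsP; exists (Ordinal hi); rewrite inE /= /block.
by rewrite ltnNge leq_addr /= addKn prednK.
Qed.

Let sum_subtype (n : nat) (P : pred 'I_n) (g : 'I_n -> R) : (forall i, P i) ->
  (forall i, 0 <= g i) -> \sum_(c : {i : 'I_n | P i}) g (val c) = \sum_i g i.
Proof.
move=> Pi g0; apply/eqP; rewrite eq_le; apply/andP; split.
  apply: (@sum_inj_le R {i : 'I_n | P i} 'I_n xpredT val g) => //.
  by move=> x y _ _; exact: val_inj.
apply: (@sum_inj_le R 'I_n {i : 'I_n | P i} xpredT
  (fun i => exist _ i (Pi i)) (fun c => g (val c))) => //.
by move=> x y _ _ [].
Qed.

Let wd_gt0 i : 0 < wd i.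
Proof. by rewrite /wd; case: ifP => _; [have /andP[] := q5_itv|have /andP[] := q1_itv]. Qed.

Let sum_width : \sum_(c : column JJ) col_width wd c `^ 1 = 1.
Proof.
rewrite (eq_bigr (fun c => wd (val c))); last by move=> c _; rewrite /col_width powRr1 ?ltW.
by rewrite (sum_subtype column_nonempty)// => i; exact: ltW.
Qed.

Let sum_height : \sum_(c : line JJ) line_height ht c `^ 1 = 1.
Proof.
rewrite (eq_bigr (fun c => ht (val c))); last first.
  by move=> c _; rewrite powRr1//; have /andP[/ltW] := q2_itv.
by rewrite (sum_subtype line_nonempty)// => i; have /andP[/ltW] := q2_itv.
Qed.

Let ht_half j : ht j `^ 2^-1 = q^-1.
Proof.
rewrite /ht powR12_sqrt ?invr_ge0 ?exprn_ge0 ?ltW// -exprVn sqrtr_sqr.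
by rewrite ger0_norm// invr_ge0 ltW.
Qed.

Let sum_A : \sum_(x : LL) wd (lcol x) `^ 1 * ht (lrow x) `^ 2^-1 = 1.
Proof.
rewrite (eq_bigr (fun x => wd (lcol x) / q)); last first.
  by move=> x _; rewrite powRr1 ?ltW// ht_half.
rewrite (sum_letter (fun i => wd i / q)) -[RHS]sum_wd; apply: eq_bigr => i _.
exact: (divfK qN0).
Qed.

(** The sum decreases in the exponent and already exceeds 1 at exponent 1/2, because the square root
    favours the many thin columns. *)
Lemma example_exponent : exists2 e, 2^-1 < e &
  \sum_(x : LL) ht (lrow x) `^ 1 * wd (lcol x) `^ e = 1.
Proof.
have htE x : ht x `^ 1 = q ^- 2 by rewrite powRr1//; have /andP[/ltW] := q2_itv.
have [||||e e0 he] := @exists_exponent R LL (fun x => wd (lcol x))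
  (fun x => ht (lrow x) `^ 1).
- by move=> x; exact: (baranski_a_itv example_system).
- by move=> x; rewrite htE; have /andP[] := q2_itv.
- rewrite (eq_bigr (fun=> q ^- 2)) => [|x _]; last exact: htE.
  have /= -> := sum_letter (fun=> q ^- 2); rewrite sumr_const card_ord -[_ *+ ncol]mulr_natl.
  have -> : ncol%:R * (q ^- 2 * q) = ncol%:R / q by field.
  rewrite ler_pdivlMr// mul1r ler_nat /ncol.
  rewrite (leq_trans _ (leq_addr _ _))// -{1}[Q]expn1 leq_exp2l//.
- rewrite (eq_bigr (fun x => q ^- 2 * wd (lcol x)))//.
    rewrite (sum_letter (fun i => q ^- 2 * wd i)) -mulr_suml -mulr_sumr sum_wd mulr1.
    have -> : q ^- 2 * q = q^-1 by field.
    by have /andP[_ /ltW] := q1_itv.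
  by move=> x _; rewrite htE.
exists e => //; rewrite ltNge; apply/negP => e2.
have : 1 < \sum_(x : LL) ht (lrow x) `^ 1 * wd (lcol x) `^ e; last first.
  by rewrite he ltxx.
apply: (@lt_le_trans _ _ (\sum_(x : LL) q ^- 2 * wd (lcol x) `^ 2^-1)); last first.
  apply: ler_sum => x _; rewrite htE; apply: ler_wpM2l.
    by have /andP[/ltW] := q2_itv.
  apply: ger_powR => //; have /andP[-> h] := baranski_a_itv example_system (lcol x).
  exact: ltW.
rewrite (sum_letter (fun i => q ^- 2 * wd i `^ 2^-1)).
under eq_bigr do rewrite mulrAC.
rewrite -mulr_sumr (_ : q ^- 2 * q = q^-1); last by field.
rewrite big_split_ord /=.
(* Even with the square root of [q ^- 5] lowered to [q ^- 3], the thin columns contribute exactly 1,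
   and the thick ones make the inequality strict. *)
apply: (@lt_le_trans _ _ (q^-1 * (\sum_(i < Q ^ 4) q ^- 3 + \sum_(i < Q.-1) q^-1))).
  rewrite !sumr_const !card_ord -[_ *+ (Q ^ 4)]mulr_natl -[_ *+ Q.-1]mulr_natl natrX.
  have Q0 : 0 < Q.-1%:R :> R by rewrite ltr0n -ltnS prednK// ltnW.
  rewrite (_ : _ * _ = 1 + Q.-1%:R * q ^- 2); last by field.
  by rewrite ltrDl mulr_gt0// invr_gt0 exprn_gt0.
rewrite ler_wpM2l ?invr_ge0 ?(ltW q0)//; apply: lerD; apply: ler_sum => i _.
  rewrite /wd /= ltn_ord powR12_sqrt ?invr_ge0 ?exprn_ge0 ?(ltW q0)//.
  have -> : q ^- 3 = Num.sqrt (q ^- 6).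
    rewrite -[q ^- 6]exprVn (_ : 6%N = (3 * 2)%N)// exprM sqrtr_sqr exprVn.
    by rewrite ger0_norm// invr_ge0 exprn_ge0// ltW.
  by rewrite ler_wsqrtr// lef_pV2 ?posrE ?exprn_gt0// ler_weXn2l// ltW.
rewrite /wd /= ltnNge leq_addr /=.
by have /andP[h1 h2] := q1_itv; apply: ger1_powR; [rewrite h1 ltW|lra].
Qed.


Let lam : R := ln 2.
Let lam0 : 0 < lam. Proof. by rewrite ln_gt0// ltr1n. Qed.
Let low (j : 'I_nrow) : bool := (j %/ Q == 0)%N.
(** Indicator of the letters in thin columns, which are those in the rows of block 0. The sides and
    all weights of the example depend on a letter through [T] alone, so a code is judged by its
    frequency of thin letters. *)
Let T (x : LL) : R := (low (lrow x))%:R.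

Let low_col (x : LL) : low (lrow x) = (lcol x < Q ^ 4)%N.
Proof.
have := valP x; rewrite inE /low /lrow /lcol /block => /eqP ->.
by case: (ltnP _ (Q ^ 4)%N).
Qed.

Let ln_wd x : ln (wd (lcol x)) = - (8 * lam) + (- (32 * lam)) * T x.
Proof.
rewrite /T low_col /wd; case: ifP => _ /=.
  by rewrite lnV ?posrE ?exprn_gt0// lnXn// ln_Q -/lam -[_ *+ 5]mulr_natl; ring.
by rewrite lnV ?posrE// ln_Q -/lam; ring.
Qed.

Let ln_ht (x : LL) : ln (ht (lrow x)) = - (16 * lam).
Proof. by rewrite lnV ?posrE ?exprn_gt0// lnXn// ln_Q -/lam -[_ *+ 2]mulr_natl; ring. Qed.

(* Half of the mass goes to block 0, far more than the law of the heights gives: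
   this Bernoulli weight nearly maximizes the dimension among the laws whose typical
   rectangles are higher than wide. *)
Let qrow (j : 'I_nrow) : R := if low j then (2 * q)^-1 else (2 * q ^+ 2)^-1.
Let qrow_gt0 j : 0 < qrow j.
Proof. by rewrite /qrow; case: ifP => _; rewrite invr_gt0 mulr_gt0// exprn_gt0. Qed.

Let ln_qrow (x : LL) : ln (qrow (lrow x)) = - (17 * lam) + 8 * lam * T x.
Proof.
rewrite /T /qrow; case: ifP => _ /=.
  by rewrite lnV ?posrE ?mulr_gt0// lnM ?posrE// ln_Q -/lam; ring.
rewrite lnV ?posrE ?mulr_gt0 ?exprn_gt0// lnM ?posrE ?exprn_gt0// lnXn// ln_Q -/lam.
by rewrite -[_ *+ 2]mulr_natl; ring.
Qed.

Let sum_qrow : \sum_j qrow j <= 1.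
Proof.
apply: (@le_trans _ _ (\sum_(j < nrow | low j) (2 * q)^-1 + \sum_(j < nrow) (2 * q ^+ 2)^-1)).
  rewrite (bigID low) /=; apply: lerD.
    by apply: ler_sum => j jl; rewrite /qrow jl.
  rewrite [leRHS](bigID low) /= -[leLHS]add0r; apply: lerD.
    by apply: sumr_ge0 => j _; rewrite invr_ge0 mulr_ge0// exprn_ge0// ltW.
  by apply: ler_sum => j /negPf jl; rewrite /qrow jl.
have -> : \sum_(j < nrow) (2 * q ^+ 2)^-1 = (q * q) * (2 * q ^+ 2)^-1.
  by rewrite sumr_const card_ord -[LHS]mulr_natl natrM.
have -> : \sum_(j < nrow | low j) (2 * q)^-1 = q * (2 * q)^-1.
  rewrite (eq_bigl (mem [pred j : 'I_nrow | (j %/ Q == 0)%N])); last first.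
    by move=> j; rewrite inE.
  by rewrite sumr_const (card_block Q (ltnW Q_gt1)) -[LHS]mulr_natl.
by rewrite le_eqVlt; apply/orP; left; apply/eqP; field.
Qed.

(** Given the row, the column is uniform: a row of block 0 meets the [Q ^ 4] thin columns, any other
    row a single column. *)
Let pl (x : LL) : R := qrow (lrow x) * (if low (lrow x) then q ^- 4 else 1).
Let pl_gt0 x : 0 < pl x.
Proof. by rewrite /pl; case: ifP => _; rewrite mulr_gt0// invr_gt0 exprn_gt0. Qed.

Let ln_pl x : ln (pl x) = - (17 * lam) + (- (24 * lam)) * T x.
Proof.
rewrite /pl lnM ?posrE// ?ln_qrow /T; last by case: ifP; rewrite ?invr_gt0 ?exprn_gt0.
case: ifP => _ /=; last by rewrite ln1; ring.
rewrite lnV ?posrE ?exprn_gt0// lnXn// ln_Q -/lam -[_ *+ 4]mulr_natl; ring.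
Qed.

Let sum_pl : \sum_x pl x <= 1.
Proof.
apply: le_trans sum_qrow; rewrite (partition_big (@lrow _ _ JJ) xpredT)//=.
apply: ler_sum => j _.
rewrite (eq_bigr (fun x => qrow j * (if low j then q ^- 4 else 1))); last first.
  by move=> x /eqP xj; rewrite /pl xj.
rewrite -mulr_sumr ler_piMr ?(ltW (qrow_gt0 j))//; case: ifP => jl.
  apply: (@le_trans _ _ (\sum_(i < ncol) if (i < Q ^ 4)%N then q ^- 4 else 0)).
    pose F (i : 'I_ncol) : R := if (i < Q ^ 4)%N then q ^- 4 else 0.
    rewrite (eq_bigr (fun x => F (lcol x))); last first.
      by move=> x /eqP xj; rewrite /F -low_col xj jl.
    apply: sum_inj_le => [i|x y /eqP xj /eqP yj xy].
      by rewrite /F; case: ifP => // _; rewrite invr_ge0 exprn_ge0// ltW.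
    by apply: letter_inj => //; rewrite xj yj.
  rewrite big_split_ord /=.
  under eq_bigr do rewrite ltn_ord.
  under [X in _ + X]eq_bigr do rewrite ltnNge leq_addr /=.
  rewrite sumr_const card_ord [X in _ + X]big1// addr0 -[_ *+ (Q ^ 4)]mulr_natl natrX.
  by rewrite mulfV// expf_neq0.
apply: le_trans (@sum_inj_le R LL unit (fun x => lrow x == j) (fun=> tt)
  (fun=> 1) _ _) _ => //; last by rewrite big_const card_unit /= addr0.
move=> x y /eqP xj /eqP yj _.
have jb : (0 < j %/ Q)%N by rewrite lt0n; move/negbT: jl.
apply: letter_inj; last by rewrite xj yj.
have col_eq (z : LL) : lrow z = j -> nat_of_ord (lcol z) = ((j %/ Q).-1 + Q ^ 4)%N.
  move=> zj; have := low_col z; rewrite zj jl => /esym/negbT; rewrite -leqNgt => h.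
  have := valP z; rewrite inE -/(lrow z) -/(lcol z) zj /block ltnNge h /= => /eqP ->.
  by rewrite subnK.
by apply: val_inj; rewrite /= !col_eq.
Qed.

Section ExampleMeasure.
Variable K : set (R * R).
Hypothesis att : baranski_attractor wd ht JJ K.

Let wd_itv i : q ^- 5 <= wd i <= q^-1.
Proof.
have h : q ^- 5 <= q^-1 by rewrite lef_pV2 ?posrE ?exprn_gt0// ler_eXnr// ltW.
by rewrite /wd; case: ifP; rewrite lexx h.
Qed.

Let ht_itv j : q ^- 5 <= ht j <= q^-1.
Proof.
rewrite /ht !lef_pV2 ?posrE ?exprn_gt0//.
by rewrite ler_weXn2l ?(ltW q1)//= ler_eXnr// ltW.
Qed.

Let q5_gt0 : 0 < q ^- 5. Proof. by have /andP[] := q5_itv. Qed.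
Let q1_lt1 : q^-1 < 1. Proof. by have /andP[] := q1_itv. Qed.

Local Notation la w n := (psum (fun x : LL => ln (wd (lcol x))) w n).
Local Notation lb w n := (psum (fun x : LL => ln (ht (lrow x))) w n).

(** If a time is inefficient, the end of its extension by rows is a later time with a lower
    frequency of thin letters. The overshoot of the stopping rule, at most [40 * lam], lets twice
    the final length exceed [n + 4 * P] by at most 5; each unit of length costs [17 * lam], and
    [17 * 5 / 2 < 43]. *)
Let good_time (w : nat -> LL) N : (forall n, (N <= n)%N -> la w n <= lb w n) ->
  exists n m, [/\ (N <= n)%N,
    stopped (@line_height R _ _ ht JJ) (wprod (fun x => wd (lcol x)) (mkseq w n))
      (wprod (@line_height R _ _ ht JJ) (map (@crow _ _ JJ) (mkseq w n)))
      (map (@crow _ _ JJ) (segment w n m)) &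
    (1 + 2^-1) * ln (wprod (fun x => wd (lcol x)) (mkseq w n)) <=
      43 * lam + ln (wprod (fun x => expR (- (lam / 10)) * pl x) (mkseq w n)) +
      ln (wprod (fun c : line JJ => qrow (val c)) (map (@crow _ _ JJ) (segment w n m)))].
Proof.
move=> tw.
have laE n : la w n = - (8 * lam) * n%:R - 32 * lam * psum T w n.
  have -> : la w n = psum (fun x => (- (32 * lam)) * T x + 0 * T x + 0 * T x + (- (8 * lam))) w n.
    by congr psum; apply: funext => x; rewrite ln_wd; ring.
  by rewrite psum_lin; ring.
have lbE n : lb w n = - (16 * lam) * n%:R.
  have -> : lb w n = psum (fun x => 0 * T x + 0 * T x + 0 * T x + (- (16 * lam))) w n.
    by congr psum; apply: funext => x; rewrite ln_ht; ring.
  by rewrite psum_lin; ring.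
have T01 x : 0 <= T x <= 1 by rewrite /T; case: low; rewrite /= ?lexx ler01.
have P0 n : 0 <= psum T w n.
  by have := @psum_ge R LL T 0 w n; rewrite mul0r; apply => x; have /andP[] := T01 x.
have P1 n : psum T w n <= n%:R.
  by have := @psum_le R LL T 1 w n; rewrite mul1r; apply => x; have /andP[] := T01 x.
apply: contrapT => none.
have step n : (N <= n)%N -> (0 < n)%N -> exists2 m,
    (n <= m)%N & psum T w m / m%:R <= psum T w n / n%:R - 100^-1.
  move=> Nn n0.
  have [m [sm h1 h2]] := @stop_segment R LL (line JJ) (@crow _ _ JJ)
    (@line_height R _ _ ht JJ) (fun x => wd (lcol x)) (q ^- 5) q^-1 q5_gt0 q1_lt1
    (fun c => ht_itv _) (fun x => wd_itv _) w n (tw n Nn).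
  exists (n + m)%N; first exact: leq_addr.
  rewrite leNgt; apply/negP => good; apply: none; exists n, m; split => //.
  have {}h1 : lb w (n + m) <= la w n by exact: h1.
  have {}h2 : la w n - (- ln (q ^- 5)) <= lb w (n + m) by exact: h2.
  rewrite lnV ?posrE ?exprn_gt0// lnXn// ln_Q -/lam -[_ *+ 5]mulr_natl in h2.
  have lnp : ln (wprod (fun x => expR (- (lam / 10)) * pl x) (mkseq w n)) =
      - (lam / 10 + 17 * lam) * n%:R - 24 * lam * psum T w n.
    rewrite ln_wprod_mkseq; last by move=> x; rewrite mulr_gt0 ?expR_gt0.
    rewrite (_ : (fun x => _) = (fun x => (- (24 * lam)) * T x + 0 * T x + 0 * T x +
        (- (lam / 10 + 17 * lam)))).
      by rewrite psum_lin; ring.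
    apply: funext => x; rewrite lnM ?posrE ?expR_gt0// expRK ln_pl; ring.
  have lnq k : psum (fun x => ln (qrow (val (@crow _ _ JJ x)))) w k =
      - (17 * lam) * k%:R + 8 * lam * psum T w k.
    rewrite (_ : (fun x => _) = (fun x => 8 * lam * T x + 0 * T x + 0 * T x +
        (- (17 * lam)))).
      by rewrite psum_lin; ring.
    apply: funext => x; rewrite ln_qrow; ring.
  have lnw : ln (wprod (fun x => wd (lcol x)) (mkseq w n)) = la w n.
    by rewrite ln_wprod_mkseq.
  rewrite lnp ln_wprod_segment//= !lnq lnw laE.
  rewrite laE lbE in h1; rewrite laE lbE in h2.
  set P := psum T w n in good h1 h2 *; set P' := psum T w (n + m) in good *.
  have nR : 0 < n%:R :> R by rewrite ltr0n.
  have PP : 0 <= P <= n%:R by rewrite P0 P1.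
  have P'0 : 0 <= P' by exact: P0.
  have MR : 0 < (n + m)%:R :> R by rewrite ltr0n ltn_addr.
  move: (n%:R : R) ((n + m)%:R : R) nR MR PP good h1 h2 => nn M nR MR /andP[PP0 PP1] good h1 h2.
  (* Divided by [lam], the two bounds of the stopping rule become the hypotheses of
     [frequency_inequality], and its conclusion is the required efficiency. *)
  have k1 : nn + 4 * P <= 2 * M.
    by rewrite -(ler_pM2l lam0); lra.
  have k2 : 2 * M <= nn + 4 * P + 5.
    by rewrite -(ler_pM2l lam0); lra.
  have key := frequency_inequality nR MR PP0 PP1 P'0 k1 k2 (ltW good).
  by move: (ler_wpM2l (ltW lam0) key); lra.
(* The frequency of thin columns cannot drop by [1/100] for ever. *)
have iter k : exists n, [/\ (N <= n)%N, (0 < n)%N &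
    psum T w n / n%:R <= 1 - k%:R / 100].
  elim: k => [|k [n [Nn n0 hn]]].
    exists N.+1; split => //; rewrite mul0r subr0 ler_pdivrMr ?ltr0n// mul1r.
    exact: P1.
  have [m nm hm] := step n Nn n0; exists m; split.
  - exact: leq_trans nm.
  - exact: leq_trans nm.
  - rewrite -natr1; lra.
have [n [_ n0 hn]] := iter 101%N.
have : 0 <= psum T w n / n%:R by rewrite divr_ge0.
lra.
Qed.

Lemma example_measure_lty : (hausdorff_measure (1 + 2^-1) K < +oo)%E.
Proof.
pose s : R := 1 + 2^-1.
have s0 : 0 <= s by rewrite addr_ge0// invr_ge0.
pose M1 : R := 2 `^ s * ((q ^- 5) `^ (- 1) * 1).
pose rho : R := expR (- (lam / 10)).
pose M2 : R := 2 `^ s * (expR (43 * lam) * (1 - rho)^-1).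
apply: (@le_lt_trans _ _ (M1 + M2)%:E); last exact: ltry.
apply: (@hausdorff_measure_le _ _ _ 1) => // del del0 _.
have [N1 hN1] : exists N, 2 * q^-1 ^+ N <= del.
  have cvg0 : (fun n => q^-1 ^+ n) @ \oo --> (0 : R).
    by apply: cvg_expr; rewrite ger0_norm// invr_ge0 ltW.
  have d2 : 0 < del / 2 by rewrite divr_gt0.
  have /cvgrPdist_le/(_ _ d2) [N _ /(_ N (leqnn N))] := cvg0.
  rewrite sub0r normrN => hN; exists N; rewrite mulrC -ler_pdivlMr//.
  by apply: le_trans hN; exact: ler_norm.
have sys := example_system.
have rho1 : rho < 1 by rewrite expR_lt1 oppr_lt0 divr_gt0.
have [||||N2 hN2] := @half_cov_ln R LL (line JJ) (@crow _ _ JJ) (@line_height R _ _ ht JJ)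
  (fun x => wd (lcol x)) (q ^- 5) q^-1 q5_gt0 q1_lt1
  (fun x => wd_itv _) (@coded R _ _ wd ht JJ) snd fst (line_track sys) (lcol_track sys)
  (@edist_le_swap R) s (43 * lam) rho (fun x => expR (- (lam / 10)) * pl x)
  (fun c => qrow (val c)) s0 _ _ _ rho1 _ del del0.
- by move=> x; rewrite mulr_gt0 ?expR_gt0.
- by [].
- by rewrite -mulr_sumr ler_piMr ?expR_ge0.
- apply: le_trans sum_qrow; apply: (@sum_inj_le R (line JJ) 'I_nrow xpredT val qrow).
    by move=> j; exact: ltW.
  by move=> x y _ _; exact: val_inj.
pose N := maxn N1 N2.
have q1_itv' : 0 <= q^-1 < 1 by rewrite q1_lt1 andbT invr_ge0 ltW.
have hN : 2 * q^-1 ^+ N <= del.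
  apply: le_trans hN1; rewrite ler_pM2l//.
  by have /andP[h1 /ltW h2] := q1_itv'; apply: ler_wiXn2l => //; rewrite leq_maxl.
have cov1 := first_return_cov q5_gt0 q1_itv' (fun c => wd_itv _) (fun x => ht_itv _)
  (column_track sys) (row_track sys) (@edist_le R) ler01 (_ : 0 <= 2^-1) sum_width sum_A
  del0 hN.
have {}cov1 := cov1 (ltac:(by rewrite invr_ge0)).
apply: cov_sub (cov_setU cov1 (hN2 N (leq_maxr _ _))).
move=> x /(coded_exists sys att) [w xw].
(* [good_time] asks for rectangles at least as high as wide only from [N] on, so this division of
   the codes may depend on [del]. *)
have [[n Nn hn]|none] := pselect (exists2 n, (N <= n)%N &
    wprod (fun l : LL => ht (lrow l)) (mkseq w n) <=
    wprod (@col_width R _ _ wd JJ) (map (@ccol _ _ JJ) (mkseq w n))).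
  by left; exists w, n.
right; have [|n [m [Nn sm hm]]] := @good_time w N.
  move=> n Nn; rewrite leNgt; apply/negP => h; apply: none; exists n => //.
  have htp l : 0 < ht (lrow l) by have /andP[] := q2_itv.
  have wdp l : 0 < wd (lcol l) by exact: wd_gt0.
  rewrite wprod_map -ler_ln ?posrE; last 2 first.
  - exact: wprod_gt0.
  - by apply: wprod_gt0 => l; exact: wdp.
  rewrite !ln_wprod_mkseq//; last by move=> l; exact: wdp.
  exact: ltW.
by exists w, n, m.
Qed.

End ExampleMeasure.

(** The map with digit 0 fixes 0, while a map with positive digit has a positive offset and does not
    fix it. *)
Let fixed_eq0 (n : nat) (al : 'I_n -> R) (i j : 'I_n) (c : R) :
  (forall i, 0 < al i < 1) -> i = 0%N :> nat -> (0 < j)%N ->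
  al i * c + \sum_(k < n | (k < i)%N) al k = c ->
  al j * c + \sum_(k < n | (k < j)%N) al k = c -> False.
Proof.
move=> al01 i0 j0; have al0 k : 0 < al k by have /andP[] := al01 k.
rewrite [X in _ + X = _ -> _]big_pred0; last by move=> k; rewrite i0.
rewrite addr0 => hc.
have c0 : c = 0.
  have : (1 - al i) * c = 0 by rewrite mulrBl hc mul1r subrr.
  move/eqP; rewrite mulf_eq0 subr_eq0 gt_eqF /=; first by move/eqP.
  by have /andP[] := al01 i.
rewrite c0 mulr0 add0r => /eqP; apply/negP.
rewrite gt_eqF// (bigD1 i)/= ?i0// ltr_pwDl// sumr_ge0// => k _; exact: ltW.
Qed.

Lemma example_carpet : exists (K : set (R * R)) (D : R),
  [/\ is_baranski_carpet K, has_box_dim K D, hausdorff_dim K <> D,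
      (0 < hausdorff_measure (hausdorff_dim K) K)%E &
      (hausdorff_measure (hausdorff_dim K) K < +oo)%E].
Proof.
have sys := example_system.
have [K att fixK] := attractor_exists sys.
have h0 : 0 <= 2^-1 :> R by rewrite invr_ge0.
have H0 : (0 < hausdorff_measure (1 + 2^-1) K)%E.
  apply: (hausdorff_measure_uniform_gt0 sys att) => //.
  - move=> i; rewrite (eq_bigr (fun=> q^-1)) => [|x _]; last by rewrite ht_half.
    by rewrite sum_col_const mulVf.
  - move=> j; have s1 : \sum_i wd i `^ 1 = 1.
      by rewrite -[RHS]sum_wd; apply: eq_bigr => i _; rewrite powRr1// ltW.
    rewrite -[leRHS]s1.
    apply: (@sum_inj_le R LL 'I_ncol _ (@lcol _ _ JJ) (fun i => wd i `^ 1)) => [i|].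
      exact: powR_ge0.
    move=> x y /eqP xj /eqP yj xy; apply: letter_inj => //.
    by rewrite xj yj.
have H1 := example_measure_lty att.
have dimE : hausdorff_dim K = 1 + 2^-1.
  by apply: hausdorff_dim_eq H0 H1; rewrite addr_ge0.
have [e e2 he] := example_exponent.
have e0 : 0 <= e by apply: le_trans h0 (ltW e2).
have box := carpet_box_dim sys att ler01 h0 ler01 e0 sum_width sum_height sum_A he.
have dim_neq : hausdorff_dim K <> Num.max (1 + 2^-1) (1 + e).
  rewrite dimE => /eqP; apply/negP; rewrite lt_eqF// lt_max; apply/orP; right.
  by rewrite ltrD2l.
rewrite -dimE in H0 H1.
suff carpetK : is_baranski_carpet K by exists K, (Num.max (1 + 2^-1) (1 + e)).
(* One letter has digit 0 on both axes and the other positive digits on both, so their fixed points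
   share no coordinate. *)
have lowJ : (c0col, row0) \in JJ.
  by rewrite inE /= /block /= div0n expn_gt0 (ltnW Q_gt1).
have bigJ : (bigcol, rowQ) \in JJ.
  by rewrite inE /= /block /= ltnn subnn divnn (ltnW Q_gt1).
have [[x1 x2] Kx [ex1 ex2]] := fixK (exist _ (c0col, row0) lowJ).
have [[y1 y2] Ky [ey1 ey2]] := fixK (exist _ (bigcol, rowQ) bigJ).
exists ncol, nrow, #|JJ|, wd, ht, JJ; split => //.
- exists (c0col, row0) => //=; rewrite /wd /ht /= expn_gt0 (ltnW Q_gt1) /=.
  by rewrite lt_eqF// ltf_pV2 ?posrE ?exprn_gt0// ltr_eXn2l.
- move=> c Kc; have /= xc := Kc _ Kx; have /= yc := Kc _ Ky.
  rewrite xc in ex1; rewrite yc in ey1.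
  apply: (fixed_eq0 (baranski_a_itv sys) _ _ ex1 ey1) => //=.
  by rewrite expn_gt0 (ltnW Q_gt1).
- move=> c Kc; have /= xc := Kc _ Kx; have /= yc := Kc _ Ky.
  rewrite xc in ex2; rewrite yc in ey2.
  apply: (fixed_eq0 (baranski_b_itv sys) _ _ ex2 ey2) => //=.
  by rewrite (ltnW Q_gt1).
Qed.

End Example.

Lemma unequal_dimensions_measure (R : realType) : exists (K : set (R * R)) (D : R),
  [/\ is_baranski_carpet K, has_box_dim K D, hausdorff_dim K <> D,
      (0 < hausdorff_measure (hausdorff_dim K) K)%E &
      (hausdorff_measure (hausdorff_dim K) K < +oo)%E].
Proof.
have [Q [Q1 lnQ]] : exists Q, (1 < Q)%N /\ ln (Q%:R : R) = 8 * ln 2.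
  exists (2 ^ 8)%N; split; first by rewrite -{1}(expn0 2) ltn_exp2l.
  by rewrite natrX lnXn ?ltr0n// mulr_natl.
exact: example_carpet Q1 lnQ.
Qed.

Theorem corollary1p2 (R : realType) :
  (forall (K : set (R * R)) (D : R),
     is_baranski_carpet K -> has_box_dim K D -> hausdorff_dim K = D ->
     (0 < hausdorff_measure (hausdorff_dim K) K)%E /\
     (hausdorff_measure (hausdorff_dim K) K < +oo)%E)
  /\
  (exists (K : set (R * R)) (D : R),
     [/\ is_baranski_carpet K, has_box_dim K D, hausdorff_dim K <> D,
         (0 < hausdorff_measure (hausdorff_dim K) K)%E &
         (hausdorff_measure (hausdorff_dim K) K < +oo)%E]).
Proof.
split; first by move=> K D; exact: equal_dimensions_measure.
exact: unequal_dimensions_measure.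
Qed.
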